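(* Let $I\subseteq\mathbb{R}$ be an open interval and $a,b\in\operatorname{AC}(I)$ real-valued with $a(s)\neq 0$ and $b(s)\geq b_0>0$ for every $s\in I$ and some positive constant $b_0$. Assume that $f:I\times[b_0,\infty)\to\mathbb{C}$ satisfies the following conditions. (i) $f(\cdot,y)\in\operatorname{AC}(I)$ for every $y\in[b_0,\infty)$. (ii) There exist $n\in\mathbb{N}$, $\alpha\geq 0$ with $n>\alpha+3$ such that $f(s,\cdot)\in C_\alpha^n([b_0,\infty))$ and $\frac{\partial f}{\partial s}(s,\cdot)\in C_{\alpha+2}^n([b_0,\infty))$ for almost every $s\in I$, and the norms $\Vert f(s,\cdot)\Vert_{C_\alpha^n([b_0,\infty))}$ and $\Vert\frac{\partial f}{\partial s}(s,\cdot)\Vert_{C_{\alpha+2}^n([b_0,\infty))}$ are locally bounded on $I$. Then the oscillatory integral $$\psi(s):=\lim_{\varepsilon\to 0^+}\int_{b(s)}^\infty e^{-\varepsilon(y-y_0)^2}e^{ia(s)y^2}f(s,y)\,dy$$ exists for every $s\in I$, is independent of $y_0\in\mathbb{R}$, and defines a function $\psi\in\operatorname{AC}(I)$. Furthermore, the derivative of $\psi$ exists for almost every $s\in I$ and is given by $$\frac{d}{ds}\psi(s)=-b'(s)e^{ia(s)b(s)^2}f(s,b(s))+\lim_{\varepsilon\to 0^+}\int_{b(s)}^\infty e^{-\varepsilon(y-y_0)^2}\frac{d}{ds}\big(e^{ia(s)y^2}f(s,y)\big)\,dy.$$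
   Context: For an open interval $I\subseteq\mathbb{R}$, $\operatorname{AC}(I)$ denotes the functions $f:I\to\mathbb{C}$ for which there is $g\in L^1_{\mathrm{loc}}(I)$ with $f(s_2)-f(s_1)=\int_{s_1}^{s_2}g(s)\,ds$ for all $s_1<s_2$ in $I$ (then $f$ is differentiable almost everywhere with $f'=g$). For $b>0$, $n\in\mathbb{N}_0$, $\alpha\geq 0$, let $C^n_\alpha([b,\infty)):=\{f\in C^n([b,\infty)) : \text{there is } M\geq 0 \text{ with } |f^{(n)}(y)|\leq My^\alpha \text{ for all } y\in[b,\infty)\}$ (complex-valued functions), with norm $$\Vert f\Vert_{C_\alpha^n([b,\infty))}:=\sum_{k=0}^{n-1}\frac{|f^{(k)}(b)|}{b^{n-k+\alpha}}+\sup_{y\in[b,\infty)}\frac{|f^{(n)}(y)|}{y^\alpha}.$$ *)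

(* Defs.v *)
From HB Require Import structures.
From mathcomp Require Import all_boot all_order all_algebra.
From mathcomp Require Import all_classical all_reals all_analysis.
From mathcomp Require Import complex.

Set Implicit Arguments.
Unset Strict Implicit.
Unset Printing Implicit Defensive.

Import Order.TTheory GRing.Theory Num.Theory.
Import numFieldNormedType.Exports.

Local Open Scope classical_set_scope.
Local Open Scope ring_scope.
Local Open Scope complex_scope.

(* The usual topology of the complex plane, as for any numFieldType. *)
HB.instance Definition _ (R : realType) :=
  PseudoPointedMetric.copy R[i] R[i]^o.
HB.instance Definition _ (R : realType) := NormedModule.copy R[i] R[i]^o.

Section Defs.
Context {R : realType}.
Implicit Types (I D A : set R) (f g u : R -> R[i]).

Local Notation mu := (@lebesgue_measure R).

Definition expi (t : R) : R[i] := cos t +i* sin t.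

(* Derivatives of functions that are only meaningful on D.  The difference
   quotient ranges over points of D, so the derivative is one-sided at an end
   point of D that belongs to D, and is the ordinary one if D is open. *)
Definition dquot f (x y : R) : R[i] := (f y - f x) / (y - x)%:C.

Definition derivable_on D f (x : R) : Prop :=
  cvg (dquot f x y @[y --> within D x^']).

Definition derive_on D f (x : R) : R[i] :=
  lim (dquot f x y @[y --> within D x^']).

Definition derive_on_n D (k : nat) f : R -> R[i] := iter k (derive_on D) f.

Definition cintegrable A g : Prop :=
  mu.-integrable A (EFin \o (fun x => complex.Re (g x))) /\
  mu.-integrable A (EFin \o (fun x => complex.Im (g x))).

Definition cintegral A g : R[i] :=
  (\int[mu]_(x in A) complex.Re (g x)) +i* (\int[mu]_(x in A) complex.Im (g x)).

Definition L1loc I g : Prop :=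
  locally_integrable I (fun x => complex.Re (g x)) /\
  locally_integrable I (fun x => complex.Im (g x)).

Definition AC_on I f : Prop :=
  exists2 g, L1loc I g &
    forall s1 s2, I s1 -> I s2 -> s1 < s2 ->
      f s2 - f s1 = cintegral `[s1, s2] g.

Definition Cn (n : nat) D f : Prop :=
  (forall k, (k < n)%N -> forall y, D y -> derivable_on D (derive_on_n D k f) y)
  /\ {within D, continuous (derive_on_n D n f)}.

Definition Cn_growth (n : nat) (alpha b : R) f : Prop :=
  Cn n `[b, +oo[ f /\
  exists2 M : R, 0 <= M &
    forall y, b <= y ->
      Normc.normc (derive_on_n `[b, +oo[ n f y) <= M * y `^ alpha.

(* Extended-real valued; finite on Cn_growth n alpha b. *)
Definition Cn_growth_norm (n : nat) (alpha b : R) f : \bar R :=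
  ((\sum_(k < n) Normc.normc (derive_on_n `[b, +oo[ k f b)
                   / b `^ ((n - k)%:R + alpha))%:E
   + ereal_sup [set (Normc.normc (derive_on_n `[b, +oo[ n f y) / y `^ alpha)%:E
               | y in `[b, +oo[])%E.

(* Local boundedness of a function that is defined almost everywhere on I. *)
Definition ae_locally_bounded I (N : R -> \bar R) : Prop :=
  forall s0, I s0 -> exists M : R, exists2 U, nbhs s0 U &
    {ae mu, forall s, I s -> U s -> (N s <= M%:E)%E}.

(* l is the Gauss-regularized integral of g over [c, +oo[:
   l = lim_{eps -> 0+} int_c^oo exp(- eps (y - y0)^2) g(y) dy,
   each of these integrals being an absolutely convergent one. *)
Definition gauss_reg (eps y0 : R) g : R -> R[i] :=
  fun y => (expR (- eps * (y - y0) ^+ 2))%:C * g y.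

Definition is_osc_integral (c y0 : R) g (l : R[i]) : Prop :=
  (forall eps, 0 < eps -> cintegrable `[c, +oo[ (gauss_reg eps y0 g)) /\
  cintegral `[c, +oo[ (gauss_reg eps y0 g) @[eps --> 0^'+] --> l.

End Defs.

(* Main.v *)
Require Import Defs.
From HB Require Import structures.
From mathcomp Require Import all_boot all_order all_algebra.
From mathcomp Require Import all_classical all_reals all_analysis.
From mathcomp Require Import measurable_realfun complex.
From mathcomp Require Import ring lra.

Set Implicit Arguments.
Unset Strict Implicit.
Unset Printing Implicit Defensive.

Import Order.TTheory GRing.Theory Num.Theory.
Import numFieldNormedType.Exports.

Local Open Scope classical_set_scope.
Local Open Scope ring_scope.
Local Open Scope complex_scope.


(** Why the theorem holds. For a regularization parameter [eps > 0], let
    [Psi_eps s] be the integral of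
    [exp(- eps (y - y0)^2) exp(i a(s) y^2) f(s, y)] over [[b(s), +oo[]. The
    Gaussian beats every power of [y], so that classical arguments apply: the
    integrand and its increments in [s] are dominated, [Psi_eps] is absolutely
    continuous, and its derivative [X_eps] is almost everywhere given by the
    Leibniz rule, as a boundary term with the factor [b'] plus the regularized
    integral of [exp(i a y^2) (i a' y^2 f + f_s)], where [f_s] is the derivative
    of [f] in [s] ([moving_cintegral_AC]). The theorem is the limit
    [eps -> 0+] in
    [Psi_eps t - Psi_eps s = int_s^t X_eps]. By dominated convergence in the
    parameter it suffices that [X_eps] converges almost everywhere, to a limit
    that does not depend on [y0], and is bounded by a locally integrable function
    uniformly in [eps] and [y0] ([AC_climit]).

    Both facts are instances of one estimate for oscillatory integrals,
    [osc_integral_symb]. The kernel [E = exp(- eps (y - y0)^2 + i a y^2)] has the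
    derivative [2 w E] with [w = - eps (y - y0) + i a y], and since
    [`|w| >= `|a| y] for all [eps], the factor [1 / (2 w)] behaves like [1 / y]
    uniformly in [eps]. Writing [E = E' / (2 w)] and integrating by parts replaces
    an amplitude [G] by [- (G / (2 w))'], which gains two powers of [y] at the cost
    of one derivative. The classes [symb] record how amplitudes behave under this
    step. A function with [n]-th derivative of order [y^alpha] is an amplitude of
    order [alpha + n] with [n] derivatives ([growth_symb]); the factor
    [i a' y^2 f + f_s] has order [alpha + n + 2], and after [n] steps the order is
    [alpha + 2 - n], which is integrable at infinity exactly if [n > alpha + 3].

    Two points need care. That a function with increments dominated by an
    integral and with a known derivative almost everywhere is the integral of
    this derivative ([dominated_AC], [AC_criterion]) is proved with Fatou's lemma
    for monotone functions; so the density of [Psi_eps] is identified without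
    exchanging integrals in [s] and [y]. And the regularity of [f] in [y]
    holds for almost every [s] only, whereas [psi] is to exist at every [s]: at an
    exceptional [s] the Lipschitz bound in [s] still makes the regularized
    integrals converge absolutely ([data_bound], [data_measurable]), and their
    limit as [eps -> 0+] exists because it does at a nearby good point and the
    increments converge. *)

(** * Integrable real functions *)

Section RealIntegrable.
Context {R : realType}.
Local Notation mu := (@lebesgue_measure R).
Local Notation intg D f := (mu.-integrable D (EFin \o f)).
Implicit Types (D : set R) (f g : R -> R).

Lemma integrable_ext D f g : measurable D ->
  (forall x, D x -> f x = g x) -> intg D f -> intg D g.
Proof.
by move=> mD fg; apply: eq_integrable => // x; rewrite inE => Dx /=; rewrite fg.
Qed.

Lemma integrable_add D f g : measurable D ->
  intg D f -> intg D g -> intg D (fun x => f x + g x).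
Proof. by move=> mD fi gi; have := @integrableD _ _ _ mu D mD _ _ fi gi. Qed.

Lemma integrable_sub D f g : measurable D ->
  intg D f -> intg D g -> intg D (fun x => f x - g x).
Proof. by move=> mD fi gi; have := @integrableB _ _ _ mu D mD _ _ fi gi. Qed.

Lemma integrable_scale D (k : R) f : measurable D ->
  intg D f -> intg D (fun x => k * f x).
Proof. by move=> mD fi; have := @integrableZl _ _ _ mu D mD k _ fi. Qed.

Lemma integrable_measurable D f : intg D f -> measurable_fun D f.
Proof. by case/integrableP => /measurable_EFinP. Qed.

Lemma integrable_dominated D f g : measurable D -> measurable_fun D f ->
  intg D g -> (forall x, D x -> `|f x| <= g x) -> intg D f.
Proof.
move=> mD mf gi fg; apply: le_integrable gi => //; first exact/measurable_EFinP.
by move=> x Dx; rewrite /= lee_fin (le_trans (fg x Dx))// ler_norm.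
Qed.

Lemma subset_itvcc (p q s t : R) : p <= s -> t <= q ->
  `[s, t]%classic `<=` `[p, q]%classic.
Proof. by move=> ps tq; apply: subset_itv; rewrite bnd_simp. Qed.

Lemma integrable_subitv (p q s t : R) f : p <= s -> t <= q ->
  intg `[p, q] f -> intg `[s, t] f.
Proof.
by move=> ps tq; apply: integrableS => //; exact: subset_itvcc.
Qed.

Lemma integrable_itv_cst (s t z : R) : intg `[s, t] (fun _ => z).
Proof.
apply: continuous_compact_integrable; first exact: segment_compact.
by apply: continuous_subspaceT => ?; exact: cvg_cst.
Qed.

Lemma Rintegral_itv_cst (s t z : R) : s <= t ->
  \int[mu]_(x in `[s, t]) z = z * (t - s).
Proof.
have muE := @lebesgue_measure_itv R `[s, t].
rewrite Rintegral_cst// [X in fine X]muE /= lte_fin.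
rewrite le_eqVlt => /predU1P[->|st]; first by rewrite ltxx/= subrr.
by rewrite st.
Qed.
End RealIntegrable.

(** * Almost everywhere derivatives of monotone functions *)

Section Monotone.
Context {R : realType}.
Local Notation mu := (@lebesgue_measure R).
Implicit Types (t H g : R -> R).

Lemma ae_neq (p : R) : {ae mu, forall x, x != p}.
Proof.
exists [set p]; split => //; first by rewrite lebesgue_measure_set1.
by move=> x /= /negP; rewrite negbK => /eqP.
Qed.

Lemma ae_mp (P Q : R -> Prop) : {ae mu, forall x, P x} ->
  (forall x, P x -> Q x) -> {ae mu, forall x, Q x}.
Proof.
by move=> h PQ; apply: filterS h; [exact: (ae_filter_ringOfSetsType mu)|exact: PQ].
Qed.

Lemma ae_mp2 (P Q S : R -> Prop) : {ae mu, forall x, P x} ->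
  {ae mu, forall x, Q x} -> (forall x, P x -> Q x -> S x) ->
  {ae mu, forall x, S x}.
Proof.
move=> h1 h2 PQ; apply: filterS2 h1 h2; last exact: PQ.
exact: (ae_filter_ringOfSetsType mu).
Qed.

Lemma ae_mp3 (P Q S T : R -> Prop) : {ae mu, forall x, P x} ->
  {ae mu, forall x, Q x} -> {ae mu, forall x, S x} ->
  (forall x, P x -> Q x -> S x -> T x) -> {ae mu, forall x, T x}.
Proof.
move=> h1 h2 h3 PQ.
have h12 : {ae mu, forall x, P x /\ Q x} by apply: (ae_mp2 h1 h2).
by apply: (ae_mp2 h12 h3) => x [Px Qx] Sx; exact: PQ.
Qed.

Lemma ae_eq_Rintegral (D : set R) (f g : R -> R) : measurable D ->
  mu.-integrable D (EFin \o f) -> measurable_fun D g ->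
  {ae mu, forall x, D x -> f x = g x} ->
  mu.-integrable D (EFin \o g) /\
  \int[mu]_(x in D) f x = \int[mu]_(x in D) g x.
Proof.
move=> mD /[dup] fi /integrableP[mf fy] mg fg; split; last first.
  rewrite /Rintegral; congr fine; apply: ae_eq_integral => //.
    exact/measurable_EFinP.
  by apply: (ae_mp fg) => x fgx Dx; rewrite fgx.
apply/integrableP; split; first exact/measurable_EFinP.
apply: le_lt_trans fy; rewrite le_eqVlt; apply/orP; left; apply/eqP.
apply: ae_eq_integral => //.
- by apply: measurableT_comp => //; exact/measurable_EFinP.
- exact: measurableT_comp.
- by apply: (ae_mp fg) => x fgx Dx; rewrite /= fgx.
Qed.

Lemma is_derive_quot t (x l : R) (u : R^nat) : is_derive x 1 t l ->
  (forall n, u n != 0) -> u @ \oo --> 0 ->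
  (t (x + u n) - t x) / u n @[n --> \oo] --> l.
Proof.
move=> [d dE] u0 cu.
have : h^-1 *: (t (h *: 1 + x) - t x) @[h --> 0^'] --> l by rewrite -dE; exact: d.
move=> H0.
rewrite [X in X @ _ --> _](_ : _ =
  (fun h => h^-1 *: (t (h *: 1 + x) - t x)) \o u); last first.
  by apply/funext => n /=; rewrite /GRing.scale/= mulr1 [u n + x]addrC mulrC.
apply: cvg_comp H0 => A; rewrite /nbhs/= => -[e /= e0 eA].
move/cvgr0Pnorm_lt : cu => /(_ _ e0); apply: filterS => n ue.
by apply: eA; [rewrite /= sub0r normrN|exact: u0].
Qed.

Lemma continuous_antiderivative t (c : R) : continuous t ->
  exists F : R -> R, forall x, c < x -> is_derive x 1 F (t x).
Proof.
move=> ct; exists (fun x => \int[mu]_(y in `[c, x]) t y)%R => x cx.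
have it : mu.-integrable `[c, x + 1] (EFin \o t).
  apply: continuous_compact_integrable; first exact: segment_compact.
  by apply: continuous_subspaceT.
have xx1 : x < x + 1 by rewrite ltrDl.
have [d e] := continuous_FTC1_closed xx1 it cx (ct x).
by apply: DeriveDef; [exact: d|rewrite -derive1E; exact: e].
Qed.

(** If [F] is an antiderivative of [t], the integral is the difference of the
    means of [t] over [[q, q + h]] and over [[p, p + h]]. *)
Lemma integral_increment_le t (p q h : R) : p < q -> 0 < h ->
  {homo t : x y / x <= y} -> continuous t ->
  (\int[mu]_(x in `[p, q]) ((t (x + h) - t x) / h)%:E <= (t (q + h) - t p)%:E)%E.
Proof.
move=> pq h0 mt ct.
have [F dF] := continuous_antiderivative (p - 1) ct.
pose G x := (F (x + h) - F x) / h.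
have dFh x : p - 1 < x -> is_derive x 1 F (t x) by exact: dF.
have dG x : p - 1 < x -> is_derive x 1 G ((t (x + h) - t x) / h).
  move=> px.
  have d1 : is_derive x 1 (fun y => F (y + h)) (t (x + h)).
    rewrite -[t _]mulr1; apply: (@is_derive1_comp _ F (fun y => y + h)).
    - by apply: dF; lra.
    - by rewrite -[1 in X in is_derive _ _ _ X]addr0; apply: is_deriveD.
  have d2 := is_deriveM (is_deriveB d1 (dFh x px)) (is_derive_cst (h^-1) x 1).
  by apply: is_derive_eq d2 _; rewrite scaler0 add0r /GRing.scale/= mulrC.
rewrite (@continuous_FTC2 _ _ G) //.
- rewrite -EFinB lee_fin /G -mulrBl ler_pdivrMr//.
  have m1 : exists2 c, c \in `]q, q + h[ & F (q + h) - F q = t c * (q + h - q).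
    apply: MVT; first by rewrite ltrDl.
      by move=> x; rewrite in_itv/= => /andP[qx _]; apply: dF; lra.
    apply: derivable_within_continuous => x; rewrite in_itv/= => /andP[qx _].
    by have [] : is_derive x 1 F (t x) by apply: dF; lra.
  have m2 : exists2 c, c \in `]p, p + h[ & F (p + h) - F p = t c * (p + h - p).
    apply: MVT; first by rewrite ltrDl.
      by move=> x; rewrite in_itv/= => /andP[qx _]; apply: dF; lra.
    apply: derivable_within_continuous => x; rewrite in_itv/= => /andP[qx _].
    by have [] : is_derive x 1 F (t x) by apply: dF; lra.
  case: m1 => c /[!in_itv]/= /andP[qc cq] ->; case: m2 => d /[!in_itv]/= /andP[pd dq] ->.
  rewrite !(addrAC _ h) !subrr !add0r -mulrBl ler_wpM2r//; first exact: ltW.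
  by apply: lerB; apply: mt; exact: ltW.
- apply: continuous_subspaceT => x; apply: cvgM; last exact: cvg_cst.
  apply: cvgB; last exact: ct.
  apply: (@continuous_comp _ _ _ (fun y => y + h) t); last exact: ct.
  by apply: cvgD; [exact: cvg_id|exact: cvg_cst].
- have cG x : p - 1 < x -> {for x, continuous G}.
    move=> px; apply/differentiable_continuous/derivable1_diffP.
    by have [] := dG _ px.
  split.
  + move=> x /[!in_itv]/= /andP[px _].
    by have [] : is_derive x 1 G ((t (x + h) - t x) / h) by apply: dG; lra.
  + by apply: cvg_at_right_filter; apply: cG; lra.
  + by apply: cvg_at_left_filter; apply: cG; lra.
- move=> x /[!in_itv]/= /andP[px _]; rewrite derive1E.
  by have [] : is_derive x 1 G ((t (x + h) - t x) / h) by apply: dG; lra.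
Qed.

(** Fatou's lemma for the difference quotients with steps [1/(k+1)], whose
    integrals are bounded by [integral_increment_le]. A monotone function can
    increase by more than the integral of its derivative, so that an inequality
    is all that one gets. *)
Lemma ge0_integral_derive_le t g (p q : R) : p < q ->
  {homo t : x y / x <= y} -> continuous t ->
  measurable_fun `[p, q] g -> (forall x, p <= x <= q -> 0 <= g x) ->
  {ae mu, forall x, p < x < q -> is_derive x 1 t (g x)} ->
  (\int[mu]_(x in `[p, q]) (g x)%:E <= (t q - t p)%:E)%E.
Proof.
move=> pq mt ct mg g0 dg.
pose u (n : nat) : R := n.+1%:R^-1.
have u0 n : 0 < u n by rewrite invr_gt0.
have cu : u @ \oo --> 0 by exact: cvg_harmonic.
pose f n x := ((t (x + u n) - t x) / u n)%:E.
have cf n : continuous (fun x => (t (x + u n) - t x) / u n).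
  move=> x; apply: cvgM; last exact: cvg_cst.
  apply: cvgB; last exact: ct.
  apply: (@continuous_comp _ _ _ (fun y => y + u n) t); last exact: ct.
  by apply: cvgD; [exact: cvg_id|exact: cvg_cst].
have mf n : measurable_fun `[p, q] (f n).
  apply/measurable_EFinP; apply: measurable_funTS.
  by apply: continuous_measurable_fun; exact: cf.
have f0 n x : `[p, q]%classic x -> (0 <= f n x)%E.
  move=> _; rewrite lee_fin divr_ge0// ?(ltW (u0 n))// subr_ge0; apply: mt.
  by rewrite lerDl ltW.
have := @fatou _ _ _ mu `[p, q] (measurable_itv _) f mf f0.
rewrite (@ge0_ae_eq_integral _ _ _ mu _ _ (fun x => (g x)%:E))//.
- move=> /le_trans; apply.
  have ct1 : (t (q + u n) - t p)%:E @[n --> \oo] --> (t q - t p)%:E.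
    apply/fine_cvgP; split; first exact: nearW.
    apply: cvgB; last exact: cvg_cst.
    have cqu : q + u n @[n --> \oo] --> q.
      by rewrite -[X in _ --> X]addr0; apply: cvgD; [exact: cvg_cst|exact: cu].
    exact: (@cvg_comp _ _ _ (fun n => q + u n) t _ _ _ cqu (ct q)).
  rewrite -(cvg_lim _ ct1)// limn_einf_lim.
  apply: lee_lim; [exact: is_cvg_einfs|exact: cvgP ct1|].
  apply: nearW => n; apply: le_trans (integral_increment_le pq (u0 n) mt ct).
  by apply: ereal_inf_lbound; exists n => /=.
- pose fN n x := (- f n x)%E.
  rewrite (_ : (fun _ => _) = -%E \o (fun x => limn_esup (fN ^~ x))).
    apply: measurableT_comp => //; apply: measurable_fun_limn_esup => n.
    apply/measurable_EFinP; apply: measurable_funTS.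
    have cN : continuous (fun x => - ((t (x + u n) - t x) / u n)).
      by move=> x; apply: cvgN; exact: cf.
    exact: continuous_measurable_fun.
  by apply/funext => x /=; rewrite limn_esupN oppeK.
- exact/measurable_EFinP.
- move=> x xpq; rewrite limn_einf_lim; apply: lime_ge; first exact: is_cvg_einfs.
  apply: nearW => n; apply: le_ereal_inf_tmp => _ [k /= _ <-]; exact: f0.
- apply: (ae_mp3 dg (ae_neq p) (ae_neq q)) => x dx xp xq /=.
  rewrite in_itv/= => /andP[px xq'].
  have {}dx : is_derive x 1 t (g x) by apply: dx; rewrite !lt_neqAle px xq' eq_sym xp xq.
  have c : f n x @[n --> \oo] --> (g x)%:E.
    apply/fine_cvgP; split; first exact: nearW.
    by apply: is_derive_quot => // n; rewrite gt_eqF.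
  by rewrite (is_cvg_limn_einfE (cvgP _ c)); exact: cvg_lim.
Qed.

(** The derivative of a nondecreasing function is nonnegative where it exists,
    so that passing to [max(g, 0)] changes [g] on a null set only. *)
Lemma integral_derive_le t g (p q : R) : p < q ->
  {homo t : x y / x <= y} -> continuous t ->
  measurable_fun `[p, q] g ->
  {ae mu, forall x, p < x < q -> is_derive x 1 t (g x)} ->
  mu.-integrable `[p, q] (EFin \o g) /\
  \int[mu]_(x in `[p, q]) g x <= t q - t p.
Proof.
move=> pq mt ct mg dg; pose h x := Num.max (g x) 0.
have mh : measurable_fun `[p, q] h by exact: measurable_maxr.
have dh : {ae mu, forall x, p < x < q -> is_derive x 1 t (h x) /\ g x = h x}.
  apply: (ae_mp dg) => x dx xpq; have {}dx := dx xpq.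
  suff -> : h x = g x by [].
  apply/max_idPl.
  have u0 n : (n.+1%:R^-1 : R) != 0 by [].
  have c := is_derive_quot dx u0 cvg_harmonic.
  rewrite -(cvg_lim _ c)//; apply: limr_ge; first exact: cvgP c.
  apply: nearW => n; rewrite divr_ge0 ?invr_ge0// subr_ge0; apply: mt.
  by rewrite lerDl invr_ge0.
have h0 x : 0 <= h x by rewrite le_max lexx orbT.
have ih : (\int[mu]_(x in `[p, q]) (h x)%:E <= (t q - t p)%:E)%E.
  apply: ge0_integral_derive_le => //.
  by apply: (ae_mp dh) => x dx pxq; exact: (dx pxq).1.
have hi : mu.-integrable `[p, q] (EFin \o h).
  apply/integrableP; split; first exact/measurable_EFinP.
  under eq_integral do rewrite /= ger0_norm//.
  by apply: le_lt_trans ih _; rewrite ltry.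
have [gi <-] : mu.-integrable `[p, q] (EFin \o g) /\
    \int[mu]_(x in `[p, q]) h x = \int[mu]_(x in `[p, q]) g x.
  apply: ae_eq_Rintegral => //.
  apply: (ae_mp3 dh (ae_neq p) (ae_neq q)) => x dx xp xq /=.
  rewrite in_itv/= => /andP[px xq'].
  by apply/esym/(dx _).2; rewrite !lt_neqAle px xq' eq_sym xp xq.
by split => //; rewrite -lee_fin /Rintegral fineK//; exact: integrable_fin_num.
Qed.
End Monotone.

(** * Functions whose increments are dominated by an integral *)

Section DominatedAC.
Context {R : realType}.
Local Notation mu := (@lebesgue_measure R).
Implicit Types (f psi H g : R -> R).

(** The retraction of the line onto [[p, q]]. Composition with it extends a
    function on [[p, q]] by its end values, and keeps continuity and
    monotonicity. *)
Definition clamp (p q x : R) := Num.min (Num.max x p) q.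

Lemma clamp_itv (p q x : R) : p <= q -> p <= clamp p q x <= q.
Proof. by move=> pq; rewrite /clamp le_min pq ge_min lexx le_max lexx !orbT. Qed.

Lemma clamp_id (p q x : R) : p <= x <= q -> clamp p q x = x.
Proof. by move=> /andP[px xq]; rewrite /clamp max_l// min_l. Qed.

Lemma clamp_homo (p q : R) : {homo clamp p q : x y / x <= y}.
Proof.
move=> x y xy; rewrite /clamp; apply: le_min2 => //.
exact: le_max2.
Qed.

Lemma continuous_clamp (p q : R) f : p <= q ->
  {within `[p, q], continuous f} -> continuous (f \o clamp p q).
Proof.
move=> pq /subspace_continuousP cf x.
have c : {for x, continuous (clamp p q)}.
  apply: (@continuous_min _ _ (fun x => Num.max x p) (cst q)); last exact: cvg_cst.
  by apply: continuous_max; [exact: cvg_id|exact: cvg_cst].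
have := cf (clamp p q x); rewrite /= in_itv/= clamp_itv// => /(_ isT).
apply: cvg_comp => A; rewrite /within/= => wA.
have c' : \forall y \near x, `[p, q]%classic (clamp p q y) -> A (clamp p q y).
  exact: (c _ wA).
apply: filterS c' => y; apply.
by rewrite /= in_itv/= clamp_itv.
Qed.

Lemma is_derive_clamp (p q x l : R) f : p < x < q ->
  is_derive x 1 f l -> is_derive x 1 (f \o clamp p q) l.
Proof.
move=> /andP[px xq]; apply: near_eq_is_derive.
near=> z; rewrite /= clamp_id//; apply/andP; split; near: z.
  by apply: filterS (lt_nbhsr px) => y /ltW.
exact: lt_le_nbhsl.
Unshelve. all: by end_near. Qed.

(** The Lebesgue differentiation theorem, applied to the extension of [H] by
    zero. *)
Lemma derive_integral H (p q : R) : p < q ->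
  mu.-integrable `[p, q] (EFin \o H) ->
  {ae mu, forall x, p < x < q ->
    is_derive x 1 (fun y => \int[mu]_(z in `[p, y]) H z) (H x)}.
Proof.
move=> pq iH.
have := lebesgue_differentiation (integrable_locally (measurable_itv _) iH).
move=> /ae_mp; apply => x lx /andP[px xq].
pose G := H \_ `[p, q].
have iG : mu.-integrable `[p, q] (EFin \o G).
  by rewrite /G -restrict_EFin; apply/integrable_restrict => //=; rewrite setIid.
have [d e] := FTC1_lebesgue_pt xq iG (px : (BLeft p < BRight x)%E) lx.
have eG y : y <= q -> \int[mu]_(z in `[p, y]) G z = \int[mu]_(z in `[p, y]) H z.
  move=> yq; apply: eq_Rintegral => z; rewrite inE/= in_itv/= => /andP[pz zy].
  by rewrite /G patchE mem_set//= in_itv/= pz (le_trans zy).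
have -> : H x = G x by rewrite /G patchE mem_set//= in_itv/= !ltW.
apply: near_eq_is_derive (DeriveDef d _).
  by near=> z; apply: eG; near: z; exact: lt_le_nbhsl.
by rewrite -derive1E.
Unshelve. all: by end_near. Qed.

Lemma integral_splitB H (p q : R) : mu.-integrable `[p, q] (EFin \o H) ->
  forall s t, p <= s -> s <= t -> t <= q ->
    \int[mu]_(x in `[s, t]) H x =
    \int[mu]_(x in `[p, t]) H x - \int[mu]_(x in `[p, s]) H x.
Proof.
move=> iH s t ps st tq; rewrite (@Rintegral_itvB _ H (BLeft p) (BRight t) s)//.
- rewrite Rintegral_itv_obnd_cbnd//; apply: integrableS iH => //.
  by apply: subset_itv; rewrite bnd_simp.
- by apply: integrableS iH => //; apply: subset_itv; rewrite bnd_simp.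
Qed.

Lemma dominated_continuous psi H (p q : R) : p < q ->
  mu.-integrable `[p, q] (EFin \o H) ->
  (forall s t, p <= s -> s <= t -> t <= q ->
     `|psi t - psi s| <= \int[mu]_(x in `[s, t]) H x) ->
  {within `[p, q], continuous psi}.
Proof.
move=> pq iH dom.
pose Phi x := \int[mu]_(z in `[p, x]) H z.
have PhiB : forall s t, p <= s -> s <= t -> t <= q ->
  \int[mu]_(x in `[s, t]) H x = Phi t - Phi s := integral_splitB iH.
have cPhi : {within `[p, q], continuous Phi}.
  exact: parameterized_integral_continuous (ltW pq) iH.
have domn s t : p <= s <= q -> p <= t <= q ->
    `|psi t - psi s| <= `|Phi t - Phi s|.
  wlog st : s t / s <= t.
    move=> h spq tpq; have [st|/ltW ts] := leP s t; first exact: h.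
    by rewrite distrC [leRHS]distrC; exact: h.
  move=> /andP[ps _] /andP[_ tq].
  by apply: le_trans (dom _ _ ps st tq) _; rewrite PhiB// ler_norm.
apply/subspace_continuousP => x xpq.
apply/cvgrPdist_lt => e e0.
move/subspace_continuousP : cPhi => /(_ _ xpq) /cvgrPdist_lt /(_ _ e0).
move=> cP; near=> y.
have ypq : `[p, q]%classic y by near: y; exact: withinT.
apply: (@le_lt_trans _ _ `|Phi x - Phi y|); last by near: y.
by apply: domn; [move: ypq|move: xpq]; rewrite /= in_itv.
Unshelve. all: by end_near. Qed.

(** With [Phi] the integral of [H] from [p], the hypothesis says that
    [Phi + psi] and [Phi - psi] are nondecreasing. For each of them the integral
    of the derivative is at most the increment ([integral_derive_le]); as
    [Phi] satisfies the equality, the two inequalities bound the integral of [g]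
    from both sides by [psi q - psi p]. *)
Lemma dominated_AC psi g H (p q : R) : p < q ->
  mu.-integrable `[p, q] (EFin \o H) -> measurable_fun `[p, q] g ->
  (forall s t, p <= s -> s <= t -> t <= q ->
     `|psi t - psi s| <= \int[mu]_(x in `[s, t]) H x) ->
  {ae mu, forall x, p < x < q -> is_derive x 1 psi (g x)} ->
  mu.-integrable `[p, q] (EFin \o g) /\
  \int[mu]_(x in `[p, q]) g x = psi q - psi p.
Proof.
move=> pq iH mg dom dpsi.
pose Phi x := \int[mu]_(z in `[p, x]) H z.
have PhiB : forall s t, p <= s -> s <= t -> t <= q ->
  \int[mu]_(x in `[s, t]) H x = Phi t - Phi s := integral_splitB iH.
have cPhi : {within `[p, q], continuous Phi}.
  exact: parameterized_integral_continuous (ltW pq) iH.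
have cpsi := dominated_continuous pq iH dom.
have key (e : bool) : let h x := H x + (-1) ^+ e * g x in
  mu.-integrable `[p, q] (EFin \o h) /\
  \int[mu]_(x in `[p, q]) h x <=
    (Phi q + (-1) ^+ e * psi q) - (Phi p + (-1) ^+ e * psi p).
  move=> h; pose t := (fun x => Phi x + (-1) ^+ e * psi x) \o clamp p q.
  have tE x : p <= x <= q -> t x = Phi x + (-1) ^+ e * psi x.
    by move=> xpq; rewrite /t /= clamp_id.
  rewrite -!tE ?lexx ?(ltW pq)//; apply: integral_derive_le => //.
  - move=> x y xy; rewrite /t /=.
    have := clamp_itv x (ltW pq); have := clamp_itv y (ltW pq).
    have := clamp_homo p q xy.
    move: (clamp p q x) (clamp p q y) => u v uv /andP[pv vq] /andP[pu uq].
    have := dom _ _ pu uv vq; rewrite PhiB// ler_norml.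
    by case: e {h t tE} => /=; rewrite ?expr1 ?expr0; lra.
  - apply: continuous_clamp; first exact: ltW.
    apply/subspace_continuousP => x xpq; apply: cvgD.
      by move/subspace_continuousP : cPhi; apply.
    by apply: cvgMr; move/subspace_continuousP : cpsi; apply.
  - case/integrableP : iH => /measurable_EFinP mH _.
    by apply: measurable_funD => //; apply: measurable_funM.
  - apply: (ae_mp2 (derive_integral pq iH) dpsi) => x d1 d2 pxq.
    apply: is_derive_clamp => //.
    by have := is_deriveD (d1 pxq) (is_deriveZ ((-1) ^+ e) (d2 pxq)).
have [i1 l1] := key false; have [i2 l2] := key true.
have iHg : mu.-integrable `[p, q] (EFin \o g).
  apply: integrable_ext (integrable_sub _ i1 iH) => // x _.
  by rewrite expr0 mul1r addrAC subrr add0r.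
split => //.
have iHn : mu.-integrable `[p, q] (EFin \o (fun x => - g x)).
  apply: integrable_ext (integrable_scale (-1) _ iHg) => // x _.
  by rewrite mulN1r.
have Phip : Phi p = 0 by rewrite /Phi set_itv1 Rintegral_set1.
have eH : \int[mu]_(x in `[p, q]) H x = Phi q by [].
move: l1 l2; under eq_Rintegral do rewrite expr0 mul1r.
under [X in _ -> X <= _ -> _]eq_Rintegral do rewrite expr1 mulN1r.
rewrite RintegralD// [X in _ -> X <= _ -> _]RintegralB// Phip eH expr0 expr1; lra.
Qed.
End DominatedAC.

(** * A criterion for local absolute continuity *)

Section ACCriterion.
Context {R : realType}.
Local Notation mu := (@lebesgue_measure R).
Local Notation intg D f := (mu.-integrable D (EFin \o f)).
Implicit Types (D I : set R) (psi H g : R -> R).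

(** The upper limit exists everywhere and is measurable, and it is the limit
    wherever there is one; hence the set of convergence does not enter. *)
Lemma measurable_limit D (f : nat -> R -> R) : measurable D ->
  (forall k, measurable_fun D (f k)) ->
  exists2 g : R -> R, measurable_fun D g &
    forall x (l : R), D x -> f k x @[k --> \oo] --> l -> g x = l.
Proof.
move=> mD mf; exists (fun x => fine (limn_esup (fun k => (f k x)%:E))).
  pose L x := limn_esup (fun k => (f k x)%:E).
  have mL : measurable_fun D L.
    apply: (@measurable_fun_limn_esup _ _ _ D (fun k x => (f k x)%:E)) => k.
    exact/measurable_EFinP.
  pose F := D `&` L @^-1` (~` [set -oo%E; +oo%E]).
  have mF : measurable F by apply: mL => //; apply: measurableC; exact: measurableU.
  apply/measurable_EFinP; apply: (eq_measurable_fun (L \_ F)).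
    move=> x /set_mem Dx; rewrite patchE /=.
    case: ifPn => [/set_mem[_]|xF].
      by rewrite /= /L; case: limn_esup => //= h; exfalso; apply: h; [right|left].
    rewrite -/(L x); case E : (L x) => [r| |] //=.
    by move: xF; rewrite notin_setE => -[]; split => //=; rewrite E => -[].
  by apply/measurable_restrict => //; apply: measurable_funS mL.
move=> x l Dx fl.
have c : (f k x)%:E @[k --> \oo] --> l%:E by apply/fine_cvgP; split => //; exact: nearW.
by rewrite (is_cvg_limn_esupE (cvgP _ c)) (cvg_lim _ c).
Qed.

Lemma open_has_cc I x : open I -> I x ->
  exists p q : R, [/\ p < x, x < q & forall y, p <= y <= q -> I y].
Proof.
move=> oI Ix; have h := open_itvcc_subset oI Ix.
have [e [e0 he]] : exists e : R, 0 < e /\ `[x - e, x + e]%classic `<=` I.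
  near (0 : R)^'+ => e; exists e; split; first by near: e; exact: nbhs_right_gt.
  by near: e.
by exists (x - e), (x + e); rewrite ltrBlDr ltrDl e0.
Unshelve. all: by end_near. Qed.

Lemma compact_sub_cc (I K : set R) : K `<=` I -> compact K -> K !=set0 ->
  exists p q, [/\ I p, I q, p <= q & K `<=` `[p, q]%classic].
Proof.
move=> KI cK K0.
have cid : {within K, continuous (id : R -> R)}.
  by apply: continuous_subspaceT => x; exact: cvg_id.
have [p /set_mem Kp pK] := compact_EVT_min K0 cK cid.
have [q /set_mem Kq qK] := compact_EVT_max K0 cK cid.
exists p, q; split; [exact: KI|exact: KI|exact/pK/mem_set|].
by move=> x Kx; rewrite /= in_itv/= pK ?qK//; exact/mem_set.
Qed.

Lemma interval_sub_cc I (p q x : R) : is_interval I -> I p -> I q ->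
  p <= x <= q -> I x.
Proof. by move=> iI Ip Iq; exact: iI. Qed.

(** A compact subset of [I] lies in the segment between its least and its
    greatest element. *)
Lemma locally_integrable_segments I g : open I -> measurable_fun I g ->
  (forall p q, I p -> I q -> p < q -> intg `[p, q] g) ->
  locally_integrable I g.
Proof.
move=> oI mg ig; split => // K KI cK.
have [->|/set0P K0] := eqVneq K set0; first by rewrite integral_set0.
have [p [q [Ip Iq pq Kpq]]] := compact_sub_cc KI cK K0.
(* [p = q] may happen; moving [q] to the right makes the segment nondegenerate. *)
have [q' [Iq' qq']] : exists q', I q' /\ q < q'.
  have [p0 [r [pq0 qr h]]] := open_has_cc oI Iq; exists r; split => //.
  by apply: h; rewrite lexx (le_trans (ltW pq0)) ?ltW.
have ipq := ig p q' Ip Iq' (le_lt_trans pq qq').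
have iK : intg K g.
  apply: integrableS ipq => //; first exact: compact_measurable.
  by apply: subset_trans Kpq _; apply: subset_itvcc => //; exact: ltW.
by case/integrableP : iK.
Qed.

(** The pointwise derivative [g] is only given up to a null set. The density is
    the limit of the difference quotients of [psi], which is measurable and
    agrees with [g] almost everywhere. *)
Lemma AC_criterion I psi g : open I -> is_interval I ->
  (forall p q, I p -> I q -> p < q -> exists2 H, intg `[p, q] H &
     forall s t, p <= s -> s <= t -> t <= q ->
       `|psi t - psi s| <= \int[mu]_(x in `[s, t]) H x) ->
  {ae mu, forall s, I s -> is_derive s 1 psi (g s)} ->
  exists g', [/\ locally_integrable I g',
    forall s1 s2, I s1 -> I s2 -> s1 < s2 ->
       psi s2 - psi s1 = \int[mu]_(x in `[s1, s2]) g' x &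
    {ae mu, forall s, I s -> g' s = g s}].
Proof.
move=> oI iI dom dpsi.
have mI : measurable I by exact: open_measurable.
have cpsi x : I x -> {for x, continuous psi}.
  move=> Ix; have [p [q [px xq pqI]]] := open_has_cc oI Ix.
  have pq := lt_trans px xq.
  have Ip : I p by apply: pqI; rewrite lexx ltW.
  have Iq : I q by apply: pqI; rewrite lexx ltW.
  have [H iH HP] := dom p q Ip Iq pq.
  have := dominated_continuous pq iH HP.
  move/(continuous_within_itvP _ pq) => [+ _ _]; apply.
  by rewrite in_itv/= px.
(* Extended by zero, [psi] can be shifted without leaving its domain. *)
pose psi0 := psi \_ I.
have mpsi0 : measurable_fun setT psi0.
  apply/(measurable_restrictT _ _).1 => //.
  apply: open_continuous_measurable_fun => // x; rewrite inE; exact: cpsi.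
pose u (k : nat) : R := k.+1%:R^-1.
have u0 k : u k != 0 by rewrite invr_eq0.
pose f k x := (psi0 (x + u k) - psi0 x) / u k.
have mf k : measurable_fun I (f k).
  apply: measurable_funTS; apply: measurable_funM; last exact: measurable_cst.
  apply: measurable_funB => //.
  apply: (measurableT_comp mpsi0); exact: measurable_funD.
have [g' mg' g'P] := measurable_limit mI mf.
have g'g : {ae mu, forall s, I s -> g' s = g s}.
  apply: (ae_mp dpsi) => s ds Is; apply: g'P => //.
  have d0 : is_derive s 1 psi0 (g s).
    apply: near_eq_is_derive (ds Is).
    have := open_nbhs_nbhs (conj oI Is); apply: filterS => z Iz.
    by rewrite /psi0 patchE mem_set.
  exact: is_derive_quot cvg_harmonic.
have main p q : I p -> I q -> p < q ->
    intg `[p, q] g' /\ \int[mu]_(x in `[p, q]) g' x = psi q - psi p.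
  move=> Ip Iq pq; have [H iH HP] := dom p q Ip Iq pq.
  apply: dominated_AC HP _ => //.
  - apply: measurable_funS mg' => // x; rewrite /= in_itv/=; exact: iI.
  - apply: (ae_mp2 g'g dpsi) => x gx dx /andP[px xq].
    have Ix : I x by apply: (iI p q) => //; rewrite !ltW.
    by rewrite gx//; exact: dx.
exists g'; split => //; last by move=> p q Ip Iq pq; have [] := main p q Ip Iq pq.
apply: locally_integrable_segments => // p q Ip Iq pq.
by have [] := main p q Ip Iq pq.
Qed.
End ACCriterion.

(** * Complex-valued functions of a real variable *)

Section ComplexTools.
Context {R : realType}.
Local Notation Re := (@complex.Re R).
Local Notation Im := (@complex.Im R).
Local Notation normc := (@Normc.normc R).
Implicit Types (z w : R[i]).

Lemma ReM z w : Re (z * w) = Re z * Re w - Im z * Im w.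
Proof. by case: z => ? ?; case: w. Qed.
Lemma ImM z w : Im (z * w) = Re z * Im w + Im z * Re w.
Proof. by case: z => ? ?; case: w. Qed.
Lemma ReD z w : Re (z + w) = Re z + Re w. Proof. by case: z => ? ?; case: w. Qed.
Lemma ImD z w : Im (z + w) = Im z + Im w. Proof. by case: z => ? ?; case: w. Qed.
Lemma ReN z : Re (- z) = - Re z. Proof. by case: z. Qed.
Lemma ImN z : Im (- z) = - Im z. Proof. by case: z. Qed.
Lemma ReC (x : R) : Re (x%:C) = x. Proof. by []. Qed.
Lemma ImC (x : R) : Im (x%:C) = 0. Proof. by []. Qed.
Lemma Rei : Re 'i%C = 0. Proof. by []. Qed.
Lemma Imi : Im 'i%C = 1. Proof. by []. Qed.
Lemma ReX (x y : R) : Re (x +i* y) = x. Proof. by []. Qed.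
Lemma ImX (x y : R) : Im (x +i* y) = y. Proof. by []. Qed.
(** Rewriting with this rule, rather than simplifying, keeps the products of
    [R[i]] folded. *)
Definition ReImE :=
  (ReM, ImM, ReD, ImD, ReN, ImN, ReC, ImC, Rei, Imi, ReX, ImX).

Lemma complex_eq z w : Re z = Re w -> Im z = Im w -> z = w.
Proof. by case: z w => [a b] [c d] /= -> ->. Qed.

Lemma normrE z : `|z| = (normc z)%:C. Proof. by []. Qed.

Lemma normc_ge0 z : 0 <= normc z.
Proof. by case: z => a b /=; rewrite sqrtr_ge0. Qed.

Lemma normc_Re z : `|Re z| <= normc z.
Proof. by rewrite -lecR -normrE normc_ge_Re. Qed.

Lemma normc_Im z : `|Im z| <= normc z.
Proof.
case: z => a b /=; rewrite -sqrtr_sqr ler_wsqrtr// lerDr; exact: sqr_ge0.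
Qed.

Lemma normcR (x : R) : normc x%:C = `|x|.
Proof. by rewrite /= expr0n/= addr0 sqrtr_sqr. Qed.

Lemma normci : normc 'i%C = 1.
Proof. by rewrite /= expr0n expr1n add0r sqrtr1. Qed.

Lemma normc_le z : normc z <= `|Re z| + `|Im z|.
Proof.
case: z => a b /=; rewrite -[leRHS]ger0_norm ?addr_ge0// -sqrtr_sqr ler_wsqrtr//.
rewrite sqrrD !real_normK ?num_real// lerD2r lerDl.
by rewrite mulrn_wge0// mulr_ge0.
Qed.

Lemma normcB_sym z w : normc (z - w) = normc (w - z).
Proof. by rewrite -normcN opprB. Qed.

Lemma cvg_complexP (T : Type) (F : set_system T) (FF : Filter F)
    (f : T -> R[i]) (l : R[i]) :
  f @ F --> l <-> (Re (f x) @[x --> F] --> Re l /\ Im (f x) @[x --> F] --> Im l).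
Proof.
split.
- move=> /cvgrPdist_lt h; split; apply/cvgrPdist_lt => e e0.
  + have := h e%:C; rewrite ltcR => /(_ e0); apply: filterS => x.
    rewrite normrE ltcR -ReN -ReD; apply: le_lt_trans; exact: normc_Re.
  + have := h e%:C; rewrite ltcR => /(_ e0); apply: filterS => x.
    rewrite normrE ltcR -ImN -ImD; apply: le_lt_trans; exact: normc_Im.
- move=> [/cvgrPdist_lt h1 /cvgrPdist_lt h2]; apply/cvgrPdist_lt => e e0.
  have [eE e'0] : e = (Re e)%:C /\ 0 < Re e.
    by move: e0; rewrite ltcE => /andP[/eqP i0 ->]; split => //; apply: complex_eq.
  have e20 : 0 < Re e / 2 by rewrite divr_gt0.
  apply: filterS2 (h1 _ e20) (h2 _ e20) => x x1 x2.
  rewrite normrE eE ltcR; apply: le_lt_trans (normc_le _) _.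
  by rewrite !ReImE [ltRHS]splitr ltrD.
Qed.

Lemma cvg_normcP (T : Type) (F : set_system T) (FF : Filter F)
    (f : T -> R[i]) (l : R[i]) :
  f @ F --> l <-> normc (f x - l) @[x --> F] --> 0.
Proof.
rewrite cvg_complexP; split => [[h1 h2]|h].
- have h : `|Re (f x) - Re l| + `|Im (f x) - Im l| @[x --> F] --> 0.
    have -> : (0 : R) = `|Re l - Re l| + `|Im l - Im l|.
      by rewrite !subrr !normr0 addr0.
    by apply: cvgD; apply: cvg_norm; apply: cvgB => //; exact: cvg_cst.
  apply: (squeeze_cvgr _ (cvg_cst 0) h).
  apply: nearW => x; rewrite normc_ge0/=; apply: le_trans (normc_le _) _.
  by rewrite !ReImE.
- split; apply/subr_cvg0; apply/cvgr0Pnorm_lt => e e0;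
    move/cvgr0Pnorm_lt : h => /(_ _ e0); apply: filterS => x;
    rewrite (ger0_norm (normc_ge0 _)); apply: le_lt_trans;
    rewrite -?ReN -?ReD -?ImN -?ImD; [exact: normc_Re|exact: normc_Im].
Qed.

Lemma complex_hausdorff : hausdorff_space R[i].
Proof. exact: (@norm_hausdorff _ R[i]^o). Qed.

Lemma normc_expi (t : R) : normc (expi t) = 1.
Proof. by rewrite /= cos2Dsin2 sqrtr1. Qed.

(** The derivative is taken componentwise, so that the real differential calculus
    applies to each part. *)
Definition is_cderive (f : R -> R[i]) (x : R) (l : R[i]) :=
  is_derive x (1 : R) (fun y => Re (f y)) (Re l) /\
  is_derive x (1 : R) (fun y => Im (f y)) (Im l).

Lemma shift_dnbhs (x a : R) : y + a @[y --> x^'] --> (x + a)^'.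
Proof.
move=> A [e /= e0 eA]; exists e => // y /= xy yx; apply: eA => /=.
  by rewrite opprD addrACA subrr addr0.
by apply: contra_neq yx => /addIr.
Qed.

Lemma is_derive_dnbhsP (f : R -> R) (x l : R) :
  is_derive x (1 : R) f l <-> (f y - f x) / (y - x) @[y --> x^'] --> l.
Proof.
pose g := fun h : R => h^-1 *: (f (h *: 1 + x) - f x).
pose q := fun y : R => (f y - f x) / (y - x).
have qg : q = g \o (fun y => y - x).
  by apply/funext => y; rewrite /q /g /= /GRing.scale/= mulr1 subrK mulrC.
have gq : g = q \o (fun h => h + x).
  by apply/funext => h; rewrite /q /g /= /GRing.scale/= mulr1 addrK mulrC.
have E : (q @ x^' --> l) <-> (g @ 0^' --> l).
  split => h; [rewrite gq|rewrite qg]; apply: cvg_comp h.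
    by have := @shift_dnbhs 0 x; rewrite add0r.
  by have := @shift_dnbhs x (- x); rewrite subrr.
rewrite -[X in _ <-> X]/(q @ x^' --> l) E; split => [[d <-]//|h].
by apply: DeriveDef; [exact: cvgP h|exact: cvg_lim h].
Qed.

Lemma within_dnbhs (D : set R) (x : R) : nbhs x D ->
  within D x^' = x^'.
Proof.
move=> nD; rewrite predeqE => A; rewrite /within/dnbhs/= /within/=; split.
  by move=> h; apply: filterS2 nD h => y Dy h yx; exact: h.
by apply: filterS => y h yx _; exact: h.
Qed.

(** Close to an interior point of [D] the restriction to [D] has no effect, so
    that the derivative relative to [D] is the ordinary one. *)
Lemma dquot_within (D : set R) (f : R -> R[i]) (x : R) (l : R[i]) :
  nbhs x D -> (dquot f x y @[y --> within D x^'] --> l) <-> is_cderive f x l.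
Proof.
move=> nD; rewrite (within_dnbhs nD).
rewrite cvg_complexP /is_cderive !is_derive_dnbhsP.
have E y : dquot f x y =
   ((Re (f y) - Re (f x)) / (y - x)) +i* ((Im (f y) - Im (f x)) / (y - x)).
  rewrite /dquot -fmorphV; apply: complex_eq.
    by rewrite ReM ReC ImC mulr0 subr0 ReD ReN.
  by rewrite ImM ReC ImC mulr0 add0r ImD ImN.
have -> : (fun y => Re (dquot f x y)) =
    (fun y => (Re (f y) - Re (f x)) / (y - x)) by apply/funext => y; rewrite E.
have -> : (fun y => Im (dquot f x y)) =
    (fun y => (Im (f y) - Im (f x)) / (y - x)) by apply/funext => y; rewrite E.
by [].
Qed.

Lemma is_cderive_derive_on (D : set R) (f : R -> R[i]) (x : R) (l : R[i]) :
  nbhs x D -> is_cderive f x l -> derivable_on D f x /\ derive_on D f x = l.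
Proof.
move=> nD /(dquot_within _ _ nD) h; split; first exact: cvgP h.
have FF : ProperFilter (within D x^').
  by rewrite (within_dnbhs nD); exact: Proper_dnbhs_numFieldType.
by apply: cvg_lim h; exact: complex_hausdorff.
Qed.

Lemma derivable_on_is_cderive (D : set R) (f : R -> R[i]) (x : R) :
  nbhs x D -> derivable_on D f x -> is_cderive f x (derive_on D f x).
Proof.
move=> nD d; apply/(dquot_within _ _ nD).
exact: d.
Qed.

Lemma is_cderive_cst (c : R[i]) (x : R) : is_cderive (fun _ => c) x 0.
Proof. by split; apply: is_derive_cst. Qed.

Lemma is_cderiveR (f : R -> R) (x l : R) : is_derive x (1 : R) f l ->
  is_cderive (fun y => (f y)%:C) x l%:C.
Proof. by move=> d; split => //=; apply: is_derive_cst. Qed.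

Lemma is_cderiveD (f g : R -> R[i]) (x : R) (l m : R[i]) :
  is_cderive f x l -> is_cderive g x m ->
  is_cderive (fun y => f y + g y) x (l + m).
Proof.
move=> [f1 f2] [g1 g2]; split.
  under eq_fun do rewrite ReD; rewrite ReD; exact: is_deriveD.
under eq_fun do rewrite ImD; rewrite ImD; exact: is_deriveD.
Qed.

Lemma is_cderiveM (f g : R -> R[i]) (x : R) (l m : R[i]) :
  is_cderive f x l -> is_cderive g x m ->
  is_cderive (fun y => f y * g y) x (l * g x + f x * m).
Proof.
move=> [f1 f2] [g1 g2]; split.
  under eq_fun do rewrite ReM; apply: is_derive_eq.
  by rewrite !ReImE /GRing.scale/=; ring.
under eq_fun do rewrite ImM; apply: is_derive_eq.
by rewrite !ReImE /GRing.scale/=; ring.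
Qed.

Lemma is_cderive_expi (f : R -> R) (x l : R) : is_derive x (1 : R) f l ->
  is_cderive (fun y => expi (f y)) x ('i%C * l%:C * expi (f x)).
Proof.
move=> d; split => /=.
  by apply: is_derive_eq; ring.
by apply: is_derive_eq; ring.
Qed.

End ComplexTools.

(** * Dominated convergence and integrals over half-lines *)

Section IntegralTools.
Context {R : realType}.
Local Notation mu := (@lebesgue_measure R).
Local Notation intg D f := (mu.-integrable D (EFin \o f)).
Implicit Types (D : set R) (f g h : R -> R).

Lemma Rintegral_dct_ae D (f_ : nat -> R -> R) f h : measurable D ->
  (forall n, measurable_fun D (f_ n)) -> measurable_fun D f ->
  {ae mu, forall x, D x -> f_ n x @[n --> \oo] --> f x} ->
  intg D h -> {ae mu, forall x, forall n, D x -> `|f_ n x| <= h x} ->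
  intg D f /\
  \int[mu]_(x in D) f_ n x @[n --> \oo] --> \int[mu]_(x in D) f x.
Proof.
move=> mD mf_ mf cf ih bf.
have [] := @dominated_convergence _ _ _ mu D mD (fun n x => (f_ n x)%:E)
   (EFin \o f) (EFin \o h).
- by move=> n; apply/measurable_EFinP; exact: mf_.
- by apply/measurable_EFinP.
- apply: (ae_mp cf) => x cx Dx; apply/fine_cvgP; split; first exact: nearW.
  exact: cx.
- exact: ih.
- by apply: (ae_mp bf) => x bx n Dx; rewrite /= lee_fin; exact: bx.
move=> fi _ fc; split => //.
apply: (@fine_cvg _ _ _ _ (fun n => \int[mu]_(x in D) (f_ n x)%:E)%E).
by rewrite /Rintegral fineK//; exact: integrable_fin_num.
Qed.

Lemma Rintegral_dct D (f_ : nat -> R -> R) f h : measurable D ->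
  (forall n, measurable_fun D (f_ n)) ->
  (forall x, D x -> f_ n x @[n --> \oo] --> f x) ->
  intg D h -> (forall n x, D x -> `|f_ n x| <= h x) ->
  intg D f /\
  \int[mu]_(x in D) f_ n x @[n --> \oo] --> \int[mu]_(x in D) f x.
Proof.
move=> mD mf_ cf ih bf; apply: (Rintegral_dct_ae (h := h)) => //.
- have [g mg gP] := measurable_limit mD mf_.
  apply: eq_measurable_fun mg => x /set_mem Dx; apply: gP => //; exact: cf.
- by apply: aeW => x; exact: cf.
- by apply: aeW => x n; exact: bf.
Qed.

(** Sequences in [(0, 1]] are enough to test a limit at [0+]; the bounds on
    regularized integrals are uniform for regularization parameters in that
    range. *)
Lemma cvg_right01P (F : R -> R) (l : R) :
  F e @[e --> 0^'+] --> l <->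
  forall u : R^nat, (forall k, 0 < u k <= 1) -> u @ \oo --> 0 ->
    F (u k) @[k --> \oo] --> l.
Proof.
split=> [cF u u1 cu|h].
  have [h _] := cvg_at_rightP F 0 l; apply: (h cF).
  by split => // k; case/andP: (u1 k).
have c1 : F (Num.min e 1) @[e --> 0^'+] --> l.
  apply/cvg_at_rightP => u [u0 cu]; apply: (h (fun k => Num.min (u k) 1)).
    by move=> k; rewrite lt_min u0 ltr01 ge_min lexx orbT.
  have n1 : \forall k \near \oo, u k <= 1 by exact: (cvgr_le _ cu _ ltr01).
  apply: cvg_trans cu; apply: near_eq_cvg; near=> k.
  by rewrite min_l//; near: k.
apply: cvg_trans c1; apply: near_eq_cvg; near=> e.
by rewrite min_l//; near: e; exact: nbhs_right_le.
Unshelve. all: by end_near. Qed.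

Lemma Rintegral_dct_right D (F : R -> R -> R) f h : measurable D ->
  (forall e, 0 < e <= 1 -> measurable_fun D (F e)) ->
  (forall x, D x -> F e x @[e --> 0^'+] --> f x) ->
  intg D h -> (forall e x, 0 < e <= 1 -> D x -> `|F e x| <= h x) ->
  intg D f /\
  \int[mu]_(x in D) F e x @[e --> 0^'+] --> \int[mu]_(x in D) f x.
Proof.
move=> mD mF cF ih bF.
have main (u : R^nat) : (forall k, 0 < u k <= 1) -> u @ \oo --> 0 ->
    intg D f /\ \int[mu]_(x in D) F (u n) x @[n --> \oo] --> \int[mu]_(x in D) f x.
  move=> u1 cu; apply: (Rintegral_dct (h := h)) => //.
  - by move=> n; exact: mF.
  - move=> x Dx.
    exact: ((cvg_right01P (F ^~ x) (f x)).1 (cF x Dx) u u1 cu).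
  - by move=> n x Dx; exact: bF.
split; last by apply/cvg_right01P => u u1 cu; have [] := main u u1 cu.
have h1 k : 0 < (@harmonic R k) <= 1.
  by rewrite harmonic_gt0/= invf_le1 ?ltr0n// ler1n.
by have [] := main _ h1 cvg_harmonic.
Qed.

Lemma powR_add (x r s : R) : 0 < x -> x `^ (r + s) = x `^ r * x `^ s.
Proof. by move=> x0; rewrite powRD//; apply/implyP => _; rewrite gt_eqF. Qed.

Lemma powR_anti (x y r : R) : r <= 0 -> 0 < x -> x <= y -> y `^ r <= x `^ r.
Proof.
move=> r0 x0 xy; have [s s0 ->] : exists2 s, 0 <= s & r = - s.
  by exists (- r); rewrite ?opprK ?oppr_ge0.
rewrite !powRN lef_pV2 ?posrE ?powR_gt0//.
  by apply: ge0_ler_powR; rewrite ?nnegrE// ltW// (lt_le_trans x0).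
exact: lt_le_trans xy.
Qed.

Lemma cvg_powRy (r : R) : r < 0 -> x `^ r @[x --> +oo] --> 0.
Proof.
move=> r0; apply/cvgr0Pnorm_le => e e0; near=> x.
have x0 : 0 < e `^ (r^-1) by rewrite powR_gt0.
rewrite ger0_norm ?powR_ge0//.
apply: (@le_trans _ _ ((e `^ (r^-1)) `^ r)).
  by apply: powR_anti => //; exact: ltW.
by rewrite -powRrM mulVf ?lt_eqF// powRr1// ltW.
Unshelve. all: by end_near. Qed.

Lemma continuous_powR_cy (c r : R) : 0 < c ->
  {within `[c, +oo[, continuous (fun y => y `^ r)}.
Proof.
move=> c0; apply: derivable_within_continuous => x; rewrite in_itv/= andbT => cx.
by have [] := is_derive1_powR r (lt_le_trans c0 cx).
Qed.

Lemma integral_powR (c r : R) : 0 < c -> r < -1 ->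
  intg `[c, +oo[ (fun y => y `^ r) /\
  \int[mu]_(y in `[c, +oo[) y `^ r = - (c `^ (r + 1) / (r + 1)).
Proof.
move=> c0 r1; have r10 : r + 1 != 0 by apply/eqP; lra.
pose F y := y `^ (r + 1) / (r + 1).
have dF (x : R) : 0 < x -> is_derive x 1 F (x `^ r).
  move=> x0; rewrite /F; have d := is_derive1_powR (r + 1) x0.
  apply: is_derive_eq (is_deriveM d (is_derive_cst ((r + 1)^-1) x 1)) _.
  by rewrite /GRing.scale/= addrK; field.
have I : (\int[mu]_(y in `[c, +oo[) (y `^ r)%:E = 0%:E - (F c)%:E)%E.
  apply: ge0_continuous_FTC2y.
  - by move=> x _; exact: powR_ge0.
  - exact: continuous_powR_cy.
  - rewrite -[X in _ --> X](mul0r (r + 1)^-1); apply: cvgM; last exact: cvg_cst.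
    by apply: cvg_powRy; lra.
  - by move=> x cx; have [] := dF x (lt_trans c0 cx).
  - apply: cvg_at_right_filter; apply: differentiable_continuous.
    by apply/derivable1_diffP; have [] := dF c c0.
  - move=> x; rewrite in_itv/= andbT => cx.
    by rewrite derive1E; have [] := dF x (lt_trans c0 cx).
have mf : measurable_fun `[c, +oo[ (fun y => y `^ r).
  by apply: subspace_continuous_measurable_fun => //; exact: continuous_powR_cy.
split; last by rewrite /Rintegral I -EFinB /= sub0r.
apply/integrableP; split; first exact/measurable_EFinP.
under eq_integral do rewrite /= ger0_norm ?powR_ge0//.
by rewrite I -EFinB ltry.
Qed.

(** Dominated convergence along the segments [[c, c + n + 1]]: integrability of
    [f] takes the place of a sign condition. *)
Lemma FTC2y_integrable f F (c : R) : {within `[c, +oo[, continuous f} ->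
  intg `[c, +oo[ f -> {within `[c, +oo[, continuous F} ->
  (forall x, c < x -> is_derive x 1 F (f x)) ->
  F x @[x --> +oo] --> 0 ->
  \int[mu]_(x in `[c, +oo[) f x = - F c.
Proof.
move=> cf fi cF dF F0.
pose d n : R := c + n.+1%:R.
have cd n : c < d n by rewrite ltrDl.
have dy : d n @[n --> \oo] --> +oo.
  apply/cvgryPge => A; near=> n; rewrite /d -lerBlDl.
  by rewrite -natr1 ler_wpDr//; near: n; exact: nbhs_infty_ger.
have sub n : (`[c, d n] `<=` `[c, +oo[)%classic by apply: subset_itvl; rewrite bnd_simp.
have I n : \int[mu]_(x in `[c, d n]) f x = F (d n) - F c.
  rewrite /Rintegral (@continuous_FTC2 _ _ F)//.
  - exact: continuous_subspaceW cf.
  - have cF' : {within `[c, d n], continuous F} by exact: continuous_subspaceW cF.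
    move/(continuous_within_itvP _ (cd n)) : cF' => [_ ? ?]; split => //.
    by move=> x /[!in_itv]/= /andP[cx _]; have [] := dF x cx.
  - by move=> x /[!in_itv]/= /andP[cx _]; rewrite derive1E; have [] := dF x cx.
have L1 : \int[mu]_(x in `[c, d n]) f x @[n --> \oo] --> - F c.
  have -> : (fun n => \int[mu]_(x in `[c, d n]) f x) = (fun n => F (d n) - F c).
    by apply/funext => n; exact: I.
  suff : F (d n) - F c @[n --> \oo] --> 0 - F c by rewrite sub0r.
  by apply: cvgB; [exact: cvg_comp dy F0|exact: cvg_cst].
pose f_ n := f \_ `[c, d n].
have mf : measurable_fun `[c, +oo[ f by exact: integrable_measurable.
have [_ L2] : intg `[c, +oo[ f /\
    \int[mu]_(x in `[c, +oo[) f_ n x @[n --> \oo] --> \int[mu]_(x in `[c, +oo[) f x.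
  apply: (Rintegral_dct (h := fun x => `|f x|)) => //.
  - move=> n; apply/measurable_restrict => //.
    by apply: measurable_funS mf => //; exact: subIsetl.
  - move=> x cx; apply: cvg_near_cst; near=> n.
    rewrite /f_ patchE mem_set//=; move: cx; rewrite /= !in_itv/= andbT => -> /=.
    by near: n; move/cvgryPge : dy; apply.
  - by have := integrable_abse fi.
  - by move=> n x _; rewrite /f_ patchE; case: ifP => // _; rewrite normr0.
apply: (cvg_unique (@Rhausdorff R) _ L1).
suff -> : (fun n => \int[mu]_(x in `[c, d n]) f x) =
  (fun n => \int[mu]_(x in `[c, +oo[) f_ n x) by [].
apply/funext => n; rewrite -Rintegral_mkcondr; congr (Rintegral _ _ _).
by rewrite setIidr.
Unshelve. all: by end_near. Qed.
End IntegralTools.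

(** * Integrals of complex-valued functions *)

Section ComplexIntegral.
Context {R : realType}.
Local Notation mu := (@lebesgue_measure R).
Local Notation intg D f := (mu.-integrable D (EFin \o f)).
Local Notation Re := (@complex.Re R).
Local Notation Im := (@complex.Im R).
Local Notation normc := (@Normc.normc R).
Implicit Types (D : set R) (f g : R -> R[i]) (h : R -> R).

Definition cmeasurable D g :=
  measurable_fun D (fun x => Re (g x)) /\ measurable_fun D (fun x => Im (g x)).

Definition ccontinuous D g :=
  {within D, continuous (fun x => Re (g x))} /\
  {within D, continuous (fun x => Im (g x))}.

Lemma ccontinuous_measurable D g : measurable D -> ccontinuous D g ->
  cmeasurable D g.
Proof.
by move=> mD [c1 c2]; split; apply: subspace_continuous_measurable_fun.
Qed.

Lemma ccontinuousS D D' g : D `<=` D' -> ccontinuous D' g -> ccontinuous D g.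
Proof.
move=> DD [c1 c2].
by split; [exact: continuous_subspaceW c1|exact: continuous_subspaceW c2].
Qed.

Lemma ccontinuousD D f g : ccontinuous D f -> ccontinuous D g ->
  ccontinuous D (fun x => f x + g x).
Proof.
move=> [f1 f2] [g1 g2]; split.
  under eq_fun do rewrite ReD; move=> x; apply: cvgD; [exact: f1|exact: g1].
under eq_fun do rewrite ImD; move=> x; apply: cvgD; [exact: f2|exact: g2].
Qed.

Lemma ccontinuousM D f g : ccontinuous D f -> ccontinuous D g ->
  ccontinuous D (fun x => f x * g x).
Proof.
move=> [f1 f2] [g1 g2]; split.
  under eq_fun do rewrite ReM; move=> x; apply: cvgB; apply: cvgM;
    [exact: f1|exact: g1|exact: f2|exact: g2].
under eq_fun do rewrite ImM; move=> x; apply: cvgD; apply: cvgM;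
    [exact: f1|exact: g2|exact: f2|exact: g1].
Qed.

Lemma is_cderive_ccontinuous D f f' : (forall x, D x -> is_cderive f x (f' x)) ->
  ccontinuous D f.
Proof.
move=> df; split; apply: continuous_in_subspaceT => x /set_mem Dx;
  apply/differentiable_continuous/derivable1_diffP; by case: (df x Dx) => -[? _] [].
Qed.

Lemma cmeasurableM D f g : cmeasurable D f -> cmeasurable D g ->
  cmeasurable D (fun x => f x * g x).
Proof.
move=> [f1 f2] [g1 g2]; split.
  under eq_fun do rewrite ReM.
  by apply: measurable_funB; apply: measurable_funM.
under eq_fun do rewrite ImM.
by apply: measurable_funD; apply: measurable_funM.
Qed.

(** The factor 2 comes from estimating the real and the imaginary part
    separately. *)
Lemma cintegral_bound D g h : measurable D -> cmeasurable D g ->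
  intg D h -> (forall x, D x -> normc (g x) <= h x) ->
  cintegrable D g /\ normc (cintegral D g) <= 2 * \int[mu]_(x in D) h x.
Proof.
move=> mD [m1 m2] ih gh.
have i1 : intg D (fun x => Re (g x)).
  apply: integrable_dominated ih _ => // x Dx.
  by apply: le_trans (gh x Dx); exact: normc_Re.
have i2 : intg D (fun x => Im (g x)).
  apply: integrable_dominated ih _ => // x Dx.
  by apply: le_trans (gh x Dx); exact: normc_Im.
split; first by split.
apply: le_trans (normc_le _) _; rewrite mulr_natl mulr2n.
apply: lerD; apply: le_trans (le_normr_Rintegral _ _) _ => //;
  apply: le_Rintegral => //.
- by have := integrable_abse i1.
- by move=> x Dx; apply: le_trans (gh x Dx); exact: normc_Re.
- by have := integrable_abse i2.
- by move=> x Dx; apply: le_trans (gh x Dx); exact: normc_Im.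
Qed.

Lemma cintegralD D f g : measurable D -> cintegrable D f -> cintegrable D g ->
  cintegral D (fun x => f x + g x) = cintegral D f + cintegral D g.
Proof.
move=> mD [f1 f2] [g1 g2]; apply: complex_eq; rewrite /cintegral /=.
  by under eq_Rintegral do rewrite ReD; rewrite RintegralD.
by under eq_Rintegral do rewrite ImD; rewrite RintegralD.
Qed.

Lemma cintegrableD D f g : measurable D -> cintegrable D f -> cintegrable D g ->
  cintegrable D (fun x => f x + g x).
Proof.
move=> mD [f1 f2] [g1 g2]; split.
  by apply: integrable_ext (integrable_add mD f1 g1) => // x _; rewrite ReD.
by apply: integrable_ext (integrable_add mD f2 g2) => // x _; rewrite ImD.
Qed.

Lemma eq_cintegral D f g : (forall x, D x -> f x = g x) ->
  cintegral D f = cintegral D g.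
Proof.
move=> fg; rewrite /cintegral; congr (_ +i* _);
  by apply: eq_Rintegral => x /set_mem Dx; rewrite fg.
Qed.

Lemma eq_cintegrable D f g : measurable D -> (forall x, D x -> f x = g x) ->
  cintegrable D f -> cintegrable D g.
Proof.
move=> mD fg [f1 f2]; split.
  by apply: integrable_ext f1 => // x Dx; rewrite fg.
by apply: integrable_ext f2 => // x Dx; rewrite fg.
Qed.

Lemma cintegral_dct_right D (F : R -> R -> R[i]) f h : measurable D ->
  (forall e, 0 < e <= 1 -> cmeasurable D (F e)) ->
  (forall x, D x -> F e x @[e --> 0^'+] --> f x) ->
  intg D h -> (forall e x, 0 < e <= 1 -> D x -> normc (F e x) <= h x) ->
  cintegral D (F e) @[e --> 0^'+] --> cintegral D f.
Proof.
move=> mD mF cF ih bF; apply/cvg_complexP; split.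
- apply: (proj2 (Rintegral_dct_right (h := h) _ _ _ _ _)) => //.
  + by move=> e e1; have [] := mF e e1.
  + by move=> x Dx; have /cvg_complexP[] := cF x Dx.
  + move=> e x e1 Dx; apply: le_trans (bF e x e1 Dx); exact: normc_Re.
- apply: (proj2 (Rintegral_dct_right (h := h) _ _ _ _ _)) => //.
  + by move=> e e1; have [] := mF e e1.
  + by move=> x Dx; have /cvg_complexP[] := cF x Dx.
  + move=> e x e1 Dx; apply: le_trans (bF e x e1 Dx); exact: normc_Im.
Qed.

Lemma cFTC2y f g (c : R) : ccontinuous `[c, +oo[ g -> cintegrable `[c, +oo[ g ->
  ccontinuous `[c, +oo[ f -> (forall x, c < x -> is_cderive f x (g x)) ->
  normc (f x) @[x --> +oo] --> 0 ->
  cintegral `[c, +oo[ g = - f c.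
Proof.
move=> [c1 c2] [i1 i2] [f1 f2] df f0.
have {}f0 : f x @[x --> +oo] --> (0 : R[i]).
  by apply/cvg_normcP; under eq_fun do rewrite subr0.
move/cvg_complexP : f0 => /= [l1 l2].
apply: complex_eq; rewrite /cintegral /= ?ReN ?ImN.
  apply: (@FTC2y_integrable _ _ (fun x => Re (f x))) => // x cx.
  by have [] := df x cx.
apply: (@FTC2y_integrable _ _ (fun x => Im (f x))) => // x cx.
by have [] := df x cx.
Qed.

(** Completing the square gives
    [exp(- e (y - y0)^2) <= exp(e y0^2) exp(- e y^2 / 2)], and a term of high
    order of the exponential series bounds the last factor by any negative power
    of [y]. The power [-2] of the conclusion is bounded and integrable on
    [[c, +oo[], which is what domination asks for. *)
Lemma gauss_decay (e y0 c r : R) : 0 < e -> 0 < c ->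
  exists2 K, 0 <= K & forall y, c <= y ->
    expR (- e * (y - y0) ^+ 2) * y `^ r <= K * y `^ (-2).
Proof.
move=> e0 c0.
have [N rN] : exists N : nat, r + 2 <= N%:R.
  by exists (Num.truncn (r + 2)).+1; exact/ltW/truncnS_gt.
pose k := N.+1.
pose K1 := expR (e * y0 ^+ 2) * (k`!%:R / (e / 2) ^+ k).
(* [s <= 0] is what allows to bound [y `^ s] by [c `^ s]. *)
pose s := r + 2 - (2 * k)%:R.
have s0 : s <= 0.
  by rewrite /s subr_le0 (le_trans rN)// ler_nat /k mul2n -addnn ltnW// ltn_addr.
have K10 : 0 <= K1.
  by rewrite mulr_ge0 ?expR_ge0// divr_ge0// exprn_ge0// divr_ge0 ?ltW.
exists (K1 * c `^ s); first by rewrite mulr_ge0 ?powR_ge0.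
move=> y cy; have y00 := lt_le_trans c0 cy.
have E1 : expR (- e * (y - y0) ^+ 2) <= expR (e * y0 ^+ 2) * expR (- (e / 2 * y ^+ 2)).
  rewrite -expRD ler_expR -subr_ge0.
  have -> : e * y0 ^+ 2 + - (e / 2 * y ^+ 2) - - e * (y - y0) ^+ 2 =
    e / 2 * (y - 2 * y0) ^+ 2 by field.
  by rewrite mulr_ge0 ?sqr_ge0// divr_ge0// ltW.
have E2 : expR (- (e / 2 * y ^+ 2)) <= k`!%:R / (e / 2) ^+ k * y `^ (- (2 * k)%:R).
  rewrite expRN (powR_invn _ (ltW y00)) -[k`!%:R / _]invf_div -invfM.
  rewrite lef_pV2 ?posrE ?expR_gt0//; last first.
    by rewrite mulr_gt0 ?divr_gt0 ?exprn_gt0 ?divr_gt0// ltr0n fact_gt0.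
  have := expR_ge1Dxn N (_ : 0 <= e / 2 * y ^+ 2).
  rewrite mulr_ge0 ?sqr_ge0 ?divr_ge0 ?(ltW e0)// => /(_ isT).
  rewrite -/k exprMn -exprM mulrAC; apply: le_trans.
  by rewrite ler_wpDl.
apply: (@le_trans _ _ (K1 * y `^ s * y `^ (-2))).
  have -> : K1 * y `^ s * y `^ (-2) = expR (e * y0 ^+ 2) *
      (k`!%:R / (e / 2) ^+ k * y `^ (- (2 * k)%:R)) * y `^ r.
    rewrite -mulrA -powR_add//.
    have -> : s + -2 = - (2 * k)%:R + r by rewrite /s; ring.
    by rewrite powR_add// /K1 -!mulrA.
  rewrite ler_wpM2r ?powR_ge0//; apply: le_trans E1 _.
  by rewrite ler_wpM2l ?expR_ge0.
rewrite ler_wpM2r ?powR_ge0// ler_wpM2l//.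
exact: powR_anti.
Qed.
End ComplexIntegral.

(** * The oscillatory kernel and symbol classes *)

Section Oscillatory.
Context {R : realType}.
Local Notation mu := (@lebesgue_measure R).
Local Notation Re := (@complex.Re R).
Local Notation Im := (@complex.Im R).
Local Notation normc := (@Normc.normc R).

(** The oscillatory factor [exp(i a y^2)] with its Gaussian regularization. *)
Definition osc (a e y0 y : R) : R[i] :=
  (expR (- e * (y - y0) ^+ 2))%:C * expi (a * y ^+ 2).

Lemma normc_osc a e y0 y : normc (osc a e y0 y) = expR (- e * (y - y0) ^+ 2).
Proof. by rewrite Normc.normcM normc_expi mulr1 normcR ger0_norm ?expR_ge0. Qed.

Lemma normc_osc_le1 a e y0 y : 0 <= e -> normc (osc a e y0 y) <= 1.
Proof.
move=> e0; rewrite normc_osc -expR0 ler_expR mulNr oppr_le0.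
by rewrite mulr_ge0// sqr_ge0.
Qed.

(** Half the logarithmic derivative of [osc a e y0], see [is_cderive_osc]. *)
Definition phase (a e y0 y : R) : R[i] := (- e * (y - y0)) +i* (a * y).

Lemma Re_phase a e y0 y : Re (phase a e y0 y) = - e * (y - y0).
Proof. by []. Qed.
Lemma Im_phase a e y0 y : Im (phase a e y0 y) = a * y.
Proof. by []. Qed.

Lemma is_cderive_osc a e y0 y :
  is_cderive (osc a e y0) y (2 * phase a e y0 y * osc a e y0 y).
Proof.
have d1 : is_derive y 1 (fun y => expR (- e * (y - y0) ^+ 2))
    (- e * (2 * (y - y0)) * expR (- e * (y - y0) ^+ 2)).
  apply: is_derive_eq; rewrite /GRing.scale/=; ring.
have d2 : is_derive y 1 (fun y => a * y ^+ 2) (a * (2 * y)).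
  apply: is_derive_eq; rewrite /GRing.scale/=; ring.
have := is_cderiveM (is_cderiveR d1) (is_cderive_expi d2).
rewrite /osc /=; congr is_cderive.
have -> : (2 : R[i]) = (2 : R)%:C by rewrite rmorph_nat.
by apply: complex_eq; rewrite /expi !(ReImE, Re_phase, Im_phase); ring.
Qed.

Lemma ccontinuous_osc a e y0 D : ccontinuous D (osc a e y0).
Proof. by apply: is_cderive_ccontinuous => x _; exact: is_cderive_osc. Qed.

Lemma cvg_osc a y0 y : osc a e y0 y @[e --> 0^'+] --> expi (a * y ^+ 2).
Proof.
have c1 : expR (- e * (y - y0) ^+ 2) @[e --> (0 : R)^'+] --> (1 : R).
  have <- : expR (- (0 : R) * (y - y0) ^+ 2) = 1 by rewrite oppr0 mul0r expR0.
  apply: cvg_at_right_filter.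
  apply: (@cvg_comp _ _ _ (fun e : R => - e * (y - y0) ^+ 2) expR).
    by apply: cvgM; [apply: cvgN; exact: cvg_id|exact: cvg_cst].
  exact: continuous_expR.
have cM (k : R) : expR (- e * (y - y0) ^+ 2) * k @[e --> (0 : R)^'+] --> k.
  by rewrite -[X in _ --> X]mul1r; apply: cvgM c1 _; exact: cvg_cst.
apply/cvg_complexP; split.
  under eq_fun do rewrite /osc ReM ReC ImC mul0r subr0.
  exact: cM.
under eq_fun do rewrite /osc ImM ReC ImC mul0r addr0.
exact: cM.
Qed.

Lemma osc_gauss_reg a e y0 (g : R -> R[i]) :
  gauss_reg e y0 (fun y => expi (a * y ^+ 2) * g y) = (fun y => osc a e y0 y * g y).
Proof. by apply/funext => y; rewrite /gauss_reg /osc mulrA. Qed.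

Lemma osc_decay (a e y0 c b M : R) (g : R -> R[i]) : 0 < e -> 0 < c -> 0 <= M ->
  (forall y, c <= y -> normc (g y) <= M * y `^ b) ->
  exists2 K, 0 <= K &
    forall y, c <= y -> normc (osc a e y0 y * g y) <= K * y `^ (-2).
Proof.
move=> e0 c0 M0 gb; have [K K0 KP] := gauss_decay y0 b e0 c0.
exists (M * K); first exact: mulr_ge0.
move=> y cy; rewrite Normc.normcM normc_osc.
apply: (@le_trans _ _ (M * (expR (- e * (y - y0) ^+ 2) * y `^ b))).
  rewrite [leRHS]mulrCA; apply: ler_wpM2l; [exact: expR_ge0|exact: gb].
by rewrite -mulrA; apply: ler_wpM2l => //; exact: KP.
Qed.

Lemma osc_integrable (a e y0 c b M : R) (g : R -> R[i]) : 0 < e -> 0 < c -> 0 <= M ->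
  cmeasurable `[c, +oo[ g ->
  (forall y, c <= y -> normc (g y) <= M * y `^ b) ->
  cintegrable `[c, +oo[ (fun y => osc a e y0 y * g y).
Proof.
move=> e0 c0 M0 mg gb; have [K K0 KP] := osc_decay a y0 e0 c0 M0 gb.
have m2 : (-2 : R) < -1 by lra.
have [ip _] := integral_powR c0 m2.
apply: (proj1 (cintegral_bound (h := fun y => K * y `^ (-2)) _ _ _ _)) => //.
- apply: cmeasurableM => //; apply: ccontinuous_measurable => //.
  exact: ccontinuous_osc.
- exact: integrable_scale.
- by move=> y; rewrite /= in_itv/= andbT; exact: KP.
Qed.

(** Amplitudes of order [b] on [[c, +oo[]: as for symbols in microlocal analysis,
    each of the first [m] derivatives lowers the exponent by one. [G e y0] is a
    family because integration by parts against [osc a e y0] produces factors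
    that depend on the regularization. The constant [M] is uniform in [e] and
    [y0], which gives estimates that survive the limit [e -> 0+]; the limit [g]
    does not depend on [y0], which makes the limit of the integrals independent
    of [y0]. Keeping [M] explicit, and the same for all derivatives, allows to
    follow how the integrals depend on the parameter [s] later on. *)
Fixpoint symb (c : R) (m : nat) (b M : R) (G : R -> R -> R -> R[i])
    (g : R -> R[i]) : Prop :=
  [/\ forall e y0 y, 0 < e <= 1 -> c <= y -> normc (G e y0 y) <= M * y `^ b,
      forall y0 y, c <= y -> G e y0 y @[e --> 0^'+] --> g y,
      forall e y0, 0 < e <= 1 -> ccontinuous `[c, +oo[ (G e y0) &
      if m is m'.+1 then exists G' g',
        (forall e y0 y, 0 < e <= 1 -> c < y ->
           is_cderive (G e y0) y (G' e y0 y)) /\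
        symb c m' (b - 1) M G' g'
      else True].

Lemma symb_bound c m b M G g : symb c m b M G g ->
  forall e y0 y, 0 < e <= 1 -> c <= y -> normc (G e y0 y) <= M * y `^ b.
Proof. by case: m => [|m] []. Qed.

Lemma symb_cvg c m b M G g : symb c m b M G g ->
  forall y0 y, c <= y -> G e y0 y @[e --> 0^'+] --> g y.
Proof. by case: m => [|m] []. Qed.

Lemma symb_cont c m b M G g : symb c m b M G g ->
  forall e y0, 0 < e <= 1 -> ccontinuous `[c, +oo[ (G e y0).
Proof. by case: m => [|m] []. Qed.

Lemma itv01_1 : 0 < (1 : R) <= 1. Proof. by rewrite ltr01 lexx. Qed.

Lemma symb_ge0 c m b M G g : 0 < c -> symb c m b M G g -> 0 <= M.
Proof.
move=> c0 /symb_bound /(_ 1 0 c itv01_1 (lexx _)) h.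
have := le_trans (normc_ge0 _) h.
by rewrite pmulr_lge0// powR_gt0.
Qed.

Lemma symb_le c m b M N G g : M <= N -> symb c m b M G g -> symb c m b N G g.
Proof.
move=> MN; elim: m b G g => [|m IH] b G g [h1 h2 h3 h4]; split => //.
- by move=> e y0 y e1 cy; apply: le_trans (h1 _ _ _ e1 cy) _; rewrite ler_wpM2r// powR_ge0.
- by move=> e y0 y e1 cy; apply: le_trans (h1 _ _ _ e1 cy) _; rewrite ler_wpM2r// powR_ge0.
- by case: h4 => G' [g' [d s]]; exists G', g'; split => //; exact: IH.
Qed.

Lemma symbS c m b M G g : symb c m.+1 b M G g -> symb c m b M G g.
Proof.
elim: m b G g => [|m IH] b G g [h1 h2 h3 h4]; split => //.
by case: h4 => G' [g' [d s]]; exists G', g'; split => //; exact: IH.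
Qed.

Lemma symbW c c' m b M G g : c <= c' -> symb c m b M G g -> symb c' m b M G g.
Proof.
move=> cc; elim: m b G g => [|m IH] b G g [h1 h2 h3 h4]; split => //.
- by move=> e y0 y e1 cy; apply: h1 => //; exact: le_trans cy.
- by move=> y0 y cy; apply: h2 => //; exact: le_trans cy.
- move=> e y0 e1; apply: ccontinuousS (h3 e y0 e1).
  by apply: subset_itvr; rewrite bnd_simp.
- by move=> e y0 y e1 cy; apply: h1 => //; exact: le_trans cy.
- by move=> y0 y cy; apply: h2 => //; exact: le_trans cy.
- move=> e y0 e1; apply: ccontinuousS (h3 e y0 e1).
  by apply: subset_itvr; rewrite bnd_simp.
- case: h4 => G' [g' [d s]]; exists G', g'; split; last exact: IH.
  by move=> e y0 y e1 cy; apply: d => //; exact: le_lt_trans cy.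
Qed.

Lemma symb0_intro c b M G g :
  (forall e y0 y, 0 < e <= 1 -> c <= y -> normc (G e y0 y) <= M * y `^ b) ->
  (forall y0 y, c <= y -> G e y0 y @[e --> 0^'+] --> g y) ->
  (forall e y0, 0 < e <= 1 -> ccontinuous `[c, +oo[ (G e y0)) ->
  symb c 0 b M G g.
Proof. by move=> h1 h2 h3; split; [exact: h1|exact: h2|exact: h3|]. Qed.

Lemma symbS_intro c m b M G g G' g' :
  symb c 0 b M G g ->
  (forall e y0 y, 0 < e <= 1 -> c < y -> is_cderive (G e y0) y (G' e y0 y)) ->
  symb c m (b - 1) M G' g' -> symb c m.+1 b M G g.
Proof.
move=> [h1 h2 h3 _] d s; split; [exact: h1|exact: h2|exact: h3|].
by exists G', g'; split; [exact: d|exact: s].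
Qed.

Lemma symb_0 c m b M G g : symb c m b M G g -> symb c 0 b M G g.
Proof.
move=> s; apply: symb0_intro; [exact: symb_bound s|exact: symb_cvg s|].
exact: symb_cont s.
Qed.

Lemma symb_deriv c m b M G g : symb c m.+1 b M G g -> exists G' g',
  (forall e y0 y, 0 < e <= 1 -> c < y -> is_cderive (G e y0) y (G' e y0 y)) /\
  symb c m (b - 1) M G' g'.
Proof. by case. Qed.

Lemma symbD0 c b M N G g H h : symb c 0 b M G g -> symb c 0 b N H h ->
  symb c 0 b (M + N) (fun e y0 y => G e y0 y + H e y0 y) (fun y => g y + h y).
Proof.
move=> sg sh; apply: symb0_intro.
- move=> e y0 y e1 cy; apply: le_trans (le_normcD _ _) _.
  by rewrite mulrDl lerD ?(symb_bound sg) ?(symb_bound sh).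
- by move=> y0 y cy; apply: cvgD; [exact: (symb_cvg sg)|exact: (symb_cvg sh)].
- by move=> e y0 e1; apply: ccontinuousD; [exact: (symb_cont sg)|exact: (symb_cont sh)].
Qed.

Lemma symbD c m b M N G g H h : symb c m b M G g -> symb c m b N H h ->
  symb c m b (M + N) (fun e y0 y => G e y0 y + H e y0 y) (fun y => g y + h y).
Proof.
elim: m b G g H h => [|m IH] b G g H h sg sh; first exact: symbD0.
have [G' [g' [dg sg']]] := symb_deriv sg.
have [H' [h' [dh sh']]] := symb_deriv sh.
apply: (symbS_intro (symbD0 (symb_0 sg) (symb_0 sh)) _ (IH _ _ _ _ _ sg' sh')).
by move=> e y0 y e1 cy; apply: is_cderiveD; [exact: dg|exact: dh].
Qed.

(** The slack [2 ^+ m] gives the constant that [symbM] reaches at order [m]. *)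
Lemma symb_prod_bound c m b d M N G g H h : 0 < c ->
  symb c m b M G g -> symb c m d N H h ->
  forall e y0 y, 0 < e <= 1 -> c <= y ->
  normc (G e y0 y * H e y0 y) <= (2 ^+ m * (M * N)) * y `^ (b + d).
Proof.
move=> c0 sg sh e y0 y e1 cy.
have M0 := symb_ge0 c0 sg; have N0 := symb_ge0 c0 sh.
rewrite Normc.normcM powR_add ?(lt_le_trans c0)//.
apply: (@le_trans _ _ (M * y `^ b * (N * y `^ d))).
  by apply: ler_pM; rewrite ?normc_ge0 ?(symb_bound sg) ?(symb_bound sh).
rewrite mulrACA; apply: ler_wpM2r; first by rewrite mulr_ge0 ?powR_ge0.
by rewrite ler_peMl ?mulr_ge0// exprn_ege1// ler1n.
Qed.

Lemma symbM0 c m b d M N G g H h : 0 < c ->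
  symb c m b M G g -> symb c m d N H h ->
  symb c 0 (b + d) (2 ^+ m * (M * N))
    (fun e y0 y => G e y0 y * H e y0 y) (fun y => g y * h y).
Proof.
move=> c0 sg sh; apply: symb0_intro.
- exact: (symb_prod_bound c0 sg sh).
- by move=> y0 y cy; apply: cvgM; [exact: (symb_cvg sg)|exact: (symb_cvg sh)].
- by move=> e y0 e1; apply: ccontinuousM; [exact: (symb_cont sg)|exact: (symb_cont sh)].
Qed.

(** The Leibniz rule turns one product into two, so that every derivative doubles
    the constant. *)
Lemma symbM c m b d M N G g H h : 0 < c ->
  symb c m b M G g -> symb c m d N H h ->
  symb c m (b + d) (2 ^+ m * (M * N))
    (fun e y0 y => G e y0 y * H e y0 y) (fun y => g y * h y).
Proof.
move=> c0; elim: m b d G g H h => [|m IH] b d G g H h sg sh; first exact: symbM0.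
have [G' [g' [dg sg']]] := symb_deriv sg.
have [H' [h' [dh sh']]] := symb_deriv sh.
have s1 := IH _ _ _ _ _ _ sg' (symbS sh).
have s2 := IH _ _ _ _ _ _ (symbS sg) sh'.
rewrite (_ : b - 1 + d = b + d - 1) in s1; last by ring.
rewrite (_ : b + (d - 1) = b + d - 1) in s2; last by ring.
apply: (symbS_intro (symbM0 c0 sg sh) (G' := fun e y0 y => G' e y0 y * H e y0 y + G e y0 y * H' e y0 y)).
  by move=> e y0 y e1 cy; apply: is_cderiveM; [exact: dg|exact: dh].
have -> : 2 ^+ m.+1 * (M * N) = 2 ^+ m * (M * N) + 2 ^+ m * (M * N).
  by rewrite exprS; ring.
exact: symbD s1 s2.
Qed.

Lemma symb_zero c m b M : 0 <= M -> symb c m b M (fun _ _ _ => 0) (fun _ => 0).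
Proof.
move=> M0; elim: m b => [|m IH] b.
  apply: symb0_intro.
  - by move=> e y0 y _ _; rewrite Normc.normc0 mulr_ge0// powR_ge0.
  - by move=> y0 y _; exact: cvg_cst.
  - by move=> e y0 _; split; apply: continuous_subspaceT => x; exact: cvg_cst.
apply: symbS_intro (symb_0 (IH b)) _ (IH (b - 1)) => e y0 y _ _.
exact: is_cderive_cst.
Qed.

Lemma symb_cst c m M (z : R -> R[i]) z0 : 0 <= M ->
  (forall e, 0 < e <= 1 -> normc (z e) <= M) -> z e @[e --> 0^'+] --> z0 ->
  symb c m 0 M (fun e _ _ => z e) (fun _ => z0).
Proof.
move=> M0 zM cz.
have s0 : symb c 0 0 M (fun e _ _ => z e) (fun _ => z0).
  apply: symb0_intro.
  - by move=> e y0 y e1 _; rewrite powRr0 mulr1; exact: zM.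
  - by move=> y0 y _; exact: cz.
  - by move=> e y0 _; split; apply: continuous_subspaceT => x; exact: cvg_cst.
case: m => [//|m]; apply: symbS_intro s0 _ (symb_zero c m (0 - 1) M0) => e y0 y _ _.
exact: is_cderive_cst.
Qed.
End Oscillatory.

(** * The inverse logarithmic derivative of the kernel *)

Section OscillatoryIntegral.
Context {R : realType}.
Local Notation mu := (@lebesgue_measure R).
Local Notation Re := (@complex.Re R).
Local Notation Im := (@complex.Im R).
Local Notation normc := (@Normc.normc R).

Lemma ReV (z : R[i]) : Re z^-1 = Re z / (Re z ^+ 2 + Im z ^+ 2).
Proof. by case: z. Qed.

Lemma ImV (z : R[i]) : Im z^-1 = - (Im z / (Re z ^+ 2 + Im z ^+ 2)).
Proof. by case: z. Qed.

Lemma is_cderiveV (f : R -> R[i]) (x : R) (l : R[i]) : f x != 0 ->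
  is_cderive f x l -> is_cderive (fun y => (f y)^-1) x (- l * ((f x)^-1 * (f x)^-1)).
Proof.
move=> fx0 [d1 d2].
have n0 : Re (f x) ^+ 2 + Im (f x) ^+ 2 != 0.
  rewrite paddr_eq0 ?sqr_ge0// !sqrf_eq0; apply: contra fx0 => /andP[/eqP a /eqP b].
  by apply/eqP/complex_eq.
have dn : is_derive x (1 : R) (fun y => Re (f y) ^+ 2 + Im (f y) ^+ 2)
    (2 * Re (f x) * Re l + 2 * Im (f x) * Im l).
  by apply: is_derive_eq; rewrite /GRing.scale/=; ring.
pose N := fun y => Re (f y) ^+ 2 + Im (f y) ^+ 2.
have dv := @is_deriveV _ N x _ 1 n0 dn.
split.
  under eq_fun do rewrite ReV.
  apply: is_derive_eq (is_deriveM d1 dv) _.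
  by rewrite /GRing.scale/= /N !(ReImE, ReV, ImV); field.
under eq_fun do rewrite ImV.
apply: is_derive_eq (is_deriveN (is_deriveM d2 dv)) _.
by rewrite /GRing.scale/= /N !(ReImE, ReV, ImV); field.
Qed.

Lemma is_cderive_phase (a e y0 y : R) :
  is_cderive (phase a e y0) y ((- e) +i* a).
Proof.
split; rewrite ?ReX ?ImX; under eq_fun do rewrite ?Re_phase ?Im_phase.
  by apply: is_derive_eq; rewrite /GRing.scale/=; ring.
by apply: is_derive_eq; rewrite /GRing.scale/=; ring.
Qed.

(** The factor that an integration by parts brings in: as
    [osc' = 2 * phase * osc], one has [osc = osc' * amp]. *)
Definition amp (a e y0 y : R) : R[i] := (2 * phase a e y0 y)^-1.
(** The limit of [amp a e y0] as [e -> 0+]. *)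
Definition amp0 (a y : R) : R[i] := (2 * (0 +i* (a * y)))^-1.

Lemma complex2E : (2 : R[i]) = (2 : R)%:C. Proof. by rewrite rmorph_nat. Qed.

Lemma phase_neq0 (a e y0 y : R) : a != 0 -> 0 < y -> 2 * phase a e y0 y != 0.
Proof.
move=> a0 y0'; rewrite mulf_neq0 ?pnatr_eq0//.
apply/eqP => /(congr1 Im); rewrite Im_phase => /eqP.
by rewrite mulf_eq0 (negbTE a0) gt_eqF.
Qed.

Lemma is_cderive_amp (a e y0 y : R) : a != 0 -> 0 < y ->
  is_cderive (amp a e y0) y
    (- 2 * ((- e) +i* a) * (amp a e y0 y * amp a e y0 y)).
Proof.
move=> a0 y0'; have n0 := phase_neq0 e y0 a0 y0'.
have d := is_cderiveM (is_cderive_cst (2 : R[i]) y) (is_cderive_phase a e y0 y).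
have := is_cderiveV n0 d; rewrite -/(amp a e y0 y); congr is_cderive.
by rewrite mul0r add0r mulNr.
Qed.

(** The imaginary part [a y] of the phase does not depend on [e], and it alone
    keeps the phase away from zero. *)
Lemma normc_amp (a e y0 y : R) : a != 0 -> 0 < y ->
  normc (amp a e y0 y) <= (2 * `|a|)^-1 * y `^ (-1).
Proof.
move=> a0 y0'; rewrite /amp Normc.normcV Normc.normcM (powR_inv1 (ltW y0')) -invfM.
rewrite complex2E normcR ger0_norm// lef_pV2.
- rewrite -mulrA ler_wpM2l//; apply: le_trans (normc_Im _).
  by rewrite Im_phase normrM (gtr0_norm y0').
- rewrite posrE mulr_gt0// (lt_le_trans _ (normc_Im _))//.
  by rewrite Im_phase normr_gt0 mulf_neq0// gt_eqF.
- by rewrite posrE !mulr_gt0// normr_gt0.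
Qed.

Lemma cvg_amp (a y0 y : R) : a != 0 -> 0 < y ->
  amp a e y0 y @[e --> 0^'+] --> amp0 a y.
Proof.
move=> a0 y0'; apply: cvgV.
  rewrite mulf_neq0 ?pnatr_eq0//; apply/eqP => /(congr1 Im)/eqP /=.
  by rewrite mulf_eq0 (negbTE a0) gt_eqF.
apply: cvgM; first exact: cvg_cst.
apply/cvg_complexP; split.
  under eq_fun do rewrite Re_phase.
  have <- : - (0 : R) * (y - y0) = Re (0 +i* (a * y)) by rewrite oppr0 mul0r.
  apply: cvg_at_right_filter.
  by apply: cvgM; [apply: cvgN; exact: cvg_id|exact: cvg_cst].
by under eq_fun do rewrite Im_phase; exact: cvg_cst.
Qed.

(** The derivative of [amp] is a constant times [amp * amp], so that the bounds
    on the derivatives follow by induction from the product rule, with constants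
    that only depend on bounds for [`|a|]. *)
Lemma symb_amp (A1 A2 : R) (m : nat) : 0 < A1 -> exists2 K : R, 0 <= K &
  forall a c, A1 <= `|a| <= A2 -> 0 < c -> symb c m (-1) K (amp a) (amp0 a).
Proof.
move=> A10.
have base (K a c : R) : (2 * A1)^-1 <= K -> A1 <= `|a| <= A2 -> 0 < c ->
    symb c 0 (-1) K (amp a) (amp0 a).
  move=> K1 /andP[a1 a2] c0.
  have a0 : a != 0 by rewrite -normr_gt0 (lt_le_trans A10).
  apply: symb0_intro.
  - move=> e y0 y e1 cy; have y00 := lt_le_trans c0 cy.
    apply: le_trans (normc_amp e y0 a0 y00) _.
    rewrite ler_wpM2r ?powR_ge0//; apply: le_trans K1.
    by rewrite lef_pV2 ?posrE ?mulr_gt0 ?normr_gt0// ler_wpM2l.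
  - by move=> y0 y cy; apply: cvg_amp => //; exact: lt_le_trans cy.
  - move=> e y0 e1; apply: is_cderive_ccontinuous => y.
    rewrite /= in_itv/= andbT => cy; apply: is_cderive_amp => //.
    exact: lt_le_trans cy.
have K00 : 0 <= (2 * A1)^-1 by rewrite invr_ge0 mulr_ge0// ltW.
elim: m => [|m [K K0 KP]]; first by exists (2 * A1)^-1 => // a c; exact: base.
pose Z : R := 2 * (1 + `|A2|).
have Z0 : 0 <= Z by rewrite mulr_ge0 ?addr_ge0.
pose K2 : R := 2 ^+ m * (Z * (2 ^+ m * (K * K))).
have K20 : 0 <= K2 by rewrite !mulr_ge0// exprn_ge0.
exists ((2 * A1)^-1 + K2); first exact: addr_ge0.
move=> a c aA c0; have sa := KP a c aA c0.
have a0 : a != 0.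
  by case/andP: aA => a1 _; rewrite -normr_gt0 (lt_le_trans A10).
have sz : symb c m 0 Z (fun e _ _ => - 2 * ((- e) +i* a)) (fun _ => - 2 * (0 +i* a)).
  apply: (@symb_cst _ _ _ _ (fun e => - 2 * ((- e) +i* a))) => //.
    move=> e /andP[e0 e1]; rewrite Normc.normcM normcN complex2E normcR ger0_norm//.
    rewrite ler_wpM2l//; apply: le_trans (normc_le _) _.
    rewrite ReX ImX normrN lerD//; first by rewrite ger0_norm// ltW.
    by case/andP: aA => _ /le_trans; apply; exact: ler_norm.
  apply: cvgM; first exact: cvg_cst.
  apply/cvg_complexP; split.
    have -> : Re (0 +i* a) = - 0 by rewrite oppr0.
    by apply: cvg_at_right_filter; apply: cvgN; exact: cvg_id.
  by apply: cvg_cst.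
have sp := symbM c0 sz (symbM c0 sa sa).
rewrite (_ : 0 + (-1 + -1) = -1 - 1) in sp; last by ring.
apply: (symbS_intro (base _ _ _ _ aA c0) _ (symb_le _ sp)).
- by rewrite lerDl.
- move=> e y0 y e1 cy; apply: is_cderive_amp => //; exact: lt_trans cy.
- by rewrite lerDr.
Qed.
End OscillatoryIntegral.

(** * Uniform bounds and limits of oscillatory integrals *)

Section OscMain.
Context {R : realType}.
Local Notation mu := (@lebesgue_measure R).
Local Notation intg D f := (mu.-integrable D (EFin \o f)).
Local Notation normc := (@Normc.normc R).

Lemma itv01_gt0 (e : R) : 0 < e <= 1 -> 0 < e. Proof. by case/andP. Qed.

Lemma symb_osc_integrable (a c b M : R) m G g e y0 : 0 < c -> 0 < e <= 1 ->
  symb c m b M G g ->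
  cintegrable `[c, +oo[ (fun y => osc a e y0 y * G e y0 y).
Proof.
move=> c0 e1 s; apply: (@osc_integrable _ a e y0 c b M) => //.
- exact: itv01_gt0 e1.
- exact: symb_ge0 s.
- by apply: ccontinuous_measurable => //; exact: (symb_cont s).
- by move=> y cy; exact: (symb_bound s).
Qed.

Lemma near_itv01 : \forall e \near (0 : R)^'+, 0 < e <= 1.
Proof.
near=> e; apply/andP; split; near: e; first exact: nbhs_right_gt.
exact: nbhs_right_le.
Unshelve. all: by end_near. Qed.

(** Integration by parts. Since [osc * G = osc' * (G * amp)], the integral of
    [osc * G] is a boundary term minus the integral of [osc * (G * amp)'], where
    the new amplitude has order [b - 2] and one derivative less. After [m] steps
    the order is [b - 2 m < -1] and the integral converges absolutely: there,
    dominated convergence gives the limit. The boundary terms are values at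
    [c], which are bounded and converge. *)
Lemma osc_integral_symb (m : nat) (b A1 A2 c1 c2 : R) : 0 < A1 -> 0 < c1 ->
  b + 1 < (2 * m)%:R -> exists2 C : R, 0 <= C &
  forall a c M G g, A1 <= `|a| <= A2 -> c1 <= c <= c2 -> symb c m b M G g ->
  (forall e y0, 0 < e <= 1 ->
    normc (cintegral `[c, +oo[ (fun y => osc a e y0 y * G e y0 y)) <= C * M) /\
  exists L : R[i], forall y0,
    cintegral `[c, +oo[ (fun y => osc a e y0 y * G e y0 y) @[e --> 0^'+] --> L.
Proof.
move=> A10 c10; elim: m b => [|m IH] b b1.
  have bm : b < -1 by move: b1; rewrite muln0; lra.
  have bn : 0 <= - (b + 1)^-1 by rewrite oppr_ge0 invr_le0; lra.
  exists (2 * (c1 `^ (b + 1) * - (b + 1)^-1)).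
    by rewrite !mulr_ge0// powR_ge0.
  move=> a c M G g aA /andP[cc1 cc2] s.
  have c0 : 0 < c by exact: lt_le_trans cc1.
  have M0 := symb_ge0 c0 s.
  have [ip eI] := integral_powR c0 bm.
  have ih : intg `[c, +oo[ (fun y => M * y `^ b) by exact: integrable_scale.
  have mE e y0 : 0 < e <= 1 -> cmeasurable `[c, +oo[ (fun y => osc a e y0 y * G e y0 y).
    move=> e1; apply: cmeasurableM; apply: ccontinuous_measurable => //.
      exact: ccontinuous_osc.
    exact: (symb_cont s).
  have bE e y0 y : 0 < e <= 1 -> `[c, +oo[%classic y ->
      normc (osc a e y0 y * G e y0 y) <= M * y `^ b.
    move=> e1; rewrite /= in_itv/= andbT => cy.
    apply: le_trans (symb_bound s y0 e1 cy).
    rewrite Normc.normcM ler_piMl ?normc_ge0// normc_osc_le1// ltW//.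
    exact: itv01_gt0 e1.
  split.
    move=> e y0 e1.
    have [_ h] := cintegral_bound (measurable_itv _) (mE e y0 e1) ih (fun y => bE e y0 y e1).
    apply: le_trans h _; rewrite RintegralZl// eI -mulrA ler_wpM2l//.
    rewrite mulrC -mulrN ler_wpM2r// ler_wpM2r//.
    by apply: powR_anti => //; lra.
  exists (cintegral `[c, +oo[ (fun y => expi (a * y ^+ 2) * g y)) => y0.
  apply: (cintegral_dct_right (h := fun y => M * y `^ b)) => //.
  - by move=> e e1; exact: mE.
  - move=> y; rewrite /= in_itv/= andbT => cy.
    by apply: cvgM; [exact: cvg_osc|exact: (symb_cvg s)].
  - by move=> e y e1 cy; exact: bE.
have [K K0 KP] := symb_amp A2 m.+1 A10.
have b2 : b - 1 - 1 + 1 < (2 * m)%:R.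
  by move: b1; rewrite mulnS natrD; lra.
have [C C0 CP] := IH _ b2.
pose P : R := 2 ^+ m.+1 * K.
have P0 : 0 <= P by rewrite mulr_ge0// exprn_ge0.
exists (P * (c1 `^ (b - 1) + c2 `^ (b - 1)) + C * P).
  by rewrite addr_ge0// mulr_ge0// addr_ge0// powR_ge0.
move=> a c M G g aA cc s.
have c0 : 0 < c by case/andP: cc => cc1 _; exact: lt_le_trans cc1.
have M0 := symb_ge0 c0 s.
have a0 : a != 0 by case/andP: aA => a1 _; rewrite -normr_gt0 (lt_le_trans A10).
have sH := symbM c0 s (KP a c aA c0).
(* [H'] is the derivative of [G * amp], of order [b - 1 - 1]. *)
have [H' [h' [dH sH']]] := symb_deriv sH.
have EN : 2 ^+ m.+1 * (M * K) = P * M by rewrite /P; ring.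
rewrite EN in sH sH'.
have [bH' [L' cH']] := CP a c _ _ _ aA cc sH'.
pose Hc e y0 := G e y0 c * amp a e y0 c.
have parts e y0 : 0 < e <= 1 ->
    cintegral `[c, +oo[ (fun y => osc a e y0 y * G e y0 y) =
    - (osc a e y0 c * Hc e y0)
    - cintegral `[c, +oo[ (fun y => osc a e y0 y * H' e y0 y).
  move=> e1.
  have i1 := symb_osc_integrable a y0 c0 e1 s.
  have i2 := symb_osc_integrable a y0 c0 e1 sH'.
  apply/eqP; rewrite -subr_eq opprK; apply/eqP.
  rewrite -cintegralD//.
  apply: (@cFTC2y _ (fun y => osc a e y0 y * (G e y0 y * amp a e y0 y))).
  - apply: ccontinuousD; apply: ccontinuousM; try exact: ccontinuous_osc.
      exact: (symb_cont s).
    exact: (symb_cont sH').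
  - exact: cintegrableD.
  - apply: ccontinuousM; first exact: ccontinuous_osc.
    exact: (symb_cont sH).
  - move=> y cy; have y00 := lt_trans c0 cy.
    have := is_cderiveM (is_cderive_osc a e y0 y) (dH e y0 y e1 cy).
    congr is_cderive; congr (_ + _).
    have n0 := phase_neq0 e y0 a0 y00.
    rewrite /amp; move: (osc _ _ _ _) (G _ _ _) n0 => o u.
    by move: (2 * phase _ _ _ _) => W n0; field.
    (* For fixed [e] the Gaussian makes the boundary term at infinity vanish. *)
  - have [K' K'0 K'P] := osc_decay a y0 (itv01_gt0 e1) c0 (symb_ge0 c0 sH)
       (fun y => @symb_bound _ _ _ _ _ _ _ sH e y0 y e1).
    have c2y : K' * y `^ (-2) @[y --> +oo] --> (0 : R).
      rewrite -[X in _ --> X](mulr0 K'); apply: cvgM; first exact: cvg_cst.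
      by apply: cvg_powRy; lra.
    apply: (squeeze_cvgr _ (cvg_cst 0) c2y); near=> y; rewrite normc_ge0/=.
    by apply: K'P; near: y; apply: nbhs_pinfty_ge; rewrite num_real.
(* The sum covers both signs of the exponent. *)
have bc : c `^ (b - 1) <= c1 `^ (b - 1) + c2 `^ (b - 1).
  case/andP: cc => cc1 cc2.
  have [b0|b0] := leP (b - 1) 0.
    by rewrite ler_wpDr ?powR_ge0// powR_anti.
  rewrite ler_wpDl ?powR_ge0// ge0_ler_powR ?nnegrE// ltW//.
  exact: lt_le_trans cc2.
split.
  move=> e y0 e1; rewrite parts//.
  apply: le_trans (le_normcD _ _) _; rewrite !normcN mulrDl; apply: lerD.
    rewrite Normc.normcM; apply: (@le_trans _ _ (normc (Hc e y0))).
      by rewrite ler_piMl ?normc_ge0// normc_osc_le1// ltW//; exact: itv01_gt0 e1.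
    apply: le_trans (symb_bound sH y0 e1 (lexx _)) _.
    by rewrite mulrAC ler_wpM2r// ler_wpM2l.
  by apply: le_trans (bH' e y0 e1) _; rewrite mulrA.
exists (- (expi (a * c ^+ 2) * (g c * amp0 a c)) - L') => y0.
have cv : - (osc a e y0 c * Hc e y0)
    - cintegral `[c, +oo[ (fun y => osc a e y0 y * H' e y0 y) @[e --> 0^'+]
    --> - (expi (a * c ^+ 2) * (g c * amp0 a c)) - L'.
  apply: cvgD; last by apply: cvgN; exact: cH'.
  apply: cvgN; apply: cvgM; first exact: cvg_osc.
  by apply: (symb_cvg sH).
apply: cvg_trans cv; apply: near_eq_cvg; near=> e; rewrite parts//.
by near: e; exact: near_itv01.
Unshelve. all: by end_near. Qed.
End OscMain.

(** * Functions of power growth as symbols *)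

Section Growth.
Context {R : realType}.
Local Notation Re := (@complex.Re R).
Local Notation Im := (@complex.Im R).
Local Notation normc := (@Normc.normc R).

Lemma derivable_on_continuous (D : set R) (f : R -> R[i]) (x : R) :
  derivable_on D f x -> f y @[y --> within D (nbhs x)] --> f x.
Proof.
move=> /cvg_ex[l hl].
have h1 : dquot f x y * (y - x)%:C + f x @[y --> within D x^'] --> l * 0 + f x.
  apply: cvgD; last exact: cvg_cst.
  apply: cvgM; first exact: hl.
  apply: cvg_within_filter; apply/cvg_complexP; split => /=; last exact: cvg_cst.
  rewrite -[X in _ --> X](subrr x); apply: cvgB; last exact: cvg_cst.
  by apply: cvg_within_filter; exact: cvg_id.
rewrite mulr0 add0r in h1.
move=> A nA; have := h1 A nA; rewrite /nbhs/= /within/= => h.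
have h' : \forall y \near x, y != x -> D y -> A (dquot f x y * (y - x)%:C + f x) := h.
rewrite /nbhs/= /within/=; apply: filterS h' => y h' Dy.
have [->|yx] := eqVneq y x; first exact: nbhs_singleton.
have := h' yx Dy; rewrite /dquot divfK ?subrK//.
by apply: contra yx => /eqP /(congr1 Re) /= /eqP; rewrite subr_eq0.
Qed.

Lemma ccontinuousP (D : set R) (f : R -> R[i]) :
  (forall x, D x -> f y @[y --> within D (nbhs x)] --> f x) -> ccontinuous D f.
Proof.
move=> h; split; apply/subspace_continuousP => x Dx;
  by have /cvg_complexP[] := h x Dx.
Qed.

Lemma MVT_le (f f' : R -> R) (p q B : R) : p <= q ->
  {within `[p, q], continuous f} ->
  (forall x, p < x < q -> is_derive x 1 f (f' x)) ->
  (forall x, p < x < q -> `|f' x| <= B) -> `|f q - f p| <= B * (q - p).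
Proof.
rewrite le_eqVlt => /predU1P[<- *|pq cf df bf].
  by rewrite !subrr normr0 mulr0.
have df' x : x \in `]p, q[ -> is_derive x 1 f (f' x).
  by rewrite in_itv/=; exact: df.
have [c cpq ->] := @MVT _ f f' p q pq df' cf.
rewrite normrM (@ger0_norm _ (q - p)) ?subr_ge0 ?(ltW pq)// ler_wpM2r//.
  by rewrite subr_ge0 ltW.
by apply: bf; move: cpq; rewrite in_itv.
Qed.

(** The factor 2 comes from applying the mean value theorem to the real and the
    imaginary part separately. *)
Lemma cMVT_le (f f' : R -> R[i]) (p q B : R) : p <= q ->
  ccontinuous `[p, q] f ->
  (forall x, p < x < q -> is_cderive f x (f' x)) ->
  (forall x, p < x < q -> normc (f' x) <= B) ->
  normc (f q - f p) <= 2 * (B * (q - p)).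
Proof.
move=> pq [c1 c2] df bf; apply: le_trans (normc_le _) _.
rewrite mulr_natl mulr2n !ReImE; apply: lerD.
  apply: (@MVT_le (fun x => Re (f x)) (fun x => Re (f' x))) => // x xpq.
    by have [] := df x xpq.
  by apply: le_trans (bf x xpq); exact: normc_Re.
apply: (@MVT_le (fun x => Im (f x)) (fun x => Im (f' x))) => // x xpq.
  by have [] := df x xpq.
by apply: le_trans (bf x xpq); exact: normc_Im.
Qed.

Lemma growth_norm_bounds (n : nat) (alpha b0 M : R) (f : R -> R[i]) :
  0 < b0 -> (Cn_growth_norm n alpha b0 f <= M%:E)%E ->
  [/\ 0 <= M,
    forall k, (k < n)%N -> normc (derive_on_n `[b0, +oo[ k f b0) <=
       M * b0 `^ (n%:R - k%:R + alpha) &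
    forall y, b0 <= y ->
       normc (derive_on_n `[b0, +oo[ n f y) <= M * y `^ alpha].
Proof.
move=> b00; rewrite /Cn_growth_norm.
set S := \sum_(k < n) _; set A := ereal_sup _ => SA.
have S0 : 0 <= S by apply: sumr_ge0 => i _; rewrite divr_ge0 ?normc_ge0 ?powR_ge0.
have AP y : b0 <= y ->
    ((normc (derive_on_n `[b0, +oo[ n f y) / y `^ alpha)%:E <= A)%E.
  move=> by_; apply: ereal_sup_ubound; exists y => //.
  by rewrite /= in_itv/= by_.
have A0 : (0 <= A)%E.
  by apply: le_trans (AP b0 (lexx _)); rewrite lee_fin divr_ge0 ?normc_ge0 ?powR_ge0.
have AM : (A <= M%:E)%E by apply: le_trans SA; rewrite leeDr// lee_fin.
have SM : S <= M by rewrite -lee_fin; apply: le_trans SA; rewrite leeDl.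
split; first exact: le_trans SM.
- move=> k kn; apply: le_trans (_ : S * b0 `^ (n%:R - k%:R + alpha) <= _); last first.
    by rewrite ler_wpM2r// powR_ge0.
  rewrite -ler_pdivrMr ?powR_gt0// /S (bigD1 (Ordinal kn))//=.
  rewrite natrB ?(ltnW kn)// lerDl; apply: sumr_ge0 => i _.
  by rewrite divr_ge0 ?normc_ge0 ?powR_ge0.
- move=> y by_; rewrite -ler_pdivrMr ?powR_gt0 ?(lt_le_trans b00)//.
  by rewrite -lee_fin; apply: le_trans AM; exact: AP.
Qed.

(** Descending from the [n]-th derivative, each integration from [b0] raises the
    exponent by one. The constant triples: the complex mean value inequality
    accounts for 2, and the value at [b0], which the norm controls with the
    exponent that fits because [b0 <= y], for 1. *)
Lemma growth_symb (n : nat) (alpha b0 M : R) (f : R -> R[i]) :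
  0 < b0 -> 0 <= alpha -> Cn_growth n alpha b0 f ->
  (Cn_growth_norm n alpha b0 f <= M%:E)%E ->
  symb b0 n (alpha + n%:R) (3 ^+ n * M) (fun _ _ => f) f.
Proof.
move=> b00 a0 [[df cf] _] nf.
have [M0 fb fn] := growth_norm_bounds b00 nf.
pose F k := derive_on_n `[b0, +oo[ k f.
have inD y : b0 <= y -> (`[b0, +oo[%classic : set R) y by rewrite /= in_itv/= andbT.
have dF k y : (k < n)%N -> b0 < y -> is_cderive (F k) y (F k.+1 y).
  move=> kn by_; apply: derivable_on_is_cderive.
    by apply: filterS (lt_nbhsr by_) => z /ltW; exact: inD.
  by apply: df => //; exact/inD/ltW.
have cF k : (k <= n)%N -> ccontinuous `[b0, +oo[ (F k).
  rewrite leq_eqVlt => /predU1P[->|kn]; apply: ccontinuousP => x Dx.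
    by move/subspace_continuousP : cf; exact.
  by apply: derivable_on_continuous; exact: df.
(* [j] counts the derivatives that are missing from the [n]-th one. *)
have bF j y : (j <= n)%N -> b0 <= y ->
    normc (F (n - j)%N y) <= 3 ^+ j * M * y `^ (alpha + j%:R).
  elim: j y => [|j IH] y jn by_.
    by rewrite subn0 expr0 mul1r addr0; exact: fn.
  have y0 := lt_le_trans b00 by_.
  have kn : (n - j.+1 < n)%N by rewrite ltn_subrL// (leq_trans _ jn).
  have kS : (n - j.+1).+1 = (n - j)%N by rewrite subnSK.
  have h1 := fb _ kn.
  have h2 : normc (F (n - j.+1)%N y - F (n - j.+1)%N b0) <=
      2 * (3 ^+ j * M * y `^ (alpha + j%:R) * (y - b0)).
    apply: (@cMVT_le _ (F (n - j)%N)) => //.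
    - apply: ccontinuousS (cF _ (ltnW kn)).
      by apply: subset_itvl; rewrite bnd_simp.
    - by move=> x /andP[bx _]; rewrite -kS; exact: dF.
    - move=> x /andP[bx xy]; apply: le_trans (IH _ (ltnW jn) (ltW bx)) _.
      rewrite ler_wpM2l ?mulr_ge0 ?exprn_ge0// ge0_ler_powR ?addr_ge0 ?nnegrE//.
      + by rewrite ltW// (lt_trans b00).
      + exact: ltW.
      + exact: ltW.
  rewrite -[F _ y](subrK (F (n - j.+1)%N b0)).
  apply: le_trans (le_normcD _ _) _; apply: le_trans (lerD h2 h1) _.
  have -> : n%:R - (n - j.+1)%:R + alpha = alpha + j.+1%:R :> R.
    by rewrite natrB//; ring.
  have e1 : b0 `^ (alpha + j.+1%:R) <= y `^ (alpha + j.+1%:R).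
    by rewrite ge0_ler_powR ?addr_ge0 ?nnegrE// ltW.
  have e2 : y `^ (alpha + j%:R) * (y - b0) <= y `^ (alpha + j.+1%:R).
    have -> : alpha + j.+1%:R = (alpha + j%:R) + 1 by rewrite -natr1; ring.
    rewrite [leRHS]powR_add// powRr1 ?(ltW y0)// ler_wpM2l ?powR_ge0//; lra.
  have e3 : (1 : R) <= 3 ^+ j by rewrite exprn_ege1// ler1n.
  have p0 := powR_ge0 y (alpha + j.+1%:R).
  have M1 : M * b0 `^ (alpha + j.+1%:R) <= 3 ^+ j * (M * y `^ (alpha + j.+1%:R)).
    apply: (@le_trans _ _ (M * y `^ (alpha + j.+1%:R))); first by rewrite ler_wpM2l.
    by rewrite ler_peMl// mulr_ge0.
  have M2 : 3 ^+ j * M * (y `^ (alpha + j%:R) * (y - b0)) <=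
      3 ^+ j * M * y `^ (alpha + j.+1%:R).
    by rewrite ler_wpM2l// mulr_ge0// exprn_ge0.
  have -> : 3 ^+ j.+1 * M * y `^ (alpha + j.+1%:R) =
      2 * (3 ^+ j * M * y `^ (alpha + j.+1%:R)) +
      3 ^+ j * (M * y `^ (alpha + j.+1%:R)) by rewrite exprS; ring.
  by apply: lerD M1; rewrite ler_wpM2l// -mulrA.
have main j : (j <= n)%N -> symb b0 j (alpha + j%:R) (3 ^+ n * M)
    (fun _ _ => F (n - j)%N) (F (n - j)%N).
  have base i : (i <= n)%N -> symb b0 0 (alpha + i%:R) (3 ^+ n * M)
    (fun _ _ => F (n - i)%N) (F (n - i)%N).
    move=> i_n; apply: symb0_intro.
    - move=> e y0 y _ by_; apply: le_trans (bF _ _ i_n by_) _.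
      rewrite ler_wpM2r ?powR_ge0// ler_wpM2r// ler_weXn2l// ler1n//.
    - by move=> y0 y _; exact: cvg_cst.
    - by move=> e y0 _; apply: cF; exact: leq_subr.
  elim: j => [|j IH] jn; first exact: base.
  apply: (symbS_intro (base _ jn) (G' := fun _ _ => F (n - j)%N) (g' := F (n - j)%N)).
    move=> e y0 y _ by_.
    have kS : (n - j.+1).+1 = (n - j)%N by rewrite subnSK.
    by rewrite -kS; apply: dF => //; rewrite ltn_subrL// (leq_trans _ jn).
  have -> : alpha + j.+1%:R - 1 = alpha + j%:R by rewrite -natr1; ring.
  exact: IH (ltnW jn).
by have := main n (leqnn n); rewrite subnn.
Qed.

Lemma symb_id (c : R) (m : nat) : 0 < c ->
  symb c m 1 1 (fun _ _ y => y%:C) (fun y => y%:C).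
Proof.
move=> c0.
have s0 : symb c 0 1 1 (fun _ _ y => y%:C) (fun y => y%:C).
  apply: symb0_intro.
  - move=> e y0 y _ cy; rewrite normcR mul1r powRr1 ?ger0_norm//;
      by rewrite ltW// (lt_le_trans c0).
  - by move=> y0 y _; exact: cvg_cst.
  - move=> e y0 _; apply: (@is_cderive_ccontinuous _ _ _ (fun _ => 1%:C)) => x _.
    by apply: is_cderiveR; exact: is_derive_id.
case: m => [//|m]; apply: (symbS_intro s0 (G' := fun _ _ _ => 1%:C) (g' := fun _ => 1%:C)).
  by move=> e y0 y _ _; apply: is_cderiveR; exact: is_derive_id.
rewrite subrr; apply: (@symb_cst _ _ _ _ (fun _ => 1%:C)) => //.
  by move=> e _; rewrite normcR normr1.
exact: cvg_cst.
Qed.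
End Growth.

(** * Local absolute continuity and differentiation of integrals *)

Section LocalTools.
Context {R : realType}.
Local Notation mu := (@lebesgue_measure R).
Local Notation intg D f := (mu.-integrable D (EFin \o f)).

(** The open set [I] is covered by the countably many intervals with rational end
    points in [I]. *)
Lemma ae_local (I : set R) (P : R -> Prop) : open I ->
  (forall p q, I p -> I q -> p < q -> {ae mu, forall s, p < s < q -> P s}) ->
  {ae mu, forall s, I s -> P s}.
Proof.
move=> oI h.
pose ok (r : rat * rat) := [/\ I (ratr r.1), I (ratr r.2) & (ratr r.1 : R) < ratr r.2].
pose bad (r : rat * rat) : set R := [set s | ok r /\ ~ (ratr r.1 < s < ratr r.2 -> P s)].
pose F k : set R := if @unpickle (rat * rat)%type k is Some r then bad r else set0.
have nF k : mu.-negligible (F k).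
  rewrite /F; case: unpickle => [r|]; last exact: negligible_set0.
  have [[i1 i2 i3]|nok] := pselect (ok r).
    by apply: negligibleS (h _ _ i1 i2 i3) => s [_].
  by apply: negligibleS (negligible_set0 mu) => s [].
apply: negligibleS (negligible_bigcup nF) => s /= /not_implyP[Is nP].
have [p [q [ps sq pqI]]] := open_has_cc oI Is.
have [r1 /[!in_itv]/= /andP[pr1 r1s]] := rat_in_itvoo ps.
have [r2 /[!in_itv]/= /andP[sr2 r2q]] := rat_in_itvoo sq.
have I1 : I (ratr r1) by apply: pqI; rewrite (ltW pr1) (ltW (lt_trans r1s sq)).
have I2 : I (ratr r2) by apply: pqI; rewrite (ltW r2q) (ltW (lt_trans ps sr2)).
have Fb : bad (r1, r2) s.
  split; first by split; [exact: I1|exact: I2|exact: lt_trans sr2].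
  by move=> hP; apply: nP; apply: hP; rewrite r1s sr2.
have FE : F (pickle (r1, r2)) = bad (r1, r2) by rewrite /F pickleK.
exists (pickle (r1, r2)); first by [].
by rewrite FE.
Qed.

Lemma ae_exists (P : R -> Prop) (p q : R) : p < q ->
  {ae mu, forall s, P s} -> exists2 s, p < s < q & P s.
Proof.
move=> pq [A [mA A0 PA]]; apply: contrapT => h.
have sub : `]p, q[%classic `<=` A.
  move=> s; rewrite /= in_itv/= => spq; apply: PA => Ps.
  by apply: h; exists s.
have : (mu `]p, q[%classic <= mu A)%E.
  by apply: le_measure => //; rewrite inE//; exact: measurable_itv.
have -> : mu A = 0%E by exact: A0.
by rewrite lebesgue_measure_itv/= lte_fin pq -EFinB lee_fin; lra.
Qed.

Lemma L1loc_integrable (I : set R) (g : R -> R) (p q : R) : is_interval I ->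
  locally_integrable I g -> I p -> I q -> intg `[p, q] g.
Proof.
move=> iI [mg _ gi] Ip Iq.
have sub : `[p, q]%classic `<=` I by move=> s; rewrite /= in_itv/=; exact: iI.
apply/integrableP; split.
  by apply/measurable_EFinP; apply: measurable_funS mg => //; exact: is_interval_measurable.
by apply: gi => //; exact: segment_compact.
Qed.

Lemma density_derive (I : set R) (psi g : R -> R) : open I -> is_interval I ->
  locally_integrable I g ->
  (forall s1 s2, I s1 -> I s2 -> s1 < s2 ->
     psi s2 - psi s1 = \int[mu]_(x in `[s1, s2]) g x) ->
  {ae mu, forall s, I s -> is_derive s 1 psi (g s)}.
Proof.
move=> oI iI lg dg; apply: ae_local => // p q Ip Iq pq.
apply: (ae_mp (derive_integral pq (L1loc_integrable iI lg Ip Iq))) => s ds /andP[ps sq].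
have d1 : is_derive s (1 : R) (fun y => \int[mu]_(z in `[p, y]) g z + psi p) (g s).
  by rewrite -[g s]addr0; apply: is_deriveD (ds _) (is_derive_cst _ _ _); rewrite ps.
apply: near_eq_is_derive d1; near=> y.
have py : p < y by near: y; exact: lt_nbhsr.
rewrite -dg ?subrK//; apply: (iI p q) => //; rewrite ltW//=.
by near: y; exact: lt_le_nbhsl.
Unshelve. all: by end_near. Qed.

Lemma density_dominated (I : set R) (psi g : R -> R) (p q : R) : is_interval I ->
  locally_integrable I g -> I p -> I q ->
  (forall s1 s2, I s1 -> I s2 -> s1 < s2 ->
     psi s2 - psi s1 = \int[mu]_(x in `[s1, s2]) g x) ->
  forall s t, p <= s -> s <= t -> t <= q ->
     `|psi t - psi s| <= \int[mu]_(x in `[s, t]) `|g x|.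
Proof.
move=> iI lg Ip Iq dg s t ps st tq.
have Is : I s by apply: (iI p q) => //; rewrite ps (le_trans st).
have It : I t by apply: (iI p q) => //; rewrite tq (le_trans ps).
move: st; rewrite le_eqVlt => /predU1P[<-|st].
  by rewrite subrr normr0; apply: Rintegral_ge0.
rewrite dg//; apply: le_normr_Rintegral => //.
exact: L1loc_integrable lg _ _.
Qed.

Lemma ae_all_seq (T : eqType) (r : seq T) (P : T -> R -> Prop) :
  (forall k, k \in r -> {ae mu, forall s, P k s}) ->
  {ae mu, forall s, forall k, k \in r -> P k s}.
Proof.
elim: r => [|k r IH] h; first by apply: aeW.
have h1 := h k (mem_head _ _).
have h2 := IH (fun k' k'r => h k' (mem_behead (s := k :: r) k'r)).
by apply: (ae_mp2 h1 h2) => s s1 s2 k'; rewrite inE => /predU1P[->|]; [|exact: s2].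
Qed.

(** Finitely many of the neighbourhoods cover the segment; the sum of their
    bounds dominates each of them. *)
Lemma ae_bounded_compact (I : set R) (N : R -> \bar R) (p q : R) :
  ae_locally_bounded I N -> (forall x, p <= x <= q -> I x) ->
  exists M : R, {ae mu, forall s, p <= s <= q -> (N s <= M%:E)%E}.
Proof.
move=> lN pqI.
have /choice[g gP] : forall s0, exists MU : R * set R, I s0 ->
    nbhs s0 MU.2 /\ {ae mu, forall s, I s -> MU.2 s -> (N s <= MU.1%:E)%E}.
  move=> s0; have [Is0|nI] := pselect (I s0); last by exists (0, setT).
  by have [M [U nU h]] := lN s0 Is0; exists (M, U).
have := @segment_compact R p q; rewrite compact_cover.
move=> /(_ R `[p, q]%classic (fun s0 => (g s0).2°)) [].
- by move=> i _; exact: open_interior.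
- move=> s spq; exists s => //.
  have [nU _] := gP s (pqI s spq).
  exact: nU.
move=> D' D'pq cov.
pose r : seq R := finmap.enum_fset D'.
exists (\sum_(k <- r) `|(g k).1|).
have /ae_mp : {ae mu, forall s, forall k, k \in r -> I s -> (g k).2 s ->
    (N s <= (g k).1%:E)%E}.
  apply: ae_all_seq => k kD'; apply: (gP k _).2; apply: pqI.
  by have := D'pq k kD'; rewrite inE.
apply => s h spq; have [k /= kD' /interior_subset Uk] := cov s spq.
apply: le_trans (h k kD' (pqI s spq) Uk) _; rewrite lee_fin.
rewrite (big_rem k)//=; apply: le_trans (ler_norm _) _.
by rewrite lerDl sumr_ge0.
Qed.

(** The difference quotients of the integrand are dominated through those of a
    function [Phi] that is differentiable at [s], and not through a Lipschitz
    bound: this is what an integrand that is merely absolutely continuous in the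
    parameter satisfies at almost every [s]. *)
Lemma derive_under_integral (D : set R) (F : R -> R -> R) (G rho Phi : R -> R)
    (p s q l : R) : measurable D -> p < s < q ->
  (forall t, p < t < q -> intg D (F t)) -> intg D rho ->
  (forall y, D y -> 0 <= rho y) ->
  (forall t y, p < t < q -> D y -> `|F t y - F s y| <= rho y * `|Phi t - Phi s|) ->
  is_derive s 1 Phi l ->
  (forall y, D y -> is_derive s 1 (F ^~ y) (G y)) ->
  is_derive s 1 (fun t => \int[mu]_(y in D) F t y) (\int[mu]_(y in D) G y).
Proof.
move=> mD psq iF irho rho0 domF dPhi dF.
apply/is_derive_dnbhsP/cvgr_dnbhsP => u [us cu].
have [N NP] : exists N, forall n, p < u (n + N)%N < q.
  have : \forall n \near \oo, p < u n < q.
    move/andP : psq => [ps sq].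
    have h1 := cvgr_gt _ cu _ ps; have h2 := cvgr_lt _ cu _ sq.
    by apply: filterS2 (h1 _) (h2 _) => n -> ->.
  move=> [N _ h]; exists N => n; apply: h => /=; exact: leq_addl.
rewrite -(cvg_shiftn N) /=; pose v n := u (n + N)%N.
have vs n : v n != s by exact: us.
have cv : v @ \oo --> s by rewrite (cvg_shiftn N).
have [B BP] : exists B : R, forall n, `|(Phi (v n) - Phi s) / (v n - s)| <= B.
  move/is_derive_dnbhsP/cvgr_dnbhsP : dPhi => /(_ v (conj vs cv)) c.
  have [B [_ h]] := cvg_seq_bounded (cvgP _ c).
  exists (B + 1) => n; apply: h => //=; last by rewrite ltrDl.
have E n : (\int[mu]_(y in D) F (v n) y - \int[mu]_(y in D) F s y) / (v n - s) =
    \int[mu]_(y in D) ((F (v n) y - F s y) / (v n - s)).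
  have i1 : intg D (F (v n)) by apply: iF; exact: NP.
  have i2 : intg D (F s) by exact: iF.
  by rewrite -RintegralB// -RintegralZr//; exact: integrable_sub.
rewrite (_ : (fun n => _) =
   (fun n => \int[mu]_(y in D) ((F (v n) y - F s y) / (v n - s)))); last first.
  by apply/funext => n; rewrite -E.
apply: (proj2 (Rintegral_dct (h := fun y => B * rho y) _ _ _ _ _)) => //.
- move=> n; apply: measurable_funM; last exact: measurable_cst.
  have i1 : intg D (F (v n)) by apply: iF; exact: NP.
  have i2 : intg D (F s) by exact: iF.
  exact: measurable_funB (integrable_measurable i1) (integrable_measurable i2).
- move=> y Dy; move/is_derive_dnbhsP/cvgr_dnbhsP : (dF y Dy); apply; split => //.
- exact: integrable_scale.
- move=> n y Dy; rewrite normrM normfV.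
  apply: (@le_trans _ _ (rho y * `|Phi (v n) - Phi s| / `|v n - s|)).
    by rewrite ler_wpM2r ?invr_ge0//; apply: domF => //; exact: NP.
  have := BP n; rewrite normrM normfV => Bn.
  by rewrite -mulrA mulrC ler_wpM2r// rho0.
Qed.

Lemma integral_tail (f : R -> R) (c x x' : R) : c <= x -> x <= x' ->
  intg `[c, +oo[ f ->
  \int[mu]_(y in `[x, +oo[) f y - \int[mu]_(y in `[x', +oo[) f y =
  \int[mu]_(y in `[x, x']) f y.
Proof.
move=> cx xx' fi.
have ix : intg `[x, +oo[ f.
  by apply: integrableS fi => //; apply: subset_itvr; rewrite bnd_simp.
have ix' : intg `]x', +oo[ f.
  apply: integrableS fi => //; apply: subset_itvr; rewrite bnd_simp.
  exact: le_trans xx'.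
have := @Rintegral_itvB _ f (BLeft x) +oo%O x' ix.
rewrite bnd_simp xx' => /(_ isT isT).
rewrite Rintegral_itv_obnd_cbnd// => <-; lra.
Qed.

(** For [k] the value of [f] at [x] this expresses differentiability in the lower
    limit, for [k = 0] a Lipschitz estimate. *)
Lemma tail_linear (f : R -> R) (c x x' k e : R) : c <= x -> c <= x' ->
  intg `[c, +oo[ f -> 0 <= e ->
  (forall y, c <= y -> `|y - x| <= `|x' - x| -> `|f y - k| <= e) ->
  `|(\int[mu]_(y in `[x, +oo[) f y - \int[mu]_(y in `[x', +oo[) f y) -
    k * (x' - x)| <= e * `|x' - x|.
Proof.
move=> cx cx' fi e0 fk.
have key u v : c <= u -> u <= v -> (forall y, u <= y <= v -> `|f y - k| <= e) ->
    `|\int[mu]_(y in `[u, v]) f y - k * (v - u)| <= e * (v - u).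
  move=> cu uv fk'.
  have iu : intg `[u, v] f.
    by apply: integrableS fi => //; apply: subset_itv; rewrite bnd_simp.
  have ic (z : R) : intg `[u, v] (fun _ => z) by exact: integrable_itv_cst.
  rewrite -!(Rintegral_itv_cst _ uv) -RintegralB//.
  apply: le_trans (le_normr_Rintegral _ _) _ => //; first exact: integrable_sub.
  apply: le_Rintegral => //.
  by have := integrable_abse (integrable_sub _ iu (ic k)); apply.
have [xx'|/ltW xx'] := leP x x'.
  rewrite (integral_tail cx xx' fi) [`|x' - x|]ger0_norm ?subr_ge0//.
  apply: key => // y /andP[xy yx']; apply: fk; first exact: le_trans xy.
  by rewrite !ger0_norm ?subr_ge0//; lra.
rewrite -[X in `|X|]opprK normrN.
have -> : - (\int[mu]_(y in `[x, +oo[) f y - \int[mu]_(y in `[x', +oo[) f y -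
   k * (x' - x)) = (\int[mu]_(y in `[x', +oo[) f y - \int[mu]_(y in `[x, +oo[) f y)
   - k * (x - x') by ring.
rewrite (integral_tail cx' xx' fi) [`|x' - x|]distrC [`|x - x'|]ger0_norm ?subr_ge0//.
apply: key => // y /andP[xy yx']; apply: fk; first exact: le_trans xy.
by rewrite distrC [leRHS]distrC !ger0_norm ?subr_ge0//; lra.
Qed.

(** The integrand moves with [t] too, but it is uniformly close to [F s (b s)] on
    the short segment between [b s] and [b t]. *)
Lemma derive_lower_limit (F : R -> R -> R) (b : R -> R) (c s b' : R) :
  (\forall t \near s, c <= b t /\ intg `[c, +oo[ (F t)) ->
  is_derive s 1 b b' ->
  (forall e : R, 0 < e -> \forall t \near s, forall y, c <= y ->
     `|y - b s| <= `|b t - b s| -> `|F t y - F s (b s)| <= e) ->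
  is_derive s 1 (fun t => \int[mu]_(y in `[b t, +oo[) F t y -
                          \int[mu]_(y in `[b s, +oo[) F t y) (- b' * F s (b s)).
Proof.
move=> hb db hF; apply/is_derive_dnbhsP.
have /is_derive_dnbhsP cb := db.
have cA : (b t - b s) / (t - s) * - F s (b s) @[t --> s^'] --> b' * - F s (b s).
  by apply: cvgM cb _; exact: cvg_cst.
rewrite mulNr -mulrN; apply: cvg_sub0 cA; apply/cvgr0Pnorm_le => /= e e0.
pose B : R := `|b'| + 1.
have B0 : 0 < B by rewrite ltr_wpDl.
have nB : \forall t \near s^', `|(b t - b s) / (t - s)| <= B.
  have cn := cvg_norm cb.
  by apply: (cvgr_le _ (cn _)); rewrite /B ltrDl.
have hbs : c <= b s by have [] := nbhs_singleton hb.
have eB : 0 < e / B by rewrite divr_gt0.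
near=> t; rewrite fctE /= subrr subr0.
have [cbt it] : c <= b t /\ intg `[c, +oo[ (F t).
  by near: t; exact: cvg_within hb.

have Ft : forall y, c <= y -> `|y - b s| <= `|b t - b s| ->
   `|F t y - F s (b s)| <= e / B by near: t; exact: cvg_within (hF _ eB).
have := tail_linear hbs cbt it (ltW eB) Ft.
set J1 := \int[mu]_(y in `[b s, +oo[) F t y; set J2 := Rintegral _ _ _ => h.
have -> : (J2 - J1) / (t - s) - (b t - b s) / (t - s) * - F s (b s) =
   - ((J1 - J2 - F s (b s) * (b t - b s)) / (t - s)) by ring.
rewrite normrN normrM.
apply: (@le_trans _ _ (e / B * `|b t - b s| * `|(t - s)^-1|)).
  by rewrite ler_wpM2r.
have Bn0 : B != 0 by rewrite gt_eqF.
rewrite -mulrA -normrM -[leRHS](divfK Bn0) ler_wpM2l//.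
  exact: ltW.
by near: t.
Unshelve. all: by end_near. Qed.
End LocalTools.

(** * Integrals over half-lines with a moving end point *)

Section MovingIntegral.
Context {R : realType}.
Local Notation mu := (@lebesgue_measure R).
Local Notation intg D f := (mu.-integrable D (EFin \o f)).
Local Notation Re := (@complex.Re R).
Local Notation Im := (@complex.Im R).
Local Notation normc := (@Normc.normc R).

Lemma integrable_tail (c x K : R) : 0 < c -> c <= x ->
  intg `[x, +oo[ (fun y => K * y `^ (-2)).
Proof.
move=> c0 cx; apply: integrable_scale => //.
by apply: (integral_powR (lt_le_trans c0 cx) _).1; lra.
Qed.

Lemma near_itvoo (p s q : R) : p < s < q -> \forall t \near s, p < t < q.
Proof.
by case/andP => ps sq; apply: filterS2 (lt_nbhsr ps) (lt_nbhsl sq) => t -> ->.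
Qed.

(** The increment in [t] splits into that of the lower limit, for the integrand
    [F t], and that of the integrand over the fixed half-line
    [[b s, +oo[]. *)
Lemma derive_moving_integral (F : R -> R -> R) (Q : R -> R) (b Phi : R -> R)
    (p s q c K l b' : R) : 0 < c -> 0 <= K -> p < s < q ->
  (forall t, p < t < q -> c <= b t) ->
  (forall t, p < t < q -> measurable_fun `[c, +oo[ (F t)) ->
  (forall t y, p < t < q -> c <= y -> `|F t y| <= K * y `^ (-2)) ->
  (forall t y, p < t < q -> c <= y ->
     `|F t y - F s y| <= K * y `^ (-2) * `|Phi t - Phi s|) ->
  {within `[c, +oo[, continuous (F s)} ->
  is_derive s 1 Phi l -> is_derive s 1 b b' ->
  (forall y, c <= y -> is_derive s 1 (F ^~ y) (Q y)) ->
  is_derive s 1 (fun t => \int[mu]_(y in `[b t, +oo[) F t y)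
    (- b' * F s (b s) + \int[mu]_(y in `[b s, +oo[) Q y).
Proof.
move=> c0 K0 psq cb mF bF dF cF dPhi db dQ.
have iF t : p < t < q -> intg `[c, +oo[ (F t).
  move=> ptq; apply: integrable_dominated (integrable_tail K c0 (lexx c)) _ => //.
    exact: mF.
  by move=> y; rewrite /= in_itv/= andbT => cy; exact: bF.
have cbs := cb s psq.
have sub : `[b s, +oo[%classic `<=` `[c, +oo[%classic.
  by apply: subset_itvr; rewrite bnd_simp.
have d2 : is_derive s 1 (fun t => \int[mu]_(y in `[b s, +oo[) F t y)
    (\int[mu]_(y in `[b s, +oo[) Q y).
  apply: (derive_under_integral (rho := fun y => K * y `^ (-2)) _ psq) dPhi _ => //.
  - by move=> t ptq; apply: integrableS (iF t ptq).
  - exact: integrable_tail cbs.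
  - by move=> y _; rewrite mulr_ge0// powR_ge0.
  - by move=> t y ptq /sub; rewrite /= in_itv/= andbT => cy; exact: dF.
  - by move=> y /sub; rewrite /= in_itv/= andbT; exact: dQ.
have d1 : is_derive s 1 (fun t => \int[mu]_(y in `[b t, +oo[) F t y -
    \int[mu]_(y in `[b s, +oo[) F t y) (- b' * F s (b s)).
  apply: (derive_lower_limit (c := c) _ db).
    by apply: filterS (near_itvoo psq) => t ptq; split; [exact: cb|exact: iF].
  move=> e e0.
  have cPhi : Phi t @[t --> s] --> Phi s.
    by apply/differentiable_continuous/derivable1_diffP; case: dPhi.
  have cb' : b t @[t --> s] --> b s.
    by apply/differentiable_continuous/derivable1_diffP; case: db.
  pose K1 := K * c `^ (-2) + 1.
  have K10 : 0 < K1 by rewrite ltr_wpDl// mulr_ge0// powR_ge0.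
  have e1 : 0 < e / 2 / K1 by rewrite !divr_gt0.
  have e2 : 0 < e / 2 by rewrite divr_gt0.
  have n1 : \forall t \near s, `|Phi s - Phi t| < e / 2 / K1.
    by move/cvgrPdist_lt : cPhi; apply.
  have [d d0 hd] : exists2 d : R, 0 < d & forall y, c <= y -> `|y - b s| <= d ->
      `|F s y - F s (b s)| <= e / 2.
    have /cvgrPdist_le/(_ _ e2) : F s y @[y --> within `[c, +oo[ (nbhs (b s))] --> F s (b s).
      move/subspace_continuousP : cF => /(_ (b s)); apply.
      by rewrite /= in_itv/= cbs.
    move=> -[d /= d0 hd]; exists (d / 2); first by rewrite divr_gt0.
    move=> y cy yd; rewrite distrC; apply: hd; last by rewrite /= in_itv/= cy.
    by rewrite /ball/= distrC; lra.
  have n2 : \forall t \near s, `|b s - b t| < d by move/cvgrPdist_lt : cb'; apply.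
  near=> t => y cy yb.
  have -> : F t y - F s (b s) = (F t y - F s y) + (F s y - F s (b s)) by ring.
  apply: le_trans (ler_normD _ _) _; rewrite [leRHS](splitr e) lerD//.
    apply: (@le_trans _ _ (K1 * (e / 2 / K1))); last by rewrite mulrC divfK// gt_eqF.
    apply: (@le_trans _ _ (K * y `^ (-2) * `|Phi t - Phi s|)).
      by apply: dF => //; near: t; exact: near_itvoo.
    apply: ler_pM => //; first by rewrite mulr_ge0// powR_ge0.
      apply: (@le_trans _ _ (K * c `^ (-2))); last by rewrite lerDl.
      by rewrite ler_wpM2l// powR_anti//; lra.
    by rewrite distrC; apply: ltW; near: t.
  apply: hd => //; apply: le_trans yb _; rewrite distrC; apply: ltW; near: t.
  exact: n2.
by apply: near_eq_is_derive (is_deriveD d1 d2); near=> t; rewrite fctE /= subrK.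
Unshelve. all: by end_near. Qed.

Lemma moving_integral_incr (f1 f2 : R -> R) (c x1 x2 K D : R) : 0 < c -> 0 <= K ->
  c <= x1 -> c <= x2 ->
  measurable_fun `[c, +oo[ f1 -> measurable_fun `[c, +oo[ f2 ->
  (forall y, c <= y -> `|f1 y| <= K * y `^ (-2)) ->
  (forall y, c <= y -> `|f2 y| <= K * y `^ (-2)) ->
  (forall y, c <= y -> `|f2 y - f1 y| <= K * y `^ (-2) * D) ->
  `|\int[mu]_(y in `[x2, +oo[) f2 y - \int[mu]_(y in `[x1, +oo[) f1 y| <=
  (\int[mu]_(y in `[c, +oo[) (K * y `^ (-2))) * D + K * c `^ (-2) * `|x2 - x1|.
Proof.
move=> c0 K0 cx1 cx2 m1 m2 b1 b2 b12.
have dom (f : R -> R) : measurable_fun `[c, +oo[ f ->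
    (forall y, c <= y -> `|f y| <= K * y `^ (-2)) -> intg `[c, +oo[ f.
  move=> mf bf; apply: integrable_dominated (integrable_tail K c0 (lexx c)) _ => //.
  by move=> y; rewrite /= in_itv/= andbT => cy; exact: bf.
have i1 := dom _ m1 b1; have i2 := dom _ m2 b2.
have sub : `[x2, +oo[%classic `<=` `[c, +oo[.
  by apply: subset_itvr; rewrite bnd_simp.
have j1 : intg `[x2, +oo[ f1 by apply: integrableS i1.
have j2 : intg `[x2, +oo[ f2 by apply: integrableS i2.
have -> : \int[mu]_(y in `[x2, +oo[) f2 y - \int[mu]_(y in `[x1, +oo[) f1 y =
    \int[mu]_(y in `[x2, +oo[) (f2 y - f1 y) -
    (\int[mu]_(y in `[x1, +oo[) f1 y - \int[mu]_(y in `[x2, +oo[) f1 y).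
  by rewrite RintegralB//; ring.
apply: le_trans (ler_normB _ _) _; apply: lerD.
  apply: le_trans (le_normr_Rintegral _ _) _ => //; first exact: integrable_sub.
  have ia : intg `[c, +oo[ (fun y => `|f2 y - f1 y|).
    exact: integrable_abse (integrable_sub _ i2 i1).
  have ik : intg `[c, +oo[ (fun y => D * (K * y `^ (-2))).
    by apply: integrable_scale => //; exact: integrable_tail c0 (lexx c).
  apply: (@le_trans _ _ (\int[mu]_(y in `[c, +oo[) `|f2 y - f1 y|)).
    by rewrite -subr_ge0 (integral_tail (lexx c) cx2 ia); exact: Rintegral_ge0.
  rewrite mulrC -RintegralZl//; last exact: integrable_tail c0 (lexx c).
  apply: le_Rintegral => // y; rewrite /= in_itv/= andbT => cy.
  by rewrite mulrC; exact: b12.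
have := @tail_linear _ f1 c x1 x2 0 (K * c `^ (-2)) cx1 cx2 i1.
rewrite mul0r subr0; apply; first by rewrite mulr_ge0// powR_ge0.
move=> y cy _; rewrite subr0; apply: le_trans (b1 y cy) _.
by rewrite ler_wpM2l// powR_anti//; lra.
Qed.

(** The increments of the integrand in [s] are dominated by a locally integrable
    [phi]. Its integral plays the role of [Phi] in [derive_moving_integral], and
    together with the density of [b] it bounds the increments of the integral as
    [AC_criterion] requires. *)
Lemma moving_integral_AC (I : set R) (F Q : R -> R -> R) (b gb phi : R -> R) (c : R) :
  open I -> is_interval I -> 0 < c -> (forall s, I s -> c <= b s) ->
  locally_integrable I gb ->
  (forall s1 s2, I s1 -> I s2 -> s1 < s2 -> b s2 - b s1 = \int[mu]_(x in `[s1, s2]) gb x) ->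
  locally_integrable I phi ->
  (forall s, I s -> measurable_fun `[c, +oo[ (F s)) ->
  (forall p q, I p -> I q -> p < q -> exists K, forall s t y, p <= s -> s <= t -> t <= q ->
     c <= y -> `|F s y| <= K * y `^ (-2) /\
     `|F t y - F s y| <= K * y `^ (-2) * \int[mu]_(x in `[s, t]) phi x) ->
  {ae mu, forall s, I s -> {within `[c, +oo[, continuous (F s)}} ->
  {ae mu, forall s, I s -> forall y, c <= y -> is_derive s 1 (F ^~ y) (Q s y)} ->
  exists g, [/\ locally_integrable I g,
    forall s1 s2, I s1 -> I s2 -> s1 < s2 ->
      \int[mu]_(y in `[b s2, +oo[) F s2 y - \int[mu]_(y in `[b s1, +oo[) F s1 y =
      \int[mu]_(x in `[s1, s2]) g x &
    {ae mu, forall s, I s ->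
       g s = - gb s * F s (b s) + \int[mu]_(y in `[b s, +oo[) Q s y}].
Proof.
move=> oI iI c0 cb lgb dgb lphi mF dom cF dF.
have dom0 p q : I p -> I q -> p < q -> exists2 K, 0 <= K & forall s t y,
     p <= s -> s <= t -> t <= q ->
     c <= y -> `|F s y| <= K * y `^ (-2) /\
     `|F t y - F s y| <= K * y `^ (-2) * \int[mu]_(x in `[s, t]) phi x.
  move=> Ip Iq pq; have [K KP] := dom p q Ip Iq pq; exists K => //.
  have [h _] := KP p p c (lexx p) (lexx p) (ltW pq) (lexx c).
  by have := le_trans (normr_ge0 _) h; rewrite pmulr_lge0// powR_gt0.
apply: AC_criterion => //.
- move=> p q Ip Iq pq; have [K K0 KP] := dom0 p q Ip Iq pq.
  set J := \int[mu]_(y in `[c, +oo[) (K * y `^ (-2)).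
  have J0 : 0 <= J.
    by apply: Rintegral_ge0 => y _; rewrite mulr_ge0// powR_ge0.
  have iphi : intg `[p, q] (fun x => `|phi x|).
    exact: integrable_abse (L1loc_integrable iI lphi Ip Iq).
  have igb : intg `[p, q] (fun x => `|gb x|).
    exact: integrable_abse (L1loc_integrable iI lgb Ip Iq).
  exists (fun x => J * `|phi x| + K * c `^ (-2) * `|gb x|).
    by apply: integrable_add => //; apply: integrable_scale.
  move=> s t ps st tq.
  have Is : I s by apply: (iI p q) => //; rewrite ps (le_trans st).
  have It : I t by apply: (iI p q) => //; rewrite tq (le_trans ps).
  have jphi := integrable_subitv ps tq iphi.
  have jgb := integrable_subitv ps tq igb.
  have sphi : intg `[s, t] phi.
    by apply: (integrable_subitv ps tq); exact: (L1loc_integrable iI lphi Ip Iq).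
  rewrite RintegralD//; [|exact: integrable_scale|exact: integrable_scale].
  rewrite !RintegralZl//.
  apply: le_trans (moving_integral_incr c0 K0 (cb s Is) (cb t It) (mF s Is) (mF t It)
    _ _ (D := \int[mu]_(x in `[s, t]) phi x) _) _.
  + by move=> y cy; have [] := KP s t y ps st tq cy.
  + by move=> y cy; have [] := KP t t y (le_trans ps st) (lexx t) tq cy.
  + by move=> y cy; have [] := KP s t y ps st tq cy.
  apply: lerD; rewrite ler_wpM2l//.
  + by apply: le_trans (ler_norm _) _; exact: le_normr_Rintegral.
  + by rewrite mulr_ge0// powR_ge0.
  + exact: (density_dominated iI lgb Ip Iq).
apply: ae_local => // p q Ip Iq pq; have [K K0 KP] := dom0 p q Ip Iq pq.
have iphi := L1loc_integrable iI lphi Ip Iq.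
have Ipq t : p < t < q -> I t.
  by case/andP => pt tq; apply: (iI p q) => //; rewrite !ltW.
apply: (ae_mp2 (ae_mp2 (derive_integral pq iphi) (density_derive oI iI lgb dgb)
  (fun s h1 h2 => conj h1 h2)) (ae_mp2 cF dF (fun s h1 h2 => conj h1 h2))).
move=> s [dPhi db] [cFs dFs] psq; have Is := Ipq s psq.
apply: (derive_moving_integral c0 K0 psq _ _ _ _ (cFs Is) (dPhi psq) (db Is) (dFs Is)).
- by move=> t /Ipq; exact: cb.
- by move=> t /Ipq; exact: mF.
- move=> t y /andP[pt tq] cy.
  by have [] := KP t t y (ltW pt) (lexx t) (ltW tq) cy.
- have sp := integral_splitB iphi.
  move=> t y ptq cy; have [st|/ltW ts] := leP s t.
    have /andP[ps _] := psq; have /andP[_ tq] := ptq.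
    apply: le_trans (KP s t y (ltW ps) st (ltW tq) cy).2 _.
    by rewrite sp ?(ltW ps) ?(ltW tq)// ler_wpM2l ?ler_norm// mulr_ge0// powR_ge0.
  have /andP[_ sq] := psq; have /andP[pt _] := ptq.
  rewrite distrC; apply: le_trans (KP t s y (ltW pt) ts (ltW sq) cy).2 _.
  rewrite sp ?(ltW pt) ?(ltW sq)// distrC.
  by rewrite ler_wpM2l ?ler_norm// mulr_ge0// powR_ge0.
Qed.

(** [moving_integral_AC] for the real and the imaginary part. *)
Lemma moving_cintegral_AC (I : set R) (F Q : R -> R -> R[i]) (b gb phi : R -> R) (c : R) :
  open I -> is_interval I -> 0 < c -> (forall s, I s -> c <= b s) ->
  locally_integrable I gb ->
  (forall s1 s2, I s1 -> I s2 -> s1 < s2 -> b s2 - b s1 = \int[mu]_(x in `[s1, s2]) gb x) ->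
  locally_integrable I phi ->
  (forall s, I s -> cmeasurable `[c, +oo[ (F s)) ->
  (forall p q, I p -> I q -> p < q -> exists K, forall s t y, p <= s -> s <= t -> t <= q ->
     c <= y -> normc (F s y) <= K * y `^ (-2) /\
     normc (F t y - F s y) <= K * y `^ (-2) * \int[mu]_(x in `[s, t]) phi x) ->
  {ae mu, forall s, I s -> ccontinuous `[c, +oo[ (F s)} ->
  {ae mu, forall s, I s -> forall y, c <= y -> is_cderive (F ^~ y) s (Q s y)} ->
  exists g, [/\ L1loc I g,
    forall s1 s2, I s1 -> I s2 -> s1 < s2 ->
      cintegral `[b s2, +oo[ (F s2) - cintegral `[b s1, +oo[ (F s1) =
      cintegral `[s1, s2] g &
    {ae mu, forall s, I s ->
       g s = - (gb s)%:C * F s (b s) + cintegral `[b s, +oo[ (Q s)}].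
Proof.
move=> oI iI c0 cb lgb dgb lphi mF dom cF dF.
have part (T : R[i] -> R) : (forall z w, T (z - w) = T z - T w) ->
    (forall z, `|T z| <= normc z) ->
    (forall D f, cmeasurable D f -> measurable_fun D (T \o f)) ->
    (forall D f, ccontinuous D f -> {within D, continuous (T \o f)}) ->
    (forall f s l, is_cderive f s l -> is_derive s 1 (T \o f) (T l)) ->
    exists g, [/\ locally_integrable I g,
    forall s1 s2, I s1 -> I s2 -> s1 < s2 ->
      \int[mu]_(y in `[b s2, +oo[) T (F s2 y) - \int[mu]_(y in `[b s1, +oo[) T (F s1 y) =
      \int[mu]_(x in `[s1, s2]) g x &
    {ae mu, forall s, I s ->
       g s = - gb s * T (F s (b s)) + \int[mu]_(y in `[b s, +oo[) T (Q s y)}].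
  move=> TB Tn Tm Tc Td.
  apply: (@moving_integral_AC I (fun s y => T (F s y)) (fun s y => T (Q s y)) b gb phi c) => //.
  - by move=> s Is; apply: Tm; exact: mF.
  - move=> p q Ip Iq pq; have [K KP] := dom p q Ip Iq pq; exists K => s t y ps st tq cy.
    have [k1 k2] := KP s t y ps st tq cy; split; first exact: le_trans k1.
    by rewrite -TB; exact: le_trans k2.
  - by apply: (ae_mp cF) => s h Is; apply: Tc; exact: h.
  - by apply: (ae_mp dF) => s h Is y cy; apply: Td; exact: h.
have [||||| g1 [l1 i1 e1]] := part Re.
- by move=> z w; rewrite !ReImE.
- exact: normc_Re.
- by move=> D f [].
- by move=> D f [].
- by move=> f s l [].
have [||||| g2 [l2 i2 e2]] := part Im.
- by move=> z w; rewrite !ReImE.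
- exact: normc_Im.
- by move=> D f [].
- by move=> D f [].
- by move=> f s l [].
exists (fun s => g1 s +i* g2 s); split => //.
- by move=> s1 s2 I1 I2 s12; apply: complex_eq; rewrite !ReImE /cintegral /=;
    [exact: i1|exact: i2].
- apply: (ae_mp2 e1 e2) => s h1 h2 Is; apply: complex_eq; rewrite !ReImE.
    by rewrite h1// oppr0 mul0r subr0.
  by rewrite h2// oppr0 mul0r addr0.
Qed.
End MovingIntegral.

(** * Limits of families of absolutely continuous functions *)

Section ACLimit.
Context {R : realType}.
Local Notation mu := (@lebesgue_measure R).
Local Notation intg D f := (mu.-integrable D (EFin \o f)).
Local Notation Re := (@complex.Re R).
Local Notation Im := (@complex.Im R).
Local Notation normc := (@Normc.normc R).

(** Dominated convergence in [s] for the derivatives [X e y0] shows that the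
    increments of [Psi e y0] between any two points converge. The values
    themselves are known to converge at almost every point only; an exceptional
    point is reached from a good one close to it by such an increment. The
    density is the limit of [X] along one fixed sequence. *)
Lemma AC_limit (I : set R) (Psi X : R -> R -> R -> R) :
  open I -> is_interval I ->
  (forall e y0, 0 < e <= 1 -> exists g, [/\ locally_integrable I g,
     forall s1 s2, I s1 -> I s2 -> s1 < s2 ->
       Psi e y0 s2 - Psi e y0 s1 = \int[mu]_(x in `[s1, s2]) g x &
     {ae mu, forall s, I s -> g s = X e y0 s}]) ->
  (forall p q, I p -> I q -> p < q -> exists2 h, intg `[p, q] h &
     {ae mu, forall s, p <= s <= q -> forall e y0, 0 < e <= 1 ->
        `|X e y0 s| <= h s}) ->
  {ae mu, forall s, I s -> exists l : R, forall y0, X e y0 s @[e --> 0^'+] --> l} ->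
  {ae mu, forall s, I s -> exists L : R, forall y0, Psi e y0 s @[e --> 0^'+] --> L} ->
  exists psi g : R -> R, [/\
    forall s, I s -> forall y0, Psi e y0 s @[e --> 0^'+] --> psi s,
    locally_integrable I g,
    forall s1 s2, I s1 -> I s2 -> s1 < s2 ->
      psi s2 - psi s1 = \int[mu]_(x in `[s1, s2]) g x &
    {ae mu, forall s, I s -> forall y0, X e y0 s @[e --> 0^'+] --> g s}].
Proof.
move=> oI iI dPsi bX cX cPsi.
have mI : measurable I by exact: open_measurable.
have /choice[G GP] : forall z : R * R, exists g, 0 < z.1 <= 1 ->
    [/\ locally_integrable I g,
     forall s1 s2, I s1 -> I s2 -> s1 < s2 ->
       Psi z.1 z.2 s2 - Psi z.1 z.2 s1 = \int[mu]_(x in `[s1, s2]) g x &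
     {ae mu, forall s, I s -> g s = X z.1 z.2 s}].
  move=> z; have [z1|nz] := boolP (0 < z.1 <= 1); last by exists (fun=> 0).
  by have [g gP] := dPsi z.1 z.2 z1; exists g.
have aeG (u : R^nat) y0 : (forall k, 0 < u k <= 1) ->
    {ae mu, forall s, forall k, I s -> G (u k, y0) s = X (u k) y0 s}.
  by move=> u1; apply/ae_foralln => k; have [_ _] := GP (u k, y0) (u1 k).
have mG e y0 : 0 < e <= 1 -> measurable_fun I (G (e, y0)).
  by move=> e1; have [[] ] := GP (e, y0) e1.
pose u (k : nat) : R := k.+1%:R^-1.
have u1 k : 0 < u k <= 1 by rewrite invr_gt0 ltr0n invf_le1 ?ltr0n// ler1n.
have [g mg gP] := measurable_limit mI (fun k => mG (u k) 0 (u1 k)).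
have Xg : {ae mu, forall s, I s -> forall y0, X e y0 s @[e --> 0^'+] --> g s}.
  apply: (ae_mp2 cX (aeG u 0 u1)) => s cs Gs Is y0; have [l lP] := cs Is.
  suff -> : g s = l by exact: lP.
  apply: gP => //; under eq_fun do rewrite Gs//.
  exact: ((cvg_right01P (fun e => X e 0 s) l).1 (lP 0) u u1 cvg_harmonic).
have main s t y0 (v : R^nat) : I s -> I t -> s < t -> (forall k, 0 < v k <= 1) ->
    v @ \oo --> 0 -> intg `[s, t] g /\
    Psi (v k) y0 t - Psi (v k) y0 s @[k --> \oo] --> \int[mu]_(x in `[s, t]) g x.
  move=> Is It st v1 cv; have [h ih hP] := bX s t Is It st.
  have sI : `[s, t]%classic `<=` I by move=> x; rewrite /= in_itv/=; exact: iI.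
  have [||||||ig cg] := @Rintegral_dct_ae R `[s, t] (fun k => G (v k, y0)) g h.
  - by [].
  - by move=> k; apply: measurable_funS (mG _ _ (v1 k)).
  - exact: measurable_funS mg.
  - apply: (ae_mp2 Xg (aeG v y0 v1)) => x cx Gx xst.
    have Ix := sI _ xst.
    under eq_fun do rewrite Gx//.
    exact: ((cvg_right01P (fun e => X e y0 x) (g x)).1 (cx Ix y0) v v1 cv).
  - exact: ih.
  - apply: (ae_mp2 hP (aeG v y0 v1)) => x hx Gx k xst.
    by rewrite Gx; [apply: hx => //; move: xst; rewrite /= in_itv|exact: sI].
  split => //; apply: cvg_trans cg; apply: near_eq_cvg; near=> k.
  by have [_ -> //] := GP (v k, y0) (v1 k).
have lg : locally_integrable I g.
  apply: locally_integrable_segments => // p q Ip Iq pq.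
  by have [] := main p q 0 u Ip Iq pq u1 cvg_harmonic.
have cinc s t y0 : I s -> I t -> s < t ->
    Psi e y0 t - Psi e y0 s @[e --> 0^'+] --> \int[mu]_(x in `[s, t]) g x.
  move=> Is It st; apply/cvg_right01P => v v1 cv.
  by have [] := main s t y0 v Is It st v1 cv.
have /choice[psi psiP] : forall s, exists L : R, I s -> forall y0,
    Psi e y0 s @[e --> 0^'+] --> L.
  move=> s; have [Is|nI] := pselect (I s); last by exists 0.
  have [p [q [ps sq pqI]]] := open_has_cc oI Is.
  have [s' /andP[ps' s's] cs'] := ae_exists ps cPsi.
  have Is' : I s' by apply: pqI; rewrite (ltW ps') (ltW (lt_trans s's sq)).
  have [L LP] := cs' Is'.
  exists (L + \int[mu]_(x in `[s', s]) g x) => _ y0.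
  apply: cvg_trans (cvgD (LP y0) (cinc s' s y0 Is' Is s's)).
  by apply: near_eq_cvg; near=> e; rewrite fctE /= addrC subrK.
exists psi, g; split => //.
move=> s t Is It st.
have c := cvgB (psiP t It 0) (psiP s Is 0).
exact: (cvg_unique _ (c _) (cinc s t 0 Is It st)).
Unshelve. all: by end_near. Qed.

Lemma AC_climit (I : set R) (Psi X : R -> R -> R -> R[i]) :
  open I -> is_interval I ->
  (forall e y0, 0 < e <= 1 -> exists g, [/\ L1loc I g,
     forall s1 s2, I s1 -> I s2 -> s1 < s2 ->
       Psi e y0 s2 - Psi e y0 s1 = cintegral `[s1, s2] g &
     {ae mu, forall s, I s -> g s = X e y0 s}]) ->
  (forall p q, I p -> I q -> p < q -> exists2 h, intg `[p, q] h &
     {ae mu, forall s, p <= s <= q -> forall e y0, 0 < e <= 1 ->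
        normc (X e y0 s) <= h s}) ->
  {ae mu, forall s, I s -> exists l : R[i], forall y0, X e y0 s @[e --> 0^'+] --> l} ->
  {ae mu, forall s, I s -> exists L : R[i], forall y0, Psi e y0 s @[e --> 0^'+] --> L} ->
  exists psi g : R -> R[i], [/\
    forall s, I s -> forall y0, Psi e y0 s @[e --> 0^'+] --> psi s,
    L1loc I g,
    forall s1 s2, I s1 -> I s2 -> s1 < s2 ->
      psi s2 - psi s1 = cintegral `[s1, s2] g &
    {ae mu, forall s, I s -> forall y0, X e y0 s @[e --> 0^'+] --> g s}].
Proof.
move=> oI iI dPsi bX cX cPsi.
have part (T : R[i] -> R) : (forall z w, T (z - w) = T z - T w) ->
    (forall z, `|T z| <= normc z) ->
    (forall g, L1loc I g -> locally_integrable I (T \o g)) ->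
    (forall D g, T (cintegral D g) = \int[mu]_(x in D) T (g x)) ->
    (forall f (l : R[i]), f e @[e --> 0^'+] --> l ->
       T (f e) @[e --> (0 : R)^'+] --> T l) ->
    exists psi g : R -> R, [/\
    forall s, I s -> forall y0, T (Psi e y0 s) @[e --> 0^'+] --> psi s,
    locally_integrable I g,
    forall s1 s2, I s1 -> I s2 -> s1 < s2 ->
      psi s2 - psi s1 = \int[mu]_(x in `[s1, s2]) g x &
    {ae mu, forall s, I s -> forall y0, T (X e y0 s) @[e --> 0^'+] --> g s}].
  move=> TB Tn Tl Ti Tc.
  apply: (@AC_limit I (fun e y0 s => T (Psi e y0 s)) (fun e y0 s => T (X e y0 s))) => //.
  - move=> e y0 e1; have [g [lg ig Xg]] := dPsi e y0 e1; exists (T \o g); split.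
    + exact: Tl.
    + by move=> s1 s2 I1 I2 s12; rewrite -TB ig// Ti.
    + by apply: (ae_mp Xg) => s h Is /=; rewrite h.
  - move=> p q Ip Iq pq; have [h ih hP] := bX p q Ip Iq pq; exists h => //.
    by apply: (ae_mp hP) => s hs spq e y0 e1; apply: le_trans (Tn _) (hs _ _ _ _).
  - apply: (ae_mp cX) => s h Is; have [l lP] := h Is.
    by exists (T l) => y0; exact: Tc (lP y0).
  - apply: (ae_mp cPsi) => s h Is; have [l lP] := h Is.
    by exists (T l) => y0; exact: Tc (lP y0).
have [||||| psi1 [g1 [c1 l1 i1 e1]]] := part Re.
- by move=> z w; rewrite !ReImE.
- exact: normc_Re.
- by move=> g [].
- by [].
- by move=> f l /cvg_complexP[].
have [||||| psi2 [g2 [c2 l2 i2 e2]]] := part Im.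
- by move=> z w; rewrite !ReImE.
- exact: normc_Im.
- by move=> g [].
- by [].
- by move=> f l /cvg_complexP[].
exists (fun s => psi1 s +i* psi2 s), (fun s => g1 s +i* g2 s); split.
- by move=> s Is y0; apply/cvg_complexP; split; [exact: c1|exact: c2].
- by split.
- by move=> s1 s2 I1 I2 s12; apply: complex_eq; rewrite !ReImE /cintegral /=;
    [exact: i1|exact: i2].
- apply: (ae_mp2 e1 e2) => s h1 h2 Is y0.
  by apply/cvg_complexP; split; [exact: h1|exact: h2].
Qed.
End ACLimit.

(** * Absolutely continuous coefficients *)

Section Coefficients.
Context {R : realType}.
Local Notation mu := (@lebesgue_measure R).
Local Notation intg D f := (mu.-integrable D (EFin \o f)).
Local Notation Re := (@complex.Re R).
Local Notation Im := (@complex.Im R).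
Local Notation normc := (@Normc.normc R).

Lemma expi_lipschitz (u v : R) : normc (expi u - expi v) <= 2 * `|u - v|.
Proof.
wlog vu : u v / v <= u.
  move=> h; have [vu|/ltW uv] := leP v u; first exact: h.
  by rewrite normcB_sym distrC; exact: h.
have d x : is_cderive (@expi R) x ('i%C * 1%:C * expi x).
  exact: (@is_cderive_expi R id x 1 (is_derive_id x 1)).
have := @cMVT_le R (@expi R) (fun x => 'i%C * 1%:C * expi x) v u 1 vu.
rewrite mul1r ger0_norm ?subr_ge0//; apply.
- by apply: is_cderive_ccontinuous => x _; exact: d.
- by move=> x _; exact: d.
- by move=> x _; rewrite !Normc.normcM normc_expi normcR normr1 !mulr1 normci.
Qed.

Lemma normc_oscB (a a' e y0 y : R) :
  normc (osc a' e y0 y - osc a e y0 y) <=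
  expR (- e * (y - y0) ^+ 2) * (2 * (y ^+ 2 * `|a' - a|)).
Proof.
rewrite /osc -mulrBr Normc.normcM normcR ger0_norm ?expR_ge0// ler_wpM2l ?expR_ge0//.
apply: le_trans (expi_lipschitz _ _) _.
by rewrite -mulrBl normrM [`|y ^+ 2|]ger0_norm ?sqr_ge0// (mulrC (`|_|)).
Qed.

Lemma is_cderive_expi_param (a : R -> R) (y s l : R) : is_derive s 1 a l ->
  is_cderive (fun t => expi (a t * y ^+ 2)) s
    ('i%C * l%:C * (y%:C * y%:C) * expi (a s * y ^+ 2)).
Proof.
move=> da.
have d : is_derive s (1 : R) (fun t => a t * y ^+ 2) (l * (y * y)).
  apply: is_derive_eq (is_deriveM da (is_derive_cst (y ^+ 2) s 1)) _.
  by rewrite /GRing.scale/=; ring.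
by have := is_cderive_expi d; rewrite !rmorphM/= !mulrA.
Qed.

Lemma is_cderive_osc_param (a : R -> R) (e y0 y s l : R) :
  is_derive s 1 a l ->
  is_cderive (fun t => osc (a t) e y0 y) s
    ('i%C * l%:C * (y%:C * y%:C) * osc (a s) e y0 y).
Proof.
move=> da.
have := is_cderiveM (is_cderive_cst (expR (- e * (y - y0) ^+ 2))%:C s)
  (is_cderive_expi_param y da).
by rewrite mul0r add0r [X in is_cderive _ _ X -> _]mulrCA.
Qed.

(** Truncating [g] at height [B] changes it on a null set only. *)
Lemma Rintegral_ae_le (g : R -> R) (s t B : R) : s <= t -> intg `[s, t] g ->
  {ae mu, forall x, s <= x <= t -> `|g x| <= B} ->
  `|\int[mu]_(x in `[s, t]) g x| <= B * (t - s).
Proof.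
move=> st ig gB.
(* A negative [B] is impossible unless the segment is a point. *)
have [B0|B0] := leP 0 B; last first.
  move: st; rewrite le_eqVlt => /predU1P[->|st].
    rewrite subrr mulr0 set_itv1 /Rintegral integral_set1 /= normr0//.
  have [x /andP[sx xt] gx] := ae_exists st gB.
  have := le_trans (normr_ge0 _) (gx _); rewrite (ltW sx) (ltW xt) => /(_ isT).
  by rewrite leNgt B0.
pose h x := Num.max (- B) (Num.min (g x) B).
have hB x : `|h x| <= B.
  rewrite /h ler_norml le_max lexx/= ge_max ge_min lexx orbT andbT.
  by rewrite (le_trans _ B0)// oppr_le0.
have mh : measurable_fun `[s, t] h.
  apply: measurable_maxr => //; apply: measurable_minr => //.
  exact: integrable_measurable ig.
have [ih ->] : intg `[s, t] h /\
    \int[mu]_(x in `[s, t]) g x = \int[mu]_(x in `[s, t]) h x.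
  apply: ae_eq_Rintegral => //; apply: (ae_mp gB) => x gx.
  rewrite /= in_itv/= => /gx; rewrite ler_norml => /andP[g1 g2].
  by rewrite /h min_l// max_r.
rewrite -(Rintegral_itv_cst B st).
have ic := integrable_itv_cst s t B.
apply: le_trans (le_normr_Rintegral _ ih) _ => //.
apply: le_Rintegral => //.
by have := integrable_abse ih; apply.
Qed.

Lemma AC_cderive (I : set R) (u g : R -> R[i]) : open I -> is_interval I ->
  L1loc I g ->
  (forall s1 s2, I s1 -> I s2 -> s1 < s2 -> u s2 - u s1 = cintegral `[s1, s2] g) ->
  {ae mu, forall s, I s -> is_cderive u s (g s)}.
Proof.
move=> oI iI [l1 l2] du.
have d1 := @density_derive R I (fun s => Re (u s)) (fun s => Re (g s)) oI iI l1.
have d2 := @density_derive R I (fun s => Im (u s)) (fun s => Im (g s)) oI iI l2.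
apply: (ae_mp2 (d1 _) (d2 _)).
- move=> s1 s2 I1 I2 s12; have := congr1 Re (du s1 s2 I1 I2 s12).
  by rewrite !ReImE.
- move=> s1 s2 I1 I2 s12; have := congr1 Im (du s1 s2 I1 I2 s12).
  by rewrite !ReImE.
by move=> s h1 h2 Is; split; [exact: h1|exact: h2].
Qed.

(** Almost everywhere [derive_on I u] agrees with a density of [u], whose integrals
    are the increments. *)
Lemma AC_lipschitz (I : set R) (u : R -> R[i]) (p q B : R) : open I -> is_interval I ->
  AC_on I u -> I p -> I q ->
  {ae mu, forall s, p <= s <= q -> normc (derive_on I u s) <= B} ->
  forall s t, p <= s -> s <= t -> t <= q -> normc (u t - u s) <= 2 * (B * (t - s)).
Proof.
move=> oI iI [g lg dg] Ip Iq uB s t ps st tq.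
have dae := AC_cderive oI iI lg dg.
have Is : I s by apply: (iI p q) => //; rewrite ps (le_trans st).
have It : I t by apply: (iI p q) => //; rewrite tq (le_trans ps).
have gB : {ae mu, forall x, s <= x <= t -> normc (g x) <= B}.
  apply: (ae_mp2 dae uB) => x dx Bx /andP[sx xt].
  have Ix : I x by apply: (iI s t) => //; rewrite sx.
  have nI : nbhs x I by exact: open_nbhs_nbhs.
  have [_ <-] := is_cderive_derive_on nI (dx Ix).
  by apply: Bx; rewrite (le_trans ps) ?(le_trans xt).
have -> : u t - u s = cintegral `[s, t] g.
  move: st; rewrite le_eqVlt => /predU1P[<-|st]; last exact: dg.
  by rewrite subrr /cintegral set_itv1 /Rintegral !integral_set1.
apply: le_trans (normc_le _) _; rewrite mulr2n mulrDl mul1r.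
have [l1 l2] := lg.
apply: lerD; apply: Rintegral_ae_le => //.
- exact: (L1loc_integrable iI l1).
- by apply: (ae_mp gB) => x gx sxt; apply: le_trans (normc_Re _) (gx sxt).
- exact: (L1loc_integrable iI l2).
- by apply: (ae_mp gB) => x gx sxt; apply: le_trans (normc_Im _) (gx sxt).
Qed.

Lemma AC_density (I : set R) (a : R -> R) : AC_on I (fun s => (a s)%:C) ->
  exists2 g : R -> R, locally_integrable I g &
    forall s1 s2, I s1 -> I s2 -> s1 < s2 ->
      a s2 - a s1 = \int[mu]_(x in `[s1, s2]) g x.
Proof.
move=> [g [l1 _] dg]; exists (fun s => Re (g s)) => // s1 s2 I1 I2 s12.
by have := congr1 Re (dg s1 s2 I1 I2 s12); rewrite !ReImE.
Qed.

(** The bounds are recorded as values of [`|a|], because the lower one then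
    inherits positivity from [a s1 != 0]. *)
Lemma density_norm_bounds (I : set R) (a g : R -> R) (p q : R) : is_interval I ->
  locally_integrable I g ->
  (forall s1 s2, I s1 -> I s2 -> s1 < s2 ->
     a s2 - a s1 = \int[mu]_(x in `[s1, s2]) g x) ->
  I p -> I q -> p < q ->
  exists s1 s2, [/\ I s1, I s2 & forall s, p <= s <= q -> `|a s1| <= `|a s| <= `|a s2|].
Proof.
move=> iI lg dg Ip Iq pq.
have ig : intg `[p, q] (fun x => `|g x|).
  exact: integrable_abse (L1loc_integrable iI lg Ip Iq).
have ca := dominated_continuous pq ig (density_dominated iI lg Ip Iq dg).
have cn : {within `[p, q], continuous (fun s => `|a s|)}.
  by move=> x; apply: cvg_norm; exact: ca.
have K0 : `[p, q]%classic !=set0 by exists p; rewrite /= in_itv/= lexx ltW.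
have [s1 /set_mem K1 m1] := compact_EVT_min K0 (@segment_compact _ p q) cn.
have [s2 /set_mem K2 m2] := compact_EVT_max K0 (@segment_compact _ p q) cn.
exists s1, s2; split.
- by move: K1; rewrite /= in_itv/=; exact: iI.
- by move: K2; rewrite /= in_itv/=; exact: iI.
by move=> s spq; rewrite m1 ?m2// inE/= in_itv.
Qed.
End Coefficients.

(** * Regularized integrals and their derivatives *)

Section PhaseIntegral.
Context {R : realType}.
Local Notation mu := (@lebesgue_measure R).
Local Notation intg D f := (mu.-integrable D (EFin \o f)).
Local Notation Re := (@complex.Re R).
Local Notation Im := (@complex.Im R).
Local Notation normc := (@Normc.normc R).

(** For [g], [u] and [v] the values at [s] of [a'], [f] and of the derivative of
    [f] in [s], the function [w] is the derivative in [s] of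
    [exp(i a(s) y^2) f(s, y)] up to the exponential. Its constant is linear in
    [`|g|], and hence locally integrable in [s]. *)
Lemma symb_velocity (b0 g al M : R) (n : nat) (u v : R -> R[i]) : 0 < b0 -> 0 <= M ->
  symb b0 n (al + n%:R) M (fun _ _ => u) u ->
  symb b0 n (al + 2 + n%:R) M (fun _ _ => v) v ->
  let w y := 'i%C * g%:C * (y%:C * y%:C * u y) + v y in
  symb b0 n (al + 2 + n%:R) (2 ^+ n * (2 ^+ n * 2 ^+ n) * (1 + `|g|) * M)
    (fun _ _ => w) w.
Proof.
move=> b00 M0 su sv w.
have sc : symb b0 n 0 `|g| (fun _ _ _ => 'i%C * g%:C) (fun _ => 'i%C * g%:C).
  apply: (@symb_cst R b0 n `|g| (fun _ => 'i%C * g%:C)) => //; last exact: cvg_cst.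
  by move=> e _; rewrite Normc.normcM normci mul1r normcR.
have si := @symb_id R b0 n b00.
have s1 := symbM b00 sc (symbM b00 (symbM b00 si si) su).
have e1 : 0 + (1 + 1 + (al + n%:R)) = al + 2 + n%:R :> R by ring.
rewrite e1 in s1.
apply: symb_le (symbD s1 sv).
set P := 2 ^+ n : R.
have P1 : 1 <= P by rewrite exprn_ege1// ler1n.
have P3 : 1 <= P * (P * P) by rewrite mulr_ege1// mulr_ege1.
have -> : P * (`|g| * (P * (P * (1 * 1) * M))) + M = (P * (P * P)) * `|g| * M + 1 * M by ring.
have -> : P * (P * P) * (1 + `|g|) * M = P * (P * P) * `|g| * M + P * (P * P) * M by ring.
by rewrite lerD2l ler_wpM2r.
Qed.

Context (I : set R) (a b ga gb : R -> R) (b0 : R) (f : R -> R -> R[i])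
  (n : nat) (alpha : R).
Context (oI : open I) (iI : is_interval I).
Context (lga : locally_integrable I ga) (dga : forall s1 s2, I s1 -> I s2 -> s1 < s2 ->
  a s2 - a s1 = \int[mu]_(x in `[s1, s2]) ga x).
Context (lgb : locally_integrable I gb) (dgb : forall s1 s2, I s1 -> I s2 -> s1 < s2 ->
  b s2 - b s1 = \int[mu]_(x in `[s1, s2]) gb x).
Context (an0 : forall s, I s -> a s != 0) (b00 : 0 < b0)
  (bb0 : forall s, I s -> b0 <= b s).
Context (fAC : forall y, b0 <= y -> AC_on I (fun s => f s y)).
Context (alpha0 : 0 <= alpha) (alphan : alpha + 3 < n%:R).
Local Notation df s := (fun y => derive_on I (fun t => f t y) s).
Context (Cf : {ae mu, forall s, I s -> Cn_growth n alpha b0 (f s)}).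
Context (Cdf : {ae mu, forall s, I s ->
  (forall y, b0 <= y -> derivable_on I (fun t => f t y) s) /\
  Cn_growth n (alpha + 2) b0 (df s)}).
Context (Nf : ae_locally_bounded I (fun s => Cn_growth_norm n alpha b0 (f s))).
Context (Ndf : ae_locally_bounded I (fun s => Cn_growth_norm n (alpha + 2) b0 (df s))).

(* [F] is the regularized integrand, [Q] its derivative in [s], and [X] the
   derivative in [s] of the integral of [F] over [[b s, +oo[]. *)
Local Notation F e y0 s := (fun y => osc (a s) e y0 y * f s y).
Local Notation vel s := (fun y => 'i%C * (ga s)%:C * (y%:C * y%:C * f s y) + df s y).
Local Notation Q e y0 s := (fun y => osc (a s) e y0 y * vel s y).
Local Notation X e y0 s := (- (gb s)%:C * F e y0 s (b s) +
  cintegral `[b s, +oo[ (Q e y0 s)).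
Local Notation gam := (alpha + 2 + n%:R).

Lemma growth_ae (p q : R) : I p -> I q -> exists2 M, 0 <= M &
  {ae mu, forall s, p <= s <= q ->
    [/\ symb b0 n (alpha + n%:R) M (fun _ _ => f s) (f s),
        symb b0 n gam M (fun _ _ => df s) (df s) &
        forall y, b0 <= y -> is_cderive (fun t => f t y) s (df s y)]}.
Proof.
move=> Ip Iq; have pqI x : p <= x <= q -> I x := interval_sub_cc iI Ip Iq.
have [M1 h1] := ae_bounded_compact Nf pqI.
have [M2 h2] := ae_bounded_compact Ndf pqI.
exists (3 ^+ n * (`|M1| + `|M2|)); first by rewrite mulr_ge0 ?exprn_ge0// addr_ge0.
apply: (ae_mp2 (ae_mp2 h1 h2 (fun s k1 k2 => conj k1 k2))
  (ae_mp2 Cf Cdf (fun s k1 k2 => conj k1 k2))) => s [N1 N2] [C1 C2] spq.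
have Is := pqI s spq; have [C3 C4] := C2 Is; split.
- apply: growth_symb => //; first exact: C1.
  by apply: le_trans (N1 spq) _; rewrite lee_fin (le_trans (ler_norm _))// lerDl.
- apply: growth_symb => //; first by rewrite addr_ge0.
  by apply: le_trans (N2 spq) _; rewrite lee_fin (le_trans (ler_norm _))// lerDr.
- by move=> y cy; apply: derivable_on_is_cderive; [exact: open_nbhs_nbhs|exact: C3].
Qed.

(** These bounds hold at every [s], while the regularity in [y] is only given at
    almost every [s]: the derivative of [f] in [s] is of order [gam] almost
    everywhere, so that [f(., y)] is Lipschitz with a constant of that order, and
    a single good point [s0] controls all others. *)
Lemma data_bound (p q : R) : I p -> I q -> p < q -> exists2 K, 0 <= K &
  forall s t y, p <= s -> s <= t -> t <= q -> b0 <= y ->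
    normc (f s y) <= K * y `^ gam /\
    normc (f t y - f s y) <= K * y `^ gam * (t - s).
Proof.
move=> Ip Iq pq; have [M M0 hM] := growth_ae Ip Iq.
have lip s t y : p <= s -> s <= t -> t <= q -> b0 <= y ->
    normc (f t y - f s y) <= 2 * M * y `^ gam * (t - s).
  move=> ps st tq cy; rewrite -!mulrA [M * (_ * _)]mulrA.
  apply: (AC_lipschitz (u := fun t => f t y) oI iI (fAC cy) Ip Iq) => //.
  apply: (ae_mp hM) => x hx /hx [_ sx _].
  exact: (symb_bound sx 0 itv01_1 cy).
have [s0 /andP[ps0 s0q] hs0] := ae_exists pq hM.
have [sf _ _] := hs0 ltac:(by rewrite !ltW).
exists (M * b0 `^ (-2) + 2 * M * (q - p) + 2 * M).
  by rewrite !addr_ge0 ?mulr_ge0// ?powR_ge0// subr_ge0 ltW.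
move=> s t y ps st tq cy.
have y0 := lt_le_trans b00 cy.
have yg : 0 <= y `^ gam by exact: powR_ge0.
have k1 : 0 <= M * b0 `^ (-2) by rewrite mulr_ge0// powR_ge0.
have k2 : 0 <= 2 * M * (q - p) by rewrite !mulr_ge0// subr_ge0 ltW.
have k3 : 0 <= 2 * M by rewrite mulr_ge0.
split; last first.
  apply: le_trans (lip s t y ps st tq cy) _.
  by rewrite ler_wpM2r ?subr_ge0// ler_wpM2r// lerDr addr_ge0.
have -> : f s y = f s0 y + (f s y - f s0 y) by rewrite addrC subrK.
apply: le_trans (le_normcD _ _) _.
rewrite mulrDl -[leLHS]addr0; apply: lerD; last by rewrite mulr_ge0.
rewrite mulrDl; apply: lerD.
  apply: le_trans (symb_bound sf 0 itv01_1 cy) _.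
  have -> : alpha + n%:R = gam + (-2) by ring.
  rewrite powR_add// -mulrA ler_wpM2l// mulrC ler_wpM2r//.
  by apply: powR_anti => //; lra.
have mono d : d <= q - p -> 2 * M * y `^ gam * d <= 2 * M * (q - p) * y `^ gam.
  by move=> dqp; rewrite mulrAC ler_wpM2r// ler_wpM2l.
have sq := le_trans st tq.
have [ss0|/ltW s0s] := leP s s0.
  rewrite normcB_sym; apply: le_trans (lip s s0 y ps ss0 (ltW s0q) cy) _.
  by apply: mono; lra.
apply: le_trans (lip s0 s y (ltW ps0) s0s sq cy) _.
by apply: mono; lra.
Qed.

(** At an exceptional [s], the function [f s] is the pointwise limit of the
    continuous functions [f (u k)] at good points [u k] that tend to [s]. *)
Lemma data_measurable s : I s -> cmeasurable `[b0, +oo[ (f s).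
Proof.
move=> Is; have [p [q [ps sq pqI]]] := open_has_cc oI Is.
have Ip : I p by apply: pqI; rewrite lexx ltW// (lt_trans ps).
have [K K0 hK] := data_bound Ip Is ps.
have [M M0 hM] := growth_ae Ip Is.
have /choice[u uP] : forall k : nat, exists x : R, [/\ p <= x, x <= s,
    s - x <= k.+1%:R^-1 & ccontinuous `[b0, +oo[ (f x)].
  move=> k; pose p' := Num.max p (s - k.+1%:R^-1).
  have p's : p' < s by rewrite gt_max ps ltrBlDr ltrDl invr_gt0 ltr0n.
  have [x /andP[px xs] hx] := ae_exists p's hM.
  move: px; rewrite gt_max => /andP[px kx].
  exists x; split; [exact: ltW|exact: ltW|by rewrite lerBlDr -lerBlDl ltW|].
  have [sx _ _] := hx ltac:(by rewrite !ltW).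
  exact: (symb_cont sx 0 itv01_1).
have cu y : b0 <= y -> f (u k) y @[k --> \oo] --> f s y.
  move=> cy; apply/cvg_normcP.
  apply: (@squeeze_cvgr _ _ _ _ (fun _ => 0) (fun k => K * y `^ gam * k.+1%:R^-1)).
  - apply: nearW => k; rewrite normc_ge0/=; have [pu us du _] := uP k.
    rewrite normcB_sym; apply: le_trans (hK (u k) s y pu us (lexx s) cy).2 _.
    by rewrite ler_wpM2l// mulr_ge0// powR_ge0.
  - exact: cvg_cst.
  - rewrite -[Z in _ --> Z](mulr0 (K * y `^ gam)).
    by apply: cvgM; [exact: cvg_cst|exact: cvg_harmonic].
have mu_ k : cmeasurable `[b0, +oo[ (f (u k)).
  by apply: ccontinuous_measurable => //; have [] := uP k.
split.
  apply: (measurable_fun_cvg (h := fun k y => Re (f (u k) y))).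
    by move=> k; have [] := mu_ k.
  by move=> y; rewrite /= in_itv/= andbT => /cu /cvg_complexP[].
apply: (measurable_fun_cvg (h := fun k y => Im (f (u k) y))).
  by move=> k; have [] := mu_ k.
by move=> y; rewrite /= in_itv/= andbT => /cu /cvg_complexP[].
Qed.

Lemma integrand_measurable (e y0 s : R) : I s -> cmeasurable `[b0, +oo[ (F e y0 s).
Proof.
move=> Is; apply: cmeasurableM; last exact: data_measurable.
by apply: ccontinuous_measurable => //; exact: ccontinuous_osc.
Qed.

(** The Gaussian absorbs every power of [y], and in particular the factor [y^2]
    in the increments of [exp(i a(s) y^2)]. *)
Lemma integrand_dominated (e y0 p q : R) : 0 < e -> I p -> I q -> p < q ->
  exists K, forall s t y, p <= s -> s <= t -> t <= q -> b0 <= y ->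
    normc (F e y0 s y) <= K * y `^ (-2) /\
    normc (F e y0 t y - F e y0 s y) <=
      K * y `^ (-2) * \int[mu]_(x in `[s, t]) (`|ga x| + 1).
Proof.
move=> e0 Ip Iq pq; have [M M0 hM] := data_bound Ip Iq pq.
have [K1 K10 h1] := gauss_decay y0 gam e0 b00.
have [K2 K20 h2] := gauss_decay y0 (gam + 2) e0 b00.
exists (M * K1 + 2 * M * K2) => s t y ps st tq cy.
have yp := lt_le_trans b00 cy.
have [fs fts] := hM s t y ps st tq cy.
have [ft _] := hM t t y (le_trans ps st) (lexx t) tq cy.
set E := expR (- e * (y - y0) ^+ 2).
have E0 : 0 <= E by exact: expR_ge0.
have w0 : 0 <= y `^ (-2) by exact: powR_ge0.
have g1 : E * y `^ gam <= K1 * y `^ (-2) by exact: h1.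
have g2 : E * (y ^+ 2 * y `^ gam) <= K2 * y `^ (-2).
  apply: le_trans (h2 y cy); rewrite ler_wpM2l// (powR_add gam 2 yp) mulrC.
  by rewrite -powR_mulrn// ltW.
split.
  rewrite Normc.normcM normc_osc -/E.
  apply: (@le_trans _ _ (E * (M * y `^ gam))); first by rewrite ler_wpM2l.
  rewrite mulrCA mulrDl -[leLHS]addr0; apply: lerD.
    by rewrite -[leRHS]mulrA ler_wpM2l.
  by rewrite !mulr_ge0.
have Is : I s by apply: (interval_sub_cc iI Ip Iq) => //; rewrite ps (le_trans st).
have It : I t by apply: (interval_sub_cc iI Ip Iq) => //; rewrite tq (le_trans ps).
have ig : intg `[s, t] (fun x => `|ga x|).
  exact: integrable_abse (L1loc_integrable iI lga Is It).
have i1 := integrable_itv_cst s t (1 : R).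
have -> : \int[mu]_(x in `[s, t]) (`|ga x| + 1) =
    \int[mu]_(x in `[s, t]) `|ga x| + (t - s).
  by rewrite RintegralD// Rintegral_itv_cst// mul1r.
have da : `|a t - a s| <= \int[mu]_(x in `[s, t]) `|ga x|.
  exact: (density_dominated iI lga Ip Iq dga).
set A := \int[mu]_(x in `[s, t]) `|ga x| in da *.
have A0 : 0 <= A := le_trans (normr_ge0 _) da.
have ts0 : 0 <= t - s by rewrite subr_ge0.
have -> : osc (a t) e y0 y * f t y - osc (a s) e y0 y * f s y =
    (osc (a t) e y0 y - osc (a s) e y0 y) * f t y +
    osc (a s) e y0 y * (f t y - f s y) by ring.
apply: le_trans (le_normcD _ _) _; rewrite [normc (_ * f t y)]Normc.normcM.
rewrite [normc (osc _ _ _ _ * _)]Normc.normcM normc_osc -/E.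
have b1 : normc (osc (a t) e y0 y - osc (a s) e y0 y) * normc (f t y) <=
    2 * M * K2 * y `^ (-2) * A.
  apply: (@le_trans _ _ ((E * (2 * (y ^+ 2 * A))) * (M * y `^ gam))).
    apply: ler_pM => //; [exact: normc_ge0|exact: normc_ge0|].
    apply: le_trans (normc_oscB _ _ _ _ _) _; rewrite -/E ler_wpM2l// ler_wpM2l//.
    by rewrite ler_wpM2l// sqr_ge0.
  have -> : (E * (2 * (y ^+ 2 * A))) * (M * y `^ gam) =
    2 * M * A * (E * (y ^+ 2 * y `^ gam)) by ring.
  have -> : 2 * M * K2 * y `^ (-2) * A = 2 * M * A * (K2 * y `^ (-2)) by ring.
  by rewrite ler_wpM2l// !mulr_ge0.
have b2 : E * normc (f t y - f s y) <= M * K1 * y `^ (-2) * (t - s).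
  apply: (@le_trans _ _ (E * (M * y `^ gam * (t - s)))); first by rewrite ler_wpM2l.
  have -> : E * (M * y `^ gam * (t - s)) = M * (t - s) * (E * y `^ gam) by ring.
  have -> : M * K1 * y `^ (-2) * (t - s) = M * (t - s) * (K1 * y `^ (-2)) by ring.
  by rewrite ler_wpM2l// mulr_ge0.
apply: le_trans (lerD b1 b2) _.
have -> : (M * K1 + 2 * M * K2) * y `^ (-2) * (A + (t - s)) =
  2 * M * K2 * y `^ (-2) * A + M * K1 * y `^ (-2) * (t - s) +
  (M * K1 * y `^ (-2) * A + 2 * M * K2 * y `^ (-2) * (t - s)) by ring.
by rewrite lerDl addr_ge0// !mulr_ge0.
Qed.

Lemma data_derivable_ae : {ae mu, forall s, I s ->
  [/\ is_derive s 1 a (ga s), is_derive s 1 b (gb s),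
      ccontinuous `[b0, +oo[ (f s) &
      forall y, b0 <= y -> is_cderive (fun t => f t y) s (df s y)]}.
Proof.
have h : {ae mu, forall s, I s -> ccontinuous `[b0, +oo[ (f s) /\
    forall y, b0 <= y -> is_cderive (fun t => f t y) s (df s y)}.
  apply: ae_local => // p q Ip Iq pq; have [M M0 hM] := growth_ae Ip Iq.
  apply: (ae_mp hM) => s hs /andP[ps sq].
  have [sf _ d] := hs ltac:(by rewrite !ltW); split => //.
  exact: (symb_cont sf 0 itv01_1).
apply: (ae_mp3 (density_derive oI iI lga dga) (density_derive oI iI lgb dgb) h).
by move=> s h1 h2 h3 Is; have [h4 h5] := h3 Is; split => //; [exact: h1|exact: h2].
Qed.

Lemma regularized_AC (e y0 : R) : 0 < e -> exists g, [/\ L1loc I g,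
  forall s1 s2, I s1 -> I s2 -> s1 < s2 ->
    cintegral `[b s2, +oo[ (F e y0 s2) - cintegral `[b s1, +oo[ (F e y0 s1) =
    cintegral `[s1, s2] g &
  {ae mu, forall s, I s -> g s = X e y0 s}].
Proof.
move=> e0.
apply: (@moving_cintegral_AC R I (fun s => F e y0 s) (fun s => Q e y0 s) b gb
  (fun x => `|ga x| + 1) b0 oI iI b00 bb0 lgb dgb).
- apply: locally_integrable_segments => //.
    have [mga _ _] := lga; apply: measurable_funD; last exact: measurable_cst.
    exact: measurableT_comp.
  move=> p q Ip Iq pq; apply: integrable_add => //.
    exact: integrable_abse (L1loc_integrable iI lga Ip Iq).
  exact: integrable_itv_cst.
- exact: integrand_measurable.
- by move=> p q Ip Iq pq; exact: integrand_dominated.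
- apply: (ae_mp data_derivable_ae) => s hs Is; have [_ _ cf _] := hs Is.
  by apply: ccontinuousM => //; exact: ccontinuous_osc.
- apply: (ae_mp data_derivable_ae) => s hs Is y cy; have [da _ _ dfs] := hs Is.
  have := is_cderiveM (is_cderive_osc_param e y0 y da) (dfs y cy).
  by rewrite (_ : _ + _ = osc (a s) e y0 y * vel s y)//; ring.
Qed.

(** This is where [n > alpha + 3] is needed: the amplitude of [Q] has order
    [alpha + 2 + n] and [n] derivatives, so that [osc_integral_symb] asks for
    [alpha + 2 + n + 1 < 2 n]. The bound [h] is linear in [a'] and [b'], which are
    locally integrable. *)
Lemma osc_estimates_ae (p q : R) : I p -> I q -> p < q -> exists2 h, intg `[p, q] h &
  {ae mu, forall s, p <= s <= q ->
    [/\ forall e y0, 0 < e <= 1 -> normc (X e y0 s) <= h s,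
        exists l : R[i], forall y0,
          cintegral `[b s, +oo[ (Q e y0 s) @[e --> 0^'+] --> l &
        exists L : R[i], forall y0,
          cintegral `[b s, +oo[ (F e y0 s) @[e --> 0^'+] --> L]}.
Proof.
move=> Ip Iq pq; have [M M0 hM] := growth_ae Ip Iq.
have pqI x : p <= x <= q -> I x := interval_sub_cc iI Ip Iq.
have [s1 [s2 [Is1 _ ha]]] := density_norm_bounds iI lga dga Ip Iq pq.
have [s4 [s3 [_ _ hb]]] := density_norm_bounds iI lgb dgb Ip Iq pq.
have A0 : 0 < `|a s1| by rewrite normr_gt0 an0.
have n1 : gam + 1 < (2 * n)%:R by move: alphan; rewrite mul2n -addnn natrD; lra.
have n2 : alpha + n%:R + 1 < (2 * n)%:R by move: alphan; rewrite mul2n -addnn natrD; lra.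
have [C1 C10 h1] := osc_integral_symb `|a s2| `|b s3| A0 b00 n1.
have [C2 C20 h2] := osc_integral_symb `|a s2| `|b s3| A0 b00 n2.
set P := 2 ^+ n * (2 ^+ n * 2 ^+ n) : R.
pose B := `|b s3| `^ (alpha + n%:R).
exists (fun s => M * B * `|gb s| + C1 * P * M * (1 + `|ga s|)).
  have ig : intg `[p, q] (fun x => `|ga x|).
    exact: integrable_abse (L1loc_integrable iI lga Ip Iq).
  have ib : intg `[p, q] (fun x => `|gb x|).
    exact: integrable_abse (L1loc_integrable iI lgb Ip Iq).
  apply: integrable_add => //; apply: integrable_scale => //.
  by apply: integrable_add => //; exact: integrable_itv_cst.
apply: (ae_mp hM) => s hs spq; have [sf sdf _] := hs spq.
have Is := pqI s spq.
have cb := bb0 Is.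
have bs : b0 <= b s <= `|b s3|.
  by rewrite cb/= (le_trans (ler_norm _))//; case/andP: (hb s spq).
have sv := symbW cb (symb_velocity (ga s) b00 M0 sf sdf).
have [bd1 l1] := h1 (a s) (b s) _ _ _ (ha s spq) bs sv.
have [_ l2] := h2 (a s) (b s) _ _ _ (ha s spq) bs (symbW cb sf).
split => // e y0 e1.
apply: le_trans (le_normcD _ _) _; apply: lerD.
  rewrite Normc.normcM normcN normcR mulrC ler_wpM2r// Normc.normcM.
  apply: (@le_trans _ _ (1 * (M * b s `^ (alpha + n%:R)))).
    apply: ler_pM; [exact: normc_ge0|exact: normc_ge0| |].
      by apply: normc_osc_le1; case/andP: e1 => /ltW.
    exact: (symb_bound sf 0 itv01_1 cb).
  rewrite mul1r ler_wpM2l//; apply: ge0_ler_powR.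
  - by rewrite addr_ge0.
  - by rewrite nnegrE (le_trans (ltW b00)).
  - by rewrite nnegrE.
  - by case/andP: bs.
apply: le_trans (bd1 e y0 e1) _.
by rewrite -/P [leLHS](_ : _ = C1 * P * M * (1 + `|ga s|))//; ring.
Qed.
Lemma regularized_limit : exists psi g : R -> R[i], [/\
  forall s, I s -> forall y0,
    cintegral `[b s, +oo[ (F e y0 s) @[e --> 0^'+] --> psi s,
  L1loc I g,
  forall s1 s2, I s1 -> I s2 -> s1 < s2 -> psi s2 - psi s1 = cintegral `[s1, s2] g &
  {ae mu, forall s, I s -> forall y0, X e y0 s @[e --> 0^'+] --> g s}].
Proof.
apply: (@AC_climit R I (fun e y0 s => cintegral `[b s, +oo[ (F e y0 s))
  (fun e y0 s => X e y0 s) oI iI).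
- by move=> e y0 /andP[e0 _]; exact: regularized_AC.
- move=> p q Ip Iq pq; have [h ih hP] := osc_estimates_ae Ip Iq pq; exists h => //.
  by apply: (ae_mp hP) => s hs spq; have [h1 _ _] := hs spq.
- apply: ae_local => // p q Ip Iq pq; have [h ih hP] := osc_estimates_ae Ip Iq pq.
  apply: (ae_mp hP) => s hs /andP[ps sq].
  have [_ [l lP] _] := hs ltac:(by rewrite !ltW).
  exists (- (gb s)%:C * (expi (a s * b s ^+ 2) * f s (b s)) + l) => y0.
  apply: cvgD (lP y0); apply: cvgM; first exact: cvg_cst.
  by apply: cvgM; [exact: cvg_osc|exact: cvg_cst].
- apply: ae_local => // p q Ip Iq pq; have [h ih hP] := osc_estimates_ae Ip Iq pq.
  apply: (ae_mp hP) => s hs /andP[ps sq].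
  by have [_ _ hL] := hs ltac:(by rewrite !ltW).
Qed.

Lemma integrand_integrable (e y0 s : R) : 0 < e -> I s -> cintegrable `[b s, +oo[ (F e y0 s).
Proof.
move=> e0 Is; have [p [q [ps sq pqI]]] := open_has_cc oI Is.
have Ip : I p by apply: pqI; rewrite lexx ltW// (lt_trans ps).
have [K K0 hK] := data_bound Ip Is ps.
have sub : `[b s, +oo[%classic `<=` `[b0, +oo[%classic.
  by apply: subset_itvr; rewrite bnd_simp; exact: bb0.
have [m1 m2] := data_measurable Is.
apply: (@osc_integrable R (a s) e y0 (b s) gam K (f s) e0 (lt_le_trans b00 (bb0 Is)) K0).
- by split; [exact: measurable_funS m1|exact: measurable_funS m2].
- move=> y by_; have cy := le_trans (bb0 Is) by_.
  by have [] := hK s s y (ltW ps) (lexx s) (lexx s) cy.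
Qed.

Lemma integrand_derivable_ae : {ae mu, forall s, I s ->
  [/\ forall y, b0 <= y ->
        is_cderive (fun t => expi (a t * y ^+ 2) * f t y) s
          (expi (a s * y ^+ 2) * vel s y),
      forall e y0, 0 < e -> cintegrable `[b s, +oo[ (Q e y0 s) &
      exists l : R[i], forall y0,
        cintegral `[b s, +oo[ (Q e y0 s) @[e --> 0^'+] --> l]}.
Proof.
apply: ae_local => // p q Ip Iq pq.
have [h ih hP] := osc_estimates_ae Ip Iq pq; have [M M0 hM] := growth_ae Ip Iq.
apply: (ae_mp3 hP hM data_derivable_ae) => s h1 h2 h3 /andP[ps sq].
have spq : p <= s <= q by rewrite !ltW.
have Is := interval_sub_cc iI Ip Iq spq.
have [_ hl _] := h1 spq; have [sf sdf _] := h2 spq; have [da _ _ dfs] := h3 Is.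
have sv := symbW (bb0 Is) (symb_velocity (ga s) b00 M0 sf sdf).
split => //.
- move=> y cy; have := is_cderiveM (is_cderive_expi_param y da) (dfs y cy).
  by rewrite (_ : _ + _ = expi (a s * y ^+ 2) * vel s y)//; ring.
- move=> e y0 e0.
  have bs0 : 0 < b s := lt_le_trans b00 (bb0 Is).
  apply: (@osc_integrable R (a s) e y0 (b s) gam _ _ e0 bs0 (symb_ge0 bs0 sv)).
    by apply: ccontinuous_measurable => //; exact: (symb_cont sv 0 itv01_1).
  by move=> y by_; exact: (symb_bound sv 0 itv01_1 by_).
Qed.
End PhaseIntegral.

(** * The oscillatory integral and its derivative *)

Theorem theorem3p7 (R : realType) (I : set R) (a b : R -> R) (b0 : R)
    (f : R -> R -> R[i]) (n : nat) (alpha : R) :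
  open I -> is_interval I ->
  AC_on I (fun s => (a s)%:C) -> AC_on I (fun s => (b s)%:C) ->
  (forall s, I s -> a s != 0) ->
  0 < b0 -> (forall s, I s -> b0 <= b s) ->
  (forall y, b0 <= y -> AC_on I (fun s => f s y)) ->
  0 <= alpha -> alpha + 3 < n%:R ->
  {ae lebesgue_measure, forall s, I s -> Cn_growth n alpha b0 (f s)} ->
  {ae lebesgue_measure, forall s, I s ->
     (forall y, b0 <= y -> derivable_on I (fun t => f t y) s) /\
     Cn_growth n (alpha + 2) b0 (fun y => derive_on I (fun t => f t y) s)} ->
  ae_locally_bounded I (fun s => Cn_growth_norm n alpha b0 (f s)) ->
  ae_locally_bounded I (fun s =>
    Cn_growth_norm n (alpha + 2) b0 (fun y => derive_on I (fun t => f t y) s)) ->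
  exists psi : R -> R[i],
    [/\ forall s, I s -> forall y0,
          is_osc_integral (b s) y0 (fun y => expi (a s * y ^+ 2) * f s y)
            (psi s),
        AC_on I psi &
        {ae lebesgue_measure, forall s, I s ->
          [/\ derivable_on I psi s,
              derivable b s 1,
              forall y, b s <= y ->
                derivable_on I (fun t => expi (a t * y ^+ 2) * f t y) s &
              exists2 l : R[i],
                forall y0, is_osc_integral (b s) y0
                  (fun y => derive_on I
                     (fun t => expi (a t * y ^+ 2) * f t y) s) l &
                derive_on I psi s =
                  - ('D_1 b s)%:C * expi (a s * b s ^+ 2) * f s (b s) + l]}].
Proof.
move=> oI iI /AC_density[ga lga dga] /AC_density[gb lgb dgb] an0 b00 bb0 fAC
  alpha0 alphan Cf Cdf Nf Ndf.
have [psi [g [cpsi lg dg Xg]]] := regularized_limit oI iI lga dga lgb dgb an0 b00 bb0 fAC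
  alpha0 alphan Cf Cdf Nf Ndf.
have iF (e y0 s : R) := @integrand_integrable R I a b b0 f n alpha oI iI b00 bb0 fAC
  alpha0 Cf Cdf Nf Ndf e y0 s.
exists psi; split.
- move=> s Is y0; split; first by move=> e e0; rewrite osc_gauss_reg; exact: iF.
  by under eq_fun do rewrite osc_gauss_reg; exact: cpsi.
- by exists g.
have dae := integrand_derivable_ae oI iI lga dga lgb dgb an0 b00 bb0 alpha0 alphan Cf Cdf Nf Ndf.
have good := data_derivable_ae oI iI lga dga lgb dgb b00 alpha0 Cf Cdf Nf Ndf.
apply: (ae_mp2 (ae_mp2 (AC_cderive oI iI lg dg) Xg (fun s h1 h2 => conj h1 h2))
  (ae_mp2 dae good (fun s h1 h2 => conj h1 h2))) => s [dpsi Xs] [ds gs] Is.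
have [dint iQ [l lP]] := ds Is; have [_ db _ _] := gs Is.
have nI : nbhs s I by exact: open_nbhs_nbhs.
have [psi1 psi2] := is_cderive_derive_on nI (dpsi Is).
have dE y : b s <= y -> derivable_on I (fun t => expi (a t * y ^+ 2) * f t y) s /\
    derive_on I (fun t => expi (a t * y ^+ 2) * f t y) s =
    expi (a s * y ^+ 2) * ('i%C * (ga s)%:C * (y%:C * y%:C * f s y) +
      derive_on I (fun t => f t y) s).
  by move=> by_; apply: is_cderive_derive_on => //; apply: dint; exact: le_trans (bb0 s Is) by_.
have regE e y0 y : `[b s, +oo[%classic y ->
    osc (a s) e y0 y * ('i%C * (ga s)%:C * (y%:C * y%:C * f s y) +
      derive_on I (fun t => f t y) s) =
    gauss_reg e y0 (fun y => derive_on I (fun t => expi (a t * y ^+ 2) * f t y) s) y.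
  rewrite /= in_itv/= andbT => by_; have [_ E] := dE y by_.
  by rewrite /gauss_reg E; exact/esym/mulrA.
split; first exact: psi1.
- by case: db.
- by move=> y by_; have [] := dE y by_.
exists l.
  move=> y0; split.
    by move=> e e0; apply: eq_cintegrable (iQ e y0 e0) => // y; exact: regE.
  apply: cvg_trans (lP y0); apply: near_eq_cvg; near=> e.
  by apply: eq_cintegral => y; exact: regE.
(* Both sides are the limit of the derivatives of the regularized integrals. *)
rewrite psi2 [in RHS](derive_val (is_derive := db)) -mulrA.
apply: (cvg_unique (@complex_hausdorff R) (Xs Is 0)).
apply: cvgD (lP 0); apply: cvgM; first exact: cvg_cst.
by apply: cvgM; [exact: cvg_osc|exact: cvg_cst].
Unshelve. all: by end_near. Qed.
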